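(* Let $X\subseteq\mathbb{P}^r$ be a quasi-projective variety of dimension $n\ge 1$. The sequence $\{\mathfrak{c}_1,\mathfrak{c}_2,\dots\}$ of ranks of the sheaves $R_i$ is strictly decreasing to a stable number, i.e. there is $m\ge 1$ with $\mathfrak{c}_1>\mathfrak{c}_2>\dots>\mathfrak{c}_m=\mathfrak{c}_{m+1}=\dots$, such that (1) either $\mathfrak{c}_m=0$, $R_m=0$, and $X$ is not contained in any proper linear subspace of $\mathbb{P}^r$; or (2) there exists a subspace $W\subseteq V$ of dimension $\mathfrak{c}_m$ such that $R_m\otimes L=W\otimes\mathcal{O}_X$, this sheaf is contained in $R_i\otimes L$ for all $i\ge 0$, and $X$ is contained in the linear space $\mathbb{P}(V/W)\subseteq\mathbb{P}^r$.
   Context: Work over $\mathbb{C}$; a variety is separated, reduced, irreducible, of finite type over $\mathbb{C}$. Let $L=\mathcal{O}_X(1)$, $V=H^0(\mathbb{P}^r,\mathcal{O}_{\mathbb{P}^r}(1))$; $\mathbb{P}(V)=\mathbb{P}^r$ denotes the space of one-dimensional quotients, so $\mathbb{P}(V/W)$ is the linear subspace cut out by the linear forms in $W$. For $k\ge 0$ let $P^k(L)=pr_{1,*}\big((\mathcal{O}_{X\times X}/I_\Delta^{k+1})\otimes pr_2^*L\big)$ be the sheaf of $k$-th order principal parts ($\mathcal{O}_X$-module via $pr_1$), with universal differential operator $d^k_L:L\to P^k(L)$ induced by $pr_2$. The Taylor series map is the $\mathcal{O}_X$-linear map $\alpha_k:V\otimes\mathcal{O}_X\to P^k(L)$, $T\otimes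 a\mapsto a\,d^k_L(T|_X)$. Put $R_k=(\ker\alpha_k)\otimes L^*$ and $\mathfrak{c}_k=\operatorname{rank}R_k$ (so $R_k\otimes L=\ker\alpha_k\subseteq V\otimes\mathcal{O}_X$). *)

(* Defs.v *)
From HB Require Import structures.
From mathcomp Require Import all_boot all_order all_algebra.
From mathcomp Require Import boolp classical_sets reals.
From mathcomp Require Import complex mpoly.

Set Implicit Arguments.
Unset Strict Implicit.
Unset Printing Implicit Defensive.

Import GRing.Theory.
Local Open Scope classical_set_scope.
Local Open Scope ring_scope.
Local Open Scope complex_scope.

(* A point of P^r is given by homogeneous coordinates, i.e. by a nonzero      *)
(* vector; subsets of P^r and of P^r x P^r are identified with their cones    *)
(* (stable under independent rescaling of each vector). Varieties are reduced,*)
(* so they are given by their closed points, and sections of O_X(d) are       *)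
(* functions on the cone. A section over U is represented by a total function *)
(* whose values off U are irrelevant: sections are equal when they agree on U.*)
Notation coords R r := 'rV[R[i]]_r.+1.

(* V = H^0(P^r, O(1)): a linear form is given by its coefficients.            *)
Notation linforms R r := 'rV[R[i]]_r.+1.

Section Projective.
Context {R : realType} {r : nat}.
Local Notation C := (R[i]).
Local Notation pt := (coords R r).
Local Notation V := (linforms R r).
Implicit Types (X U Z : set pt) (O : set (pt * pt)).

Definition heval (p : {mpoly C[r.+1]}) (x : pt) : C := p.@[fun i => x 0 i].

Definition lin_eval (T : V) (x : pt) : C := \sum_i T 0 i * x 0 i.

Definition projective_space : set pt := [set x | x != 0].

Definition zclosed Z := exists S : set {mpoly C[r.+1]},
  (forall p, S p -> exists d, p \is d.-homog) /\
  Z = [set x | x != 0 /\ forall p, S p -> heval p x = 0].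

Definition closed_in X Z := exists2 Z', zclosed Z' & Z = X `&` Z'.

Definition open_in X U := exists2 Z', zclosed Z' & U = X `\` Z'.

Definition locally_closed X :=
  exists Z1 Z2, [/\ zclosed Z1, zclosed Z2 & X = Z1 `\` Z2].

Definition irreducible_set X := X !=set0 /\
  forall Z1 Z2, zclosed Z1 -> zclosed Z2 -> X `<=` Z1 `|` Z2 ->
    X `<=` Z1 \/ X `<=` Z2.

Definition quasi_projective_variety X := locally_closed X /\ irreducible_set X.

Definition irreducible_chain X (n : nat) := exists Z : nat -> set pt,
  (forall i, (i <= n)%N -> closed_in X (Z i) /\ irreducible_set (Z i)) /\
  (forall i, (i < n)%N -> Z i `<` Z i.+1).

Definition has_dimension X (n : nat) :=
  irreducible_chain X n /\ ~ irreducible_chain X n.+1.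

(* Sections of O_X(d) over U.                                                 *)
Definition regular X (d : int) U (f : pt -> C) := forall x, U x ->
  exists (U' : set pt) (d1 d2 : nat) (p q : {mpoly C[r.+1]}),
  [/\ open_in X U', U' x & U' `<=` U] /\
  [/\ p \is d1.-homog, q \is d2.-homog & d1%:Z = d2%:Z + d] /\
  forall u, U' u -> heval q u != 0 /\ f u = heval p u / heval q u.

(* The first (last) r+1 variables are the coordinates on the first (second)   *)
(* factor of P^r x P^r.                                                       *)
Definition bihomog (a b : nat) (p : {mpoly C[r.+1 + r.+1]}) :=
  forall m, m \in msupp p ->
    (\sum_i m (lshift r.+1 i) = a)%N /\ (\sum_i m (rshift r.+1 i) = b)%N.

Definition bieval (p : {mpoly C[r.+1 + r.+1]}) (z : pt * pt) : C :=
  p.@[fun i => row_mx z.1 z.2 0 i].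

Definition zclosed2 (Z : set (pt * pt)) :=
  exists S : set {mpoly C[r.+1 + r.+1]},
  (forall p, S p -> exists a b, bihomog a b p) /\
  Z = [set z | [/\ z.1 != 0, z.2 != 0 & forall p, S p -> bieval p z = 0]].

(* Zariski topology of the product variety X x X.                             *)
Definition open_in2 X O := exists2 Z, zclosed2 Z & O = (X `*` X) `\` Z.

(* Sections of O_{X x X} over O.                                              *)
Definition regular2 X O (h : pt * pt -> C) := forall z, O z ->
  exists (O' : set (pt * pt)) (a b : nat) (p q : {mpoly C[r.+1 + r.+1]}),
  [/\ open_in2 X O', O' z & O' `<=` O] /\
  (bihomog a b p /\ bihomog a b q) /\
  forall w, O' w -> bieval q w != 0 /\ h w = bieval p w / bieval q w.

(* Sections of I_Delta, the kernel of O_{X x X} -> O_Delta.                   *)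
Definition diag_ideal X O (h : pt * pt -> C) :=
  regular2 X O h /\ forall x, O (x, x) -> h (x, x) = 0.

(* Sections of pr_2^* L for L = O_X(1): locally, finite sums of h * pr_2^*(l).*)
Definition pr2L X O (s : pt * pt -> C) := forall z, O z ->
  exists (O' : set (pt * pt)) (U : set pt) (c : nat)
         (h : 'I_c -> pt * pt -> C) (l : 'I_c -> pt -> C),
  [/\ open_in2 X O', O' z & O' `<=` O] /\
  (open_in X U /\ forall w, O' w -> U w.2) /\
  (forall j, regular2 X O' (h j) /\ regular X 1 U (l j)) /\
  forall w, O' w -> s w = \sum_(j < c) h j w * l j w.2.

(* Sections of I_Delta^e * pr_2^* L.                                          *)
Definition diag_powerL X (e : nat) O (s : pt * pt -> C) := forall z, O z ->
  exists (O' : set (pt * pt)) (c : nat)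
         (h : 'I_c -> 'I_e -> pt * pt -> C) (t : 'I_c -> pt * pt -> C),
  [/\ open_in2 X O', O' z & O' `<=` O] /\
  (forall j, (forall l, diag_ideal X O' (h j l)) /\ pr2L X O' (t j)) /\
  forall w, O' w -> s w = \sum_(j < c) (\prod_(l < e) h j l w) * t j w.

(* The element represented by s in the stalk at z of                          *)
(*   (O_{X x X} / I_Delta^(k+1)) (x) pr_2^* L                                 *)
(*     = pr_2^* L / I_Delta^(k+1) pr_2^* L,                                   *)
(* namely its coset, as a set of representatives defined near z.              *)
Definition pp_germ X (k : nat) (s : pt * pt -> C) (z : pt * pt) :
    set (pt * pt -> C) :=
  [set t | exists O, [/\ open_in2 X O, O z, pr2L X O t &
                         diag_powerL X k.+1 O (fun w => t w - s w)]].

(* A family of stalk elements; the sections of P^k(L) over U are the families *)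
(* indexed by U x X that are locally induced by sections of pr_2^* L.         *)
Definition pp_family := pt * pt -> set (pt * pt -> C).

Definition principal_parts X (k : nat) U (phi : pp_family) :=
  forall z, (U `*` X) z -> exists (O : set (pt * pt)) (s : pt * pt -> C),
  [/\ open_in2 X O, O z, O `<=` U `*` X, pr2L X O s &
      forall w, O w -> phi w = pp_germ X k s w].

Definition pp_zero X k : pp_family := pp_germ X k (fun=> 0).

Definition pp_add (phi psi : pp_family) : pp_family := fun z =>
  [set t | exists t1 t2, [/\ phi z t1, psi z t2 & t = fun w => t1 w + t2 w]].

(* The O_X-module structure via pr_1.                                         *)
Definition pp_scale X k (a : pt -> C) (phi : pp_family) : pp_family := fun z =>
  [set t | exists2 t1, phi z t1 & pp_germ X k (fun w => a w.1 * t1 w) z t].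

(* The universal differential operator d^k_L : L -> P^k(L).                   *)
Definition universal_diff X k (l : pt -> C) : pp_family :=
  pp_germ X k (fun w => l w.2).

(* A sheaf on X is represented by its sections over each open set of X. All   *)
(* the sheaves of modules below are subsheaves of some V (x) O_X(d), whose    *)
(* sections are V-valued functions.                                           *)
Definition sheaf := set pt -> set (pt -> V).

Definition Vtensor X (d : int) : sheaf := fun U =>
  [set s | forall i, regular X d U (fun x => s x 0 i)].

(* s = \sum_i T_i (x) s_i in the basis of coordinate forms T_i of V.          *)
Definition taylor_map X k (s : pt -> V) : pp_family :=
  \big[pp_add/pp_zero X k]_(i < r.+1)
    pp_scale X k (fun x => s x 0 i)
      (universal_diff X k (lin_eval (delta_mx 0 i))).

Definition taylor_kernel X (k : nat) : sheaf := fun U =>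
  [set s | Vtensor X 0 U s /\
           forall z, (U `*` X) z -> taylor_map X k s z = pp_zero X k z].

(* F (x) O_X(d), for F a subsheaf of some V (x) O_X(e), as a subsheaf of      *)
(* V (x) O_X(e + d): locally, finite sums of sections g (x) t.                *)
Definition twist X (d : int) (F : sheaf) : sheaf := fun U =>
  [set s | forall x, U x ->
    exists (U' : set pt) (c : nat) (g : 'I_c -> pt -> C) (t : 'I_c -> pt -> V),
    [/\ open_in X U', U' x & U' `<=` U] /\
    (forall j, regular X d U' (g j) /\ F U' (t j)) /\
    forall u, U' u -> s u = \sum_(j < c) g j u *: t j u].

(* R_k = ker(alpha_k) (x) L^*.                                                *)
Definition Rsheaf X (k : nat) : sheaf := twist X (-1) (taylor_kernel X k).

(* Linear independence, over the function field, of the germs of the s j at   *)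
(* the generic point of X.                                                    *)
Definition generically_free X U (c : nat) (s : 'I_c -> pt -> V) :=
  forall (U' : set pt) (f : 'I_c -> pt -> C),
    open_in X U' -> U' !=set0 -> U' `<=` U ->
    (forall j, regular X 0 U' (f j)) ->
    (forall u, U' u -> \sum_(j < c) f j u *: s j u = 0) ->
    forall j u, U' u -> f j u = 0.

Definition generic_free_family X (F : sheaf) (c : nat) :=
  exists (U : set pt) (s : 'I_c -> pt -> V),
  [/\ open_in X U, U !=set0, forall j, F U (s j) & generically_free X U s].

(* The dimension of the generic stalk of F over the function field of X.      *)
Definition has_rank X (F : sheaf) (c : nat) :=
  generic_free_family X F c /\ ~ generic_free_family X F c.+1.

Definition sheaf_sub X (F G : sheaf) := forall U, open_in X U -> F U `<=` G U.

Definition sheaf_eq X (F G : sheaf) := forall U, open_in X U -> F U = G U.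

Definition sheaf_zero X (F : sheaf) := forall U, open_in X U ->
  forall s, F U s -> forall x, U x -> s x = 0.

(* W (x) O_X, a section being written in a basis of W.                        *)
Definition Wtensor X (W : {vspace V}) : sheaf := fun U =>
  [set s | exists f : 'I_(\dim W) -> pt -> C,
    (forall j, regular X 0 U (f j)) /\
    forall x, U x -> s x = \sum_j f j x *: (vbasis W)`_j].

(* P(V/W), the linear subspace cut out by the linear forms in W.              *)
Definition lin_subspace (W : {vspace V}) : set pt :=
  [set x | x != 0 /\ forall T, T \in W -> lin_eval T x = 0].

End Projective.

(* Main.v *)
Require Import Defs.
From HB Require Import structures.
From mathcomp Require Import all_boot all_order all_algebra.
From mathcomp Require Import boolp classical_sets reals.
From mathcomp Require Import complex mpoly.
From mathcomp Require Import ring zify.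

(** The Taylor kernels are computed at the generic point. Let K be the function
    field of X, x in K^(r+1) the generic point (normalized so that one
    coordinate is 1), J the ideal of X and m the ideal of the point x in K[Y].
    The generic stalk of ker(alpha_k) is
      D_k = { v in K^(r+1) | \sum_i v_i Y_i \in m^(k+1) + J K[Y] },
    so c_k = dim D_k is nonincreasing. A C-derivation of K, acting on
    coefficients, preserves J K[Y] and maps m^(k+2) into m^(k+1), hence maps
    D_(k+1) into D_k. If c_k = c_(k+1), then D_k is stable under all
    derivations; a basis of D_k that is the identity in some set of columns is
    then killed by all derivations, so it has entries in C (in characteristic 0
    an element transcendental over C is moved by some derivation). Thus
    D_k = W (x) K, where W is forced to be the space of linear forms vanishing
    on X; since W (x) K lies in every D_i, the sequence is constant from k on. *)

Set Implicit Arguments.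
Unset Strict Implicit.
Unset Printing Implicit Defensive.

Import GRing.Theory.
Local Open Scope classical_set_scope.
Local Open Scope ring_scope.
Local Open Scope complex_scope.

(** * Derivations of a field extension *)

(** Sections are functions on cones and principal parts are cosets of germs on X x X, so most of the
    work is a dictionary between these and K[Y]. All r+1 variables are kept: points of a chart are
    scaled to have coordinate 1 at [i0], so J contains Y_i0 - 1 and linear forms restrict to affine
    functions on the chart. Two facts let germs be read as polynomials. A polynomial over K that
    vanishes at all complex points of the chart lies in J K[Y], so a function vanishing on X x X
    contributes only to J K[Y]. A polynomial nonzero at the generic point is a unit modulo m^(k+1) +
    J K[Y], so denominators cancel without localizing. In the other direction the generators of m
    and of J lift to explicit functions on X x X, which turns a vector of D_k into a section of
    ker(alpha_k) over an open set. Derivations of K are produced by Zorn's lemma, one element at a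
    time, without a transcendence basis. *)

Section Derivations.
Variables (k K : fieldType) (iota : {rmorphism k -> K}).

(** [D] is a bare function because it is chosen from a maximal graph; it is bundled as an additive
    map only where it has to act on the coefficients of polynomials. *)
Definition derivation (D : K -> K) :=
  [/\ forall a b, D (a + b) = D a + D b,
      forall a b, D (a * b) = D a * b + a * D b &
      forall c, D (iota c) = 0].

(* The graph of a derivation defined on a k-subalgebra of K.                  *)
Definition partial_derivation (G : set (K * K)) :=
  [/\ forall c, G (iota c, 0),
      forall a b, G a -> G b -> G (a.1 + b.1, a.2 + b.2),
      forall a b, G a -> G b -> G (a.1 * b.1, a.2 * b.1 + a.1 * b.2) &
      forall b, G (0, b) -> b = 0].

(** * Extending a partial derivation by one element *)

Section Extension.
Variables (G : set (K * K)) (hG : partial_derivation G) (a : K).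

(** Read: p has coefficients in the domain of [G], and q is p^D, the derivation applied to each
    coefficient. *)
Let over (p q : {poly K}) := forall i, G (p`_i, q`_i).

Let G0 : G (0, 0).
Proof. by case: hG => h _ _ _; have := h 0; rewrite rmorph0. Qed.

Let GD u v u' v' : G (u, v) -> G (u', v') -> G (u + u', v + v').
Proof. by case: hG => _ h _ _; exact: h. Qed.

Let GM u v u' v' : G (u, v) -> G (u', v') -> G (u * u', v * u' + u * v').
Proof. by case: hG => _ _ h _; exact: h. Qed.

Let GN u v : G (u, v) -> G (- u, - v).
Proof.
case: hG => h _ _ _; have := h (-1); rewrite rmorphN1 => /GM h1 /h1.
by rewrite !mulN1r mul0r add0r.
Qed.

Let overD p q p' q' : over p q -> over p' q' -> over (p + p') (q + q').
Proof. by move=> h h' i; rewrite !coefD; exact: GD. Qed.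

Let overN p q : over p q -> over (- p) (- q).
Proof. by move=> h i; rewrite !coefN; exact: GN. Qed.

Let overM p q p' q' :
  over p q -> over p' q' -> over (p * p') (q * p' + p * q').
Proof.
move=> h h' i; rewrite coefD !coefM -big_split /=.
elim/big_ind2: _ => //= [? ? ? ? ? ?|j _]; [exact: GD|exact: GM].
Qed.

Let overC u v : G (u, v) -> over u%:P v%:P.
Proof. by move=> h i; rewrite !coefC; case: eqP. Qed.

Let overXn d : over 'X^d 0.
Proof.
move=> i; rewrite coefXn coef0; case: eqP => //= _.
by case: hG => h _ _ _; have := h 1; rewrite rmorph1.
Qed.

Let over_deriv p q : over p q -> over p^`() q^`().
Proof.
move=> h i; rewrite !coef_deriv; move: (h i.+1).
move: (p`_i.+1) (q`_i.+1) => u v guv; move: (i.+1) => m.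
elim: m => [|n IH]; first by rewrite !mulr0n.
by rewrite !mulrS; exact: GD.
Qed.

Section Value.
Variable b : K.

(** For q = p^D this is p^D(a) + p'(a) b, the value at p(a) forced on any extension that sends a to
    b. *)
Let E (p q : {poly K}) := q.[a] + p^`().[a] * b.

Let ED p q p' q' : E (p + p') (q + q') = E p q + E p' q'.
Proof. by rewrite /E derivD !hornerD; ring. Qed.

Let EN p q : E (- p) (- q) = - E p q.
Proof. by rewrite /E derivN !hornerN; ring. Qed.

Let EM p q p' q' :
  E (p * p') (q * p' + p * q') = E p q * p'.[a] + p.[a] * E p' q'.
Proof. by rewrite /E derivM !(hornerD, hornerM); ring. Qed.

Definition adjoin_graph : set (K * K) :=
  [set z | exists p q, over p q /\ z = (p.[a], E p q)].

Lemma adjoin_graph_sub : G `<=` adjoin_graph.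
Proof.
move=> [u v] h; exists u%:P, v%:P; split; first exact: overC.
by rewrite /E derivC !hornerE ?(mul0r, addr0).
Qed.

Lemma adjoin_graph_gen : adjoin_graph (a, b).
Proof.
exists 'X, 0; split; first exact: (overXn 1).
by rewrite /E derivX !hornerE ?(mul1r, add0r).
Qed.

(** The only obstruction is well-definedness: the value must depend on p(a) alone, which by
    additivity is a condition on the relations p(a) = 0. *)
Lemma adjoin_graph_derivation :
  (forall p q, over p q -> p.[a] = 0 -> E p q = 0) ->
  partial_derivation adjoin_graph.
Proof.
move=> hE; split.
- by move=> c; apply: adjoin_graph_sub; case: hG.
- move=> _ _ [p [q [h ->]]] [p' [q' [h' ->]]] /=.
  exists (p + p'), (q + q'); split; first exact: overD.
  by rewrite ED hornerD.
- move=> _ _ [p [q [h ->]]] [p' [q' [h' ->]]] /=.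
  exists (p * p'), (q * p' + p * q'); split; first exact: overM.
  by rewrite EM hornerM.
- by move=> c [p [q [h [hp ->]]]]; apply: hE.
Qed.

(* Pseudo-division by an annihilator of least degree.                         *)
Lemma extension_criterion P Q : over P Q -> P != 0 -> P.[a] = 0 ->
  (forall p q, over p q -> p != 0 -> p.[a] = 0 -> (size P <= size p)%N) ->
  E P Q = 0 -> forall p q, over p q -> p.[a] = 0 -> E p q = 0.
Proof.
move=> oP nP Pa minP EP p q; move: {2}(size p) (leqnn (size p)) => n.
elim: n p q => [|n IH] p q szp op pa; have [p0|np] := eqVneq p 0.
- move: szp op pa; rewrite p0 => _ op _; rewrite /E derivC horner0 mul0r addr0.
  suff -> : q = 0 by rewrite horner0.
  by apply/polyP => i; rewrite coef0; case: hG => _ _ _; apply; have := op i;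
    rewrite coef0.
- by move: szp; rewrite leqn0 size_poly_eq0 (negbTE np).
- move: szp op pa; rewrite p0 => _ op _; rewrite /E derivC horner0 mul0r addr0.
  suff -> : q = 0 by rewrite horner0.
  by apply/polyP => i; rewrite coef0; case: hG => _ _ _; apply; have := op i;
    rewrite coef0.
have le := minP _ _ op np pa.
pose d := (size p - size P)%N.
(* The domain of [G] is only a ring, so leading coefficients are cross-multiplied, not inverted. As
   p(a), P(a) and [E P Q] vanish, [E] of the combination is lead_coef P times [E p q], and the
   nonzero factor cancels in K. *)
have oL : over (lead_coef P)%:P (Q`_(size P).-1)%:P by apply: overC; exact: oP.
have oM : over (lead_coef p)%:P (q`_(size p).-1)%:P by apply: overC; exact: op.
have o1 := overM oL op; have o2 := overM (overM oM (overXn d)) oP.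
have o3 := overD o1 (overN o2).
have ev : ((lead_coef P)%:P * p - (lead_coef p)%:P * 'X^d * P).[a] = 0.
  by rewrite !hornerE pa Pa !mulr0 subr0.
suff sz : (size ((lead_coef P)%:P * p - (lead_coef p)%:P * 'X^d * P)%R <= n)%N.
  have := IH _ _ sz o3 ev.
  rewrite ED EN !EM pa Pa EP !(mulr0, add0r, addr0, oppr0) hornerC.
  by move/eqP; rewrite mulf_eq0 lead_coef_eq0 (negbTE nP) /= => /eqP.
apply: (@leq_trans (size p).-1); last first.
  by rewrite -ltnS (leq_trans _ szp) // ltn_predL size_poly_gt0.
have sp0 : (0 < size p)%N by rewrite size_poly_gt0.
have sP0 : (0 < size P)%N by rewrite size_poly_gt0.
apply/leq_sizeP => j hj; rewrite coefB -mulrA !coefCM mulrC -commr_polyXn coefMXn.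
have dj : (d <= j)%N.
  by apply: leq_trans hj; rewrite /d -subn1 leq_sub2l.
rewrite ltnNge dj /=.
have [jE|jN] := eqVneq j (size p).-1.
  have -> : (j - d)%N = (size P).-1.
    by rewrite jE /d -!subn1 subnAC subKn.
  by rewrite jE mulrC subrr.
have jp : (size p <= j)%N.
  by rewrite leqNgt; apply/negP => lt; case/negP: jN; rewrite eqn_leq hj andbT -ltnS prednK.
rewrite [p`_j]nth_default // [P`_(j - d)]nth_default ?mul0r ?mulr0 ?subrr //.
by rewrite leq_subRL // /d subnK.
Qed.

End Value.

(** If a satisfies no nonzero relation over the domain, every b works and 0 is taken. Otherwise a
    relation P of least degree forces b = - P^D(a) / P'(a), and minimality passes the compatibility
    on to all relations. *)
Lemma partial_derivation_extend : (forall n, n.+1%:R != 0 :> K) ->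
  exists b, partial_derivation (adjoin_graph b).
Proof.
move=> char0.
have [ex|nex] := pselect (exists n, `[< exists p q,
    [/\ over p q, p != 0, p.[a] = 0 & size p = n] >]); last first.
  exists 0; apply: adjoin_graph_derivation => p q op pa.
  have p0 : p = 0.
    apply/eqP; apply/negPn/negP => np; apply: nex.
    by exists (size p); apply/asboolP; exists p, q.
  rewrite p0 derivC horner0 mul0r addr0.
  suff -> : q = 0 by rewrite horner0.
  by apply/polyP => i; rewrite coef0; case: hG => _ _ _; apply; have := op i;
    rewrite p0 coef0.
case: (ex_minnP ex) => n /asboolP [P [Q [oP nP Pa szP]]] minP.
have min p q : over p q -> p != 0 -> p.[a] = 0 -> (size P <= size p)%N.
  by move=> op np pa; rewrite szP; apply: minP; apply/asboolP; exists p, q.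
(* By minimality P' vanishes at a only if P' = 0; in characteristic 0, P is then a constant with a
   root, hence zero. *)
have dP : P^`().[a] != 0.
  apply/eqP => dPa; have [d0|nd] := eqVneq P^`() 0; last first.
    by have := min _ _ (over_deriv oP) nd dPa; rewrite leqNgt lt_size_deriv.
  have : (size P <= 1)%N.
    apply/leq_sizeP => -[|j] // _; have := congr1 (fun p : {poly K} => p`_j) d0.
    rewrite coef_deriv coef0 -mulr_natr => /eqP; rewrite mulf_eq0.
    by rewrite (negbTE (char0 j)) orbF => /eqP.
  move=> /size1_polyC Pc; move: Pa nP; rewrite Pc hornerC => ->.
  by rewrite eqxx.
exists (- Q.[a] / P^`().[a]); apply: adjoin_graph_derivation.
apply: (@extension_criterion _ P Q) => //.
by rewrite [_ * (_ / _)]mulrC divfK // subrr.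
Qed.

End Extension.

(** Start from d/dg on k[g], which is well defined because g is transcendental over k, and take a
    maximal extension; it is defined on all of K, since any missing element could still be
    adjoined. *)
Lemma exists_derivation (g : K) : (forall n, n.+1%:R != 0 :> K) ->
  (forall p : {poly k}, (map_poly iota p).[g] = 0 -> p = 0) ->
  exists2 D, derivation D & D g = 1.
Proof.
move=> char0 trg.
pose B : set (K * K) := [set z | exists p : {poly k},
  z = ((map_poly iota p).[g], (map_poly iota p^`()).[g])].
have pB : partial_derivation B.
  split.
  - by move=> c; exists c%:P; rewrite derivC !rmorph0 map_polyC !hornerE.
  - move=> _ _ [p ->] [q ->] /=; exists (p + q).
    by rewrite derivD !rmorphD /= !hornerD.
  - move=> _ _ [p ->] [q ->] /=; exists (p * q).
    by rewrite derivM !(rmorphD, rmorphM) /= !hornerE.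
  - by move=> b [p [/esym /trg -> ->]]; rewrite derivC rmorph0 horner0.
have Bg : B (g, 1).
  by exists 'X; rewrite derivX map_polyX rmorph1 !hornerE.
(* With [B] joined to every graph, the empty chain also has an admissible union, namely [B]. *)
pose P G := partial_derivation (B `|` G).
have [F FP Ftot|A [PA maxA]] := @Zorn_bigcup _ P.
  have nest z1 z2 : (B `|` \bigcup_(G in F) G) z1 ->
      (B `|` \bigcup_(G in F) G) z2 -> exists2 G, partial_derivation G &
      [/\ G z1, G z2 & G `<=` B `|` \bigcup_(G in F) G].
    have sub G : F G -> B `|` G `<=` B `|` \bigcup_(G in F) G.
      by move=> FG z [Bz|Gz]; [left|right; exists G].
    move=> [B1|[G1 F1 h1]] [B2|[G2 F2 h2]].
    - by exists B => //; split => //; exact: subsetUl.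
    - exists (B `|` G2); [exact: FP|split; [by left|by right|exact: sub]].
    - exists (B `|` G1); [exact: FP|split; [by right|by left|exact: sub]].
    - have [le|le] := Ftot _ _ F1 F2.
        exists (B `|` G2); [exact: FP|split; [right; exact: le|by right|exact: sub]].
      exists (B `|` G1); [exact: FP|split; [by right|right; exact: le|exact: sub]].
  split.
  - by move=> c; left; case: pB.
  - by move=> z1 z2 h1 h2; have [G [_ h _ _] [? ? ]] := nest _ _ h1 h2; apply; exact: h.
  - by move=> z1 z2 h1 h2; have [G [_ _ h _] [? ? ]] := nest _ _ h1 h2; apply; exact: h.
  - by move=> b h1; have [G [_ _ _ h] [? ? _]] := nest _ _ h1 h1; exact: h.
have full a : exists b, (B `|` A) (a, b).
  have [b pb] := partial_derivation_extend PA a char0.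
  exists b; right; apply: contrapT => nA.
  apply: (maxA (A `|` adjoin_graph (B `|` A) a b)).
    split; first exact: subsetUl.
    by move=> h; apply: nA; apply: h; right; exact: adjoin_graph_gen.
  rewrite /P; suff -> : B `|` (A `|` adjoin_graph (B `|` A) a b) =
      adjoin_graph (B `|` A) a b by [].
  rewrite setUA; apply/seteqP; split; last exact: subsetUr.
  by move=> z [|//]; exact: adjoin_graph_sub.
have [D hD] := choice full.
have uniq a b b' : (B `|` A) (a, b) -> (B `|` A) (a, b') -> b = b'.
  case: PA => cP dP mP zP h h'.
  have h1 : (B `|` A) (- a, - b').
    by have := mP _ _ (cP (-1)) h'; rewrite /= rmorphN1 !mulN1r mul0r add0r.
  by have := dP _ _ h h1; rewrite /= subrr => /zP /eqP; rewrite subr_eq0 => /eqP.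
exists D; last by apply: (uniq g) => //; left.
case: PA => cP dP mP zP; split.
- by move=> a b; apply: (uniq (a + b)) => //; exact: (dP _ _ (hD a) (hD b)).
- by move=> a b; apply: (uniq (a * b)) => //; exact: (mP _ _ (hD a) (hD b)).
- by move=> c; apply: (uniq (iota c)).
Qed.

End Derivations.

(** * Constants of all derivations, and descent of stable subspaces *)

Lemma constant_of_derivations (k : closedFieldType) (K : fieldType)
    (iota : {rmorphism k -> K}) (g : K) : (forall n, n.+1%:R != 0 :> K) ->
  (forall D, derivation iota D -> D g = 0) -> exists c, g = iota c.
Proof.
move=> char0 hg; apply: contrapT => ng.
have [p pg|D dD Dg] := @exists_derivation _ _ iota g char0.
  apply/eqP/negPn/negP => np; apply: ng.
  (* A nonzero annihilator of g splits over the algebraically closed k, so g would be one of its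
     roots in k. *)
  have [rs pE] := closed_field_poly_normal p.
  move: pg; rewrite pE map_polyZ rmorph_prod /= hornerZ horner_prod => /eqP.
  rewrite mulf_eq0 fmorph_eq0 lead_coef_eq0 (negbTE np) /=.
  rewrite prodf_seq_eq0 => /hasP [z _ /=].
  rewrite rmorphB /= map_polyX map_polyC !hornerE subr_eq0 => /eqP ->.
  by exists z.
by have /eqP := hg _ dD; rewrite Dg oner_eq0.
Qed.

(** A matrix of largest rank among those with rows in [P] works: joining a further vector of [P] to
    its row space cannot raise the rank. *)
Lemma submx_of_linear_set (K : fieldType) (n : nat) (P : set 'rV[K]_n) :
  P 0 -> (forall u v, P u -> P v -> P (u + v)) ->
  (forall a v, P v -> P (a *: v)) ->
  exists M : 'M[K]_n, forall v, P v <-> (v <= M)%MS.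
Proof.
move=> P0 PD PZ.
have Pcomb m (A : 'M[K]_(m, n)) u : (forall i, P (row i A)) -> P (u *m A).
  move=> PA; rewrite mulmx_sum_row; elim/big_ind: _ => // i _; exact: PZ.
pose Q c := `[< exists2 M : 'M[K]_n, forall i, P (row i M) & \rank M = c >].
have Q0 : exists c, Q c.
  exists 0%N; apply/asboolP; exists 0; last exact: mxrank0.
  by move=> i; rewrite row0.
have Qmax c : Q c -> (c <= n)%N by move=> /asboolP [M _ <-]; exact: rank_leq_row.
case: (ex_maxnP Q0 Qmax) => c /asboolP [M PM <-] maxM; exists M => v; split.
  move=> Pv; pose S := (M + v)%MS.
  have PS i : P (row i S).
    have /sub_addsmxP [[u w] /= ->] : (row i S <= M + v)%MS by exact: row_sub.
    apply: PD; first exact: Pcomb.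
    by apply: Pcomb => j; rewrite row_id.
  have le : (\rank S <= \rank M)%N by apply: maxM; apply/asboolP; exists S.
  have /mxrank_leqif_sup [_ eqM] : (M <= S)%MS by exact: addsmxSl.
  have : \rank M == \rank S by rewrite eqn_leq le mxrankS // addsmxSl.
  by rewrite eqM => /(submx_trans _); apply; exact: addsmxSr.
by move=> /submxP [u ->]; exact: Pcomb.
Qed.

Lemma derivation_stable_descent (k K : fieldType) (iota : {rmorphism k -> K})
    (n : nat) (M : 'M[K]_n) :
  (forall g, (forall D, derivation iota D -> D g = 0) ->
     exists c, g = iota c) ->
  (forall D (v : 'rV_n), derivation iota D -> (v <= M)%MS -> (map_mx D v <= M)%MS) ->
  exists B : 'M[k]_(\rank M, n), (map_mx iota B :=: M)%MS.
Proof.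
move=> const stable; pose A := row_base M.
have fA : row_full A^T.
  by rewrite /row_full mxrank_tr; have := row_base_free M.
pose f := fullrankfun fA.
have uT : colsub f A \in unitmx.
  rewrite -unitmx_tr; have := fullrowsub_unit fA; rewrite /f.
  by have -> : (colsub (fullrankfun fA) A)^T = rowsub (fullrankfun fA) A^T
    by apply/matrixP => i j; rewrite !mxE.
pose B := invmx (colsub f A) *m A.
have BM : (B :=: M)%MS.
  apply: (eqmx_trans _ (eq_row_base M)); apply: eqmxMfull.
  by rewrite row_full_unit unitmx_inv.
have Bf : colsub f B = 1%:M.
  rewrite -(mulVmx uT); apply/matrixP => i j.
  rewrite mxE [LHS]mxE [RHS]mxE.
  by apply: eq_bigr => l _; rewrite [colsub f A l j]mxE.
have D0B D i j : derivation iota D -> D (B i j) = 0.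
  move=> dD; have [Da Dm Dc] := dD.
  have D1 : D 1 = 0 by rewrite -(rmorph1 iota) Dc.
  have D0 : D 0 = 0 by have := Dc 0; rewrite rmorph0.
  have : (map_mx D (row i B) <= B)%MS.
    by rewrite BM; apply: stable => //; rewrite -BM row_sub.
  move=> /submxP [G GE].
  (* [B] is the identity in the columns [f], so the coordinates of a vector of its row space are its
     entries there; for the derivative of a row these are D 0 or D 1, both zero. *)
  have G0 : G = 0.
    have : colsub f (map_mx D (row i B)) = G.
      rewrite GE -[RHS]mulmx1 -Bf; apply/matrixP => a b.
      rewrite mxE [LHS]mxE [RHS]mxE.
      by apply: eq_bigr => l _; rewrite [colsub f B l b]mxE.
    move=> <-; apply/matrixP => a b.
    have := congr1 (fun Z : 'M_ _ => Z i b) Bf; rewrite !mxE /= => ->.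
    by case: eqP; rewrite ?D0 ?D1.
  by have := congr1 (fun Z : 'M_(_, _) => Z 0 j) GE; rewrite G0 mul0mx !mxE.
have /choice [b bE] : forall ij : 'I_(\rank M) * 'I_n,
    exists c, B ij.1 ij.2 = iota c.
  by move=> [i j]; apply: const => D dD; exact: D0B.
exists (\matrix_(i, j) b (i, j)).
suff -> : map_mx iota (\matrix_(i, j) b (i, j)) = B by exact: BM.
by apply/matrixP => i j; rewrite [LHS]mxE [X in iota X]mxE -bE.
Qed.

(** * The ideal of the generic point *)

Section PrincipalPartsIdeal.
Variables (k K : fieldType) (iota : {rmorphism k -> K}) (n : nat).
Variables (xg : 'I_n -> K) (J : set {mpoly k[n]}).

Local Notation "p ^i" := (map_mpoly iota p) (at level 2, format "p ^i").

Definition ext_ideal (G : {mpoly K[n]}) :=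
  exists c (b : 'I_c -> {mpoly K[n]}) (H : 'I_c -> {mpoly k[n]}),
    (forall j, J (H j)) /\ G = \sum_j b j * (H j)^i.

(* The ideal m^e + J K[Y], where m is the ideal of the point xg.              *)
Fixpoint pp_ideal e (G : {mpoly K[n]}) : Prop :=
  if e is e'.+1 then exists (g : 'I_n -> {mpoly K[n]}) j,
    [/\ forall i, pp_ideal e' (g i), ext_ideal j &
        G = \sum_i ('X_i - (xg i)%:MP) * g i + j]
  else True.

Lemma ext_ideal0 : ext_ideal 0.
Proof.
by exists 0%N, (fun=> 0), (fun=> 0); split; [case|rewrite big_ord0].
Qed.

Lemma ext_idealD G H : ext_ideal G -> ext_ideal H -> ext_ideal (G + H).
Proof.
move=> [c [b [P [hP ->]]]] [c' [b' [P' [hP' ->]]]].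
exists (c + c')%N, (fun i => match split i with inl j => b j | inr j => b' j end),
  (fun i => match split i with inl j => P j | inr j => P' j end); split.
  by move=> i; case: split.
rewrite big_split_ord /=; congr (_ + _); apply: eq_bigr => i _.
  by rewrite -/(unsplit (inl i)) unsplitK.
by rewrite -/(unsplit (inr i)) unsplitK.
Qed.

Lemma ext_idealM a G : ext_ideal G -> ext_ideal (a * G).
Proof.
move=> [c [b [P [hP ->]]]]; exists c, (fun j => a * b j), P; split => //.
by rewrite mulr_sumr; apply: eq_bigr => j _; rewrite mulrA.
Qed.

Lemma ext_ideal_gen a H : J H -> ext_ideal (a * H^i).
Proof.
by move=> h; exists 1%N, (fun=> a), (fun=> H); split => //; rewrite big_ord1.
Qed.

Lemma ext_ideal_sum (I : Type) (s : seq I) (F : I -> {mpoly K[n]}) :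
  (forall i, ext_ideal (F i)) -> ext_ideal (\sum_(i <- s) F i).
Proof.
move=> h; elim/big_ind: _ => //; [exact: ext_ideal0|exact: ext_idealD].
Qed.

Lemma pp_ideal_ext e j : ext_ideal j -> pp_ideal e j.
Proof.
elim: e j => // e IH j hj /=; exists (fun=> 0), j; split => //.
  by move=> _; apply: IH; exact: ext_ideal0.
by rewrite big1 ?add0r // => i _; rewrite mulr0.
Qed.

Lemma pp_ideal0 e : pp_ideal e 0.
Proof. exact/pp_ideal_ext/ext_ideal0. Qed.

Lemma pp_idealD e G H : pp_ideal e G -> pp_ideal e H -> pp_ideal e (G + H).
Proof.
elim: e G H => // e IH _ _ [g [j [hg hj ->]]] [g' [j' [hg' hj' ->]]] /=.
exists (fun i => g i + g' i), (j + j'); split.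
- by move=> i; exact: IH (hg i) (hg' i).
- exact: ext_idealD.
- rewrite addrACA -big_split /=; congr (_ + _).
  by apply: eq_bigr => i _; rewrite mulrDr.
Qed.

Lemma pp_idealM e a G : pp_ideal e G -> pp_ideal e (a * G).
Proof.
elim: e G => // e IH _ [g [j [hg hj ->]]] /=.
exists (fun i => a * g i), (a * j); split.
- by move=> i; exact: IH (hg i).
- exact: ext_idealM.
- rewrite mulrDr mulr_sumr; congr (_ + _).
  by apply: eq_bigr => i _; rewrite mulrCA.
Qed.

Lemma pp_idealN e G : pp_ideal e G -> pp_ideal e (- G).
Proof. by rewrite -mulN1r; exact: pp_idealM. Qed.

Lemma pp_ideal_sum (I : Type) e (s : seq I) (F : I -> {mpoly K[n]}) :
  (forall i, pp_ideal e (F i)) -> pp_ideal e (\sum_(i <- s) F i).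
Proof.
move=> h; elim/big_ind: _ => //; [exact: pp_ideal0|exact: pp_idealD].
Qed.

Lemma pp_ideal_weak e G : pp_ideal e.+1 G -> pp_ideal e G.
Proof.
elim: e G => // e IH _ [g [j [hg hj ->]]]; exists g, j; split => // i.
exact: IH.
Qed.

(** The polynomials with this property contain constants and variables and form a ring: AB -
    A(x)B(x) = (A - A(x))B + A(x)(B - B(x)). *)
Lemma mpoly_sub_eval (G : {mpoly K[n]}) : exists g : 'I_n -> {mpoly K[n]},
  G - (G.@[xg])%:MP = \sum_i ('X_i - (xg i)%:MP) * g i.
Proof.
pose P (G : {mpoly K[n]}) := exists g : 'I_n -> {mpoly K[n]},
  G - (G.@[xg])%:MP = \sum_i ('X_i - (xg i)%:MP) * g i.
have PC c : P c%:MP.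
  exists (fun=> 0); rewrite mevalC subrr big1 // => i _; exact: mulr0.
have PD A B : P A -> P B -> P (A + B).
  move=> [g hg] [h hh]; exists (fun i => g i + h i).
  rewrite mevalD mpolyCD opprD addrACA hg hh -big_split /=.
  by apply: eq_bigr => i _; rewrite mulrDr.
have PM A B : P A -> P B -> P (A * B).
  move=> [g hg] [h hh]; exists (fun i => g i * B + (A.@[xg])%:MP * h i).
  rewrite mevalM mpolyCM.
  have -> : A * B - (A.@[xg])%:MP * (B.@[xg])%:MP =
    (A - (A.@[xg])%:MP) * B + (A.@[xg])%:MP * (B - (B.@[xg])%:MP) by ring.
  rewrite hg hh mulr_suml mulr_sumr -big_split /=.
  by apply: eq_bigr => i _; ring.
have PX i : P 'X_i.
  exists (fun j => (j == i)%:R); rewrite mevalXU (bigD1 i) //= eqxx mulr1.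
  by rewrite big1 ?addr0 // => j /negbTE ->; rewrite mulr0.
rewrite -/(P G) [G]mpolyE; elim/big_ind: _ => // [|m _].
  by rewrite -mpolyC0; exact: PC.
rewrite -mul_mpolyC; apply: (PM _ _ (PC _)).
rewrite mpolyXE_id; elim/big_ind: _ => // [|i _].
  by rewrite -mpolyC1; exact: PC.
elim: (m i) => [|e IH]; first by rewrite expr0 -mpolyC1; exact: PC.
by rewrite exprS; exact: PM.
Qed.

Lemma pp_ideal_mul1 e G H :
  G.@[xg] = 0 -> pp_ideal e H -> pp_ideal e.+1 (G * H).
Proof.
move=> G0 hH; have [g] := mpoly_sub_eval G.
rewrite G0 mpolyC0 subr0 => ->; exists (fun i => g i * H), 0; split.
- by move=> i; exact: pp_idealM.
- exact: ext_ideal0.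
- by rewrite addr0 mulr_suml; apply: eq_bigr => i _; rewrite mulrA.
Qed.

Lemma pp_ideal_vanish e G : (forall H, J H -> H^i.@[xg] = 0) ->
  pp_ideal e.+1 G -> G.@[xg] = 0.
Proof.
move=> hJ [g [_ [_ [c [b [H [hH ->]]]] ->]]].
rewrite mevalD !raddf_sum /= !big1 ?addr0 // => i _; rewrite rmorphM /=.
  by rewrite hJ ?mulr0.
by rewrite mevalB mevalXU mevalC subrr mul0r.
Qed.

(** [u] is a unit modulo m^e + J K[Y]. With c = u(xg), cG = uG - (u - c)G; by induction G already
    has one order less, and the factor u - c restores it. *)
Lemma pp_ideal_cancel e u G : u.@[xg] != 0 ->
  pp_ideal e (u * G) -> pp_ideal e G.
Proof.
move=> nu; elim: e => // e IH hG.
have /IH hG' := pp_ideal_weak hG.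
have -> : G = ((u.@[xg])^-1)%:MP * (u * G - (u - (u.@[xg])%:MP) * G).
  have -> : u * G - (u - (u.@[xg])%:MP) * G = (u.@[xg])%:MP * G by ring.
  by rewrite mulrA -mpolyCM mulVf // mpolyC1 mul1r.
apply/pp_idealM/pp_idealD => //; apply: pp_idealN; apply: pp_ideal_mul1 => //.
by rewrite mevalB mevalC subrr.
Qed.

Definition linear_mpoly (v : 'rV[K]_n) : {mpoly K[n]} := \sum_i v 0 i *: 'X_i.

(** * The action of a derivation on coefficients *)

Section Derive.
Variables (D : {additive K -> K}) (hD : derivation iota D).

Local Notation "p ^D" := (map_mpoly D p) (at level 2, format "p ^D").

Lemma map_mpoly_derivation (p q : {mpoly K[n]}) :
  (p * q)^D = p^D * q + p * q^D.
Proof.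
case: hD => _ Dm _; apply/mpolyP => m.
rewrite mcoeff_map_mpoly mcoeffD !mcoeffM raddf_sum -big_split /=.
by apply: eq_bigr => i _; rewrite Dm !mcoeff_map_mpoly.
Qed.

Lemma derivation_nat (m : nat) : D m%:R = 0.
Proof. by case: hD => _ _ Dc; rewrite -(rmorph_nat iota) Dc. Qed.

Lemma map_mpoly_derivation_const (p : {mpoly k[n]}) : p^i^D = 0.
Proof.
by case: hD => _ _ Dc; apply/mpolyP => m; rewrite !mcoeff_map_mpoly Dc mcoeff0.
Qed.

Lemma map_mpoly_derivationX i : ('X_i : {mpoly K[n]})^D = 0.
Proof.
by apply/mpolyP => m; rewrite mcoeff_map_mpoly mcoeffX derivation_nat mcoeff0.
Qed.

(** The generators have coefficients in k, which D kills, so only the multipliers are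
    differentiated. *)
Lemma ext_ideal_derivation G : ext_ideal G -> ext_ideal G^D.
Proof.
move=> [c [b [H [hH ->]]]]; rewrite raddf_sum /=; apply: ext_ideal_sum => j.
rewrite map_mpoly_derivation map_mpoly_derivation_const mulr0 addr0.
exact: ext_ideal_gen.
Qed.

(** One order is lost because the point moves: Y_i - xg_i has derivative - D(xg_i), a constant of
    K[Y]. In the other Leibniz term the factor Y_i - xg_i survives and makes up for the order lost
    by its cofactor. *)
Lemma pp_ideal_derivation e G : pp_ideal e.+1 G -> pp_ideal e G^D.
Proof.
elim: e G => // e IH _ [g [j [hg hj ->]]]; rewrite raddfD raddf_sum /=.
apply: (@pp_idealD e.+1); last exact/pp_ideal_ext/ext_ideal_derivation.
apply: pp_ideal_sum => i; rewrite map_mpoly_derivation; apply: pp_idealD.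
  by apply: pp_idealM; exact: hg.
apply: pp_ideal_mul1; last exact: IH.
by rewrite mevalB mevalXU mevalC subrr.
Qed.

Lemma map_linear_mpoly_derivation v :
  (linear_mpoly v)^D = linear_mpoly (map_mx D v).
Proof.
rewrite /linear_mpoly raddf_sum /=; apply: eq_bigr => i _.
rewrite -mul_mpolyC map_mpoly_derivation map_mpoly_derivationX.
by rewrite mulr0 addr0 map_mpolyC mul_mpolyC mxE.
Qed.

End Derive.

(* The generic stalk of ker(alpha_e).                                         *)
Definition taylor_stalk e : set 'rV[K]_n :=
  [set v | pp_ideal e.+1 (linear_mpoly v)].

Lemma linear_mpolyD u v : linear_mpoly (u + v) = linear_mpoly u + linear_mpoly v.
Proof.
by rewrite /linear_mpoly -big_split; apply: eq_bigr => i _; rewrite mxE scalerDl.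
Qed.

Lemma linear_mpolyZ a v : linear_mpoly (a *: v) = a%:MP * linear_mpoly v.
Proof.
rewrite mul_mpolyC /linear_mpoly scaler_sumr.
by apply: eq_bigr => i _; rewrite mxE scalerA.
Qed.

Lemma taylor_stalk_submx e :
  exists M : 'M[K]_n, forall v, taylor_stalk e v <-> (v <= M)%MS.
Proof.
apply: submx_of_linear_set => [|u v|a v].
- rewrite /taylor_stalk /mkset -(scale0r 0) linear_mpolyZ mpolyC0 mul0r.
  exact: (@pp_ideal0 e.+1).
- by rewrite /taylor_stalk /mkset linear_mpolyD; exact: pp_idealD.
- by rewrite /taylor_stalk /mkset linear_mpolyZ; exact: pp_idealM.
Qed.

Lemma taylor_stalk_derivation e D v : derivation iota D ->
  taylor_stalk e.+1 v -> taylor_stalk e (map_mx D v).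
Proof.
move=> dD; have [Da Dm Dc] := dD.
have D0 : D 0 = 0 by have := Dc 0; rewrite rmorph0.
have DB : zmod_morphism D.
  move=> a b; apply/eqP; rewrite eq_sym subr_eq -Da subrK; exact/eqP.
pose D' : {additive K -> K} := HB.pack D (GRing.isZmodMorphism.Build K K D DB).
have dD' : derivation iota D' by [].
rewrite /taylor_stalk /mkset => h; have := pp_ideal_derivation dD' h.
by rewrite map_linear_mpoly_derivation.
Qed.

Lemma taylor_stalk_weak e v : taylor_stalk e.+1 v -> taylor_stalk e v.
Proof. exact: pp_ideal_weak. Qed.

End PrincipalPartsIdeal.

(** * Regular functions on X and X x X *)

(** Every later identity between substitutions (diagonal, slices, generic point) is reduced by this
    to a check on constants and variables. *)
Lemma rmorph_mmap (n : nat) (R : nzRingType) (S T : comNzRingType)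
    (f : R -> S) (h : 'I_n -> S) (g : {rmorphism S -> T}) p :
  g (mmap f h p) = mmap (g \o f) (g \o h) p.
Proof.
rewrite /mmap rmorph_sum; apply: eq_bigr => m _ /=; rewrite rmorphM.
congr (_ * _); rewrite /mmap1 rmorph_prod.
by apply: eq_bigr => i _; rewrite rmorphXn.
Qed.

Lemma eq_mmap (n : nat) (R : nzRingType) (S : comNzRingType)
    (f g : R -> S) (h h' : 'I_n -> S) p :
  f =1 g -> h =1 h' -> mmap f h p = mmap g h' p.
Proof.
move=> fg hh; rewrite /mmap; apply: eq_bigr => m _; rewrite fg.
by rewrite (mmap1_eq _ hh).
Qed.

Section Evaluation.
Context {R : realType} {r : nat}.
Local Notation C := (R[i]).
Local Notation pt := (coords R r).
Local Notation A := {mpoly C[r.+1]}.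
Local Notation A2 := {mpoly C[r.+1 + r.+1]}.
Implicit Types (p q : A) (P Q : A2) (x y : pt) (z w : pt * pt).

Lemma hevalD p q x : heval (p + q) x = heval p x + heval q x.
Proof. exact: mevalD. Qed.
Lemma hevalB p q x : heval (p - q) x = heval p x - heval q x.
Proof. exact: mevalB. Qed.
Lemma hevalM p q x : heval (p * q) x = heval p x * heval q x.
Proof. exact: mevalM. Qed.
Lemma hevalC c x : heval c%:MP x = c.
Proof. exact: mevalC. Qed.
Lemma hevalXU i x : heval 'X_i x = x 0 i.
Proof. exact: mevalXU. Qed.

Lemma bievalD P Q z : bieval (P + Q) z = bieval P z + bieval Q z.
Proof. exact: mevalD. Qed.
Lemma bievalB P Q z : bieval (P - Q) z = bieval P z - bieval Q z.
Proof. exact: mevalB. Qed.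
Lemma bievalM P Q z : bieval (P * Q) z = bieval P z * bieval Q z.
Proof. exact: mevalM. Qed.
Lemma bievalC c z : bieval c%:MP z = c.
Proof. exact: mevalC. Qed.
Lemma bievalXl i z : bieval 'X_(lshift r.+1 i) z = z.1 0 i.
Proof. by rewrite /bieval mevalXU row_mxEl. Qed.
Lemma bievalXr i z : bieval 'X_(rshift r.+1 i) z = z.2 0 i.
Proof. by rewrite /bieval mevalXU row_mxEr. Qed.

Lemma heval_homog d p c x : p \is d.-homog ->
  heval p (c *: x) = c ^+ d * heval p x.
Proof.
move=> /dhomogP hp; rewrite /heval !mevalE mulr_sumr.
apply: eq_big_seq => m /hp md; rewrite mulrCA; congr (_ * _).
rewrite -(md : mdeg m = d) mdegE -prodrXr -big_split /=.
by apply: eq_bigr => i _; rewrite mxE exprMn.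
Qed.

Lemma bieval_bihomog a b P c e x y : bihomog a b P ->
  bieval P (c *: x, e *: y) = c ^+ a * e ^+ b * bieval P (x, y).
Proof.
move=> hP; rewrite /bieval !mevalE mulr_sumr.
apply: eq_big_seq => m /hP [<- <-]; rewrite mulrCA; congr (_ * _).
rewrite -!prodrXr !big_split_ord /= mulrACA.
by congr (_ * _); rewrite -big_split /=; apply: eq_bigr => i _;
  rewrite ?row_mxEl ?row_mxEr mxE exprMn.
Qed.

Lemma bihomogD a b P Q : bihomog a b P -> bihomog a b Q -> bihomog a b (P + Q).
Proof. by move=> hP hQ m /msuppD_le; rewrite mem_cat => /orP [/hP|/hQ]. Qed.

Lemma bihomog0 a b : bihomog a b (0 : A2).
Proof. by move=> m; rewrite msupp0. Qed.

Lemma bihomogM a b a' b' P Q : bihomog a b P -> bihomog a' b' Q ->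
  bihomog (a + a') (b + b') (P * Q).
Proof.
move=> hP hQ m /msuppM_le /allpairsP [[m1 m2] /= [/hP [<- <-] /hQ [<- <-] ->]].
by split; rewrite -big_split /=; apply: eq_bigr => i _; rewrite mnmDE.
Qed.

Lemma bihomogC c : bihomog 0 0 (c%:MP : A2).
Proof.
move=> m; rewrite msuppC; case: eqP => // _; rewrite inE => /eqP ->.
by split; rewrite big1 // => i _; rewrite mnm0E.
Qed.

Lemma bihomogN a b P : bihomog a b P -> bihomog a b (- P).
Proof.
by move=> hP; have := bihomogM (@bihomogC (-1)) hP; rewrite mpolyCN mpolyC1 mulN1r.
Qed.

Lemma bihomogXl i : bihomog 1 0 ('X_(lshift r.+1 i) : A2).
Proof.
move=> m; rewrite msuppX inE => /eqP ->; split.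
  rewrite (bigD1 i) //= mnm1E eqxx big1 // => j ji.
  by rewrite mnm1E (inj_eq (@lshift_inj _ _)) eq_sym (negbTE ji).
by rewrite big1 // => j _; rewrite mnm1E eq_lrshift.
Qed.

Lemma bihomogXr i : bihomog 0 1 ('X_(rshift r.+1 i) : A2).
Proof.
move=> m; rewrite msuppX inE => /eqP ->; split.
  by rewrite big1 // => j _; rewrite mnm1E eq_rlshift.
rewrite (bigD1 i) //= mnm1E eqxx big1 // => j ji.
by rewrite mnm1E (inj_eq (@rshift_inj _ _)) eq_sym (negbTE ji).
Qed.

Lemma bihomog_exp a b P e : bihomog a b P -> bihomog (a * e) (b * e) (P ^+ e).
Proof.
move=> hP; elim: e => [|e IH].
  by rewrite !muln0 expr0 -mpolyC1; exact: bihomogC.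
by rewrite !mulnS exprS; exact: bihomogM.
Qed.

Lemma bihomog_prod (I : Type) (s : seq I) (F : I -> A2) (a b : I -> nat) :
  (forall i, bihomog (a i) (b i) (F i)) ->
  bihomog (\sum_(i <- s) a i) (\sum_(i <- s) b i) (\prod_(i <- s) F i).
Proof.
move=> hF; elim: s => [|i s IH].
  by rewrite !big_nil -mpolyC1; exact: bihomogC.
by rewrite !big_cons; exact: bihomogM.
Qed.

Lemma bihomog_sum (I : eqType) (s : seq I) (F : I -> A2) a b :
  (forall i, i \in s -> bihomog a b (F i)) -> bihomog a b (\sum_(i <- s) F i).
Proof.
move=> hF; rewrite big_seq_cond; elim/big_ind: _ => [||i /andP [/hF]] //.
- exact: bihomog0.
- exact: bihomogD.
Qed.

(* Locked, since comparing two unfolded instances up to conversion is costly. *)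
Fact poly_embedding_key : unit. Proof. exact: tt. Qed.

Definition lpoly : A -> A2 := locked_with poly_embedding_key
  (mmap (@mpolyC _ C) (fun i => 'X_(lshift r.+1 i))).
Definition rpoly : A -> A2 := locked_with poly_embedding_key
  (mmap (@mpolyC _ C) (fun i => 'X_(rshift r.+1 i))).

Lemma lpolyE p : lpoly p = mmap (@mpolyC _ C) (fun i => 'X_(lshift r.+1 i)) p.
Proof. by rewrite /lpoly locked_withE. Qed.
Lemma rpolyE p : rpoly p = mmap (@mpolyC _ C) (fun i => 'X_(rshift r.+1 i)) p.
Proof. by rewrite /rpoly locked_withE. Qed.

Lemma bieval_lpoly p z : bieval (lpoly p) z = heval p z.1.
Proof.
rewrite lpolyE /bieval rmorph_mmap; apply: eq_mmap => i /=.
  by rewrite mevalC.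
exact: bievalXl.
Qed.

Lemma bieval_rpoly p z : bieval (rpoly p) z = heval p z.2.
Proof.
rewrite rpolyE /bieval rmorph_mmap; apply: eq_mmap => i /=.
  by rewrite mevalC.
exact: bievalXr.
Qed.

Lemma bihomog_lpoly d p : p \is d.-homog -> bihomog d 0 (lpoly p).
Proof.
move=> /dhomogP hp; rewrite lpolyE; apply: bihomog_sum => m /hp md.
rewrite -(md : mdeg m = d) mdegE.
rewrite -[X in bihomog X _]add0n -[X in bihomog _ X]add0n.
apply: bihomogM; first exact: bihomogC.
have : bihomog (\sum_(i < r.+1) m i) (\sum_(i < r.+1) 0)
    (\prod_(i < r.+1) 'X_(lshift r.+1 i) ^+ m i : A2); last first.
  by rewrite sum_nat_const muln0.
apply: bihomog_prod => i.
rewrite -[X in bihomog X _]mul1n -[X in bihomog _ X](mul0n (m i)).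
exact/bihomog_exp/bihomogXl.
Qed.

Lemma bihomog_rpoly d p : p \is d.-homog -> bihomog 0 d (rpoly p).
Proof.
move=> /dhomogP hp; rewrite rpolyE; apply: bihomog_sum => m /hp md.
rewrite -(md : mdeg m = d) mdegE.
rewrite -[X in bihomog X _]add0n -[X in bihomog _ X]add0n.
apply: bihomogM; first exact: bihomogC.
have : bihomog (\sum_(i < r.+1) 0) (\sum_(i < r.+1) m i)
    (\prod_(i < r.+1) 'X_(rshift r.+1 i) ^+ m i : A2); last first.
  by rewrite sum_nat_const muln0.
apply: bihomog_prod => i.
rewrite -[X in bihomog _ X]mul1n -[X in bihomog X _](mul0n (m i)).
exact/bihomog_exp/bihomogXr.
Qed.

Lemma dhomogXi i : ('X_i : A) \is 1.-homog.
Proof. by rewrite dhomogX /= mdeg1. Qed.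

Lemma dhomogC c : (c%:MP : A) \is 0.-homog.
Proof. by rewrite -alg_mpolyC; apply: dhomogZ; exact: dhomog1. Qed.

End Evaluation.

Section Regular.
Context {R : realType} {r : nat}.
Local Notation C := (R[i]).
Local Notation pt := (coords R r).
Local Notation A := {mpoly C[r.+1]}.
Local Notation A2 := {mpoly C[r.+1 + r.+1]}.
Implicit Types (p q : A) (P Q : A2) (x y : pt) (z w : pt * pt).

Variables (X : set pt) (X0 : X `<=` [set x | x != 0]).

Lemma exists_coord_neq0 x : X x -> exists i, x 0 i != 0.
Proof.
move=> Xx; apply: contrapT => ex; have /eqP := X0 Xx; apply; apply/rowP => i.
by rewrite mxE; apply/eqP/negPn/negP => xi; apply: ex; exists i.
Qed.

Definition basic_open q : set pt := [set x | X x /\ heval q x != 0].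
Definition basic_open2 Q : set (pt * pt) :=
  [set w | [/\ X w.1, X w.2 & bieval Q w != 0]].

Lemma open_basic d q : q \is d.-homog -> open_in X (basic_open q).
Proof.
move=> hq; exists [set x | x != 0 /\ heval q x = 0].
  exists [set q]; split; first by move=> _ ->; exists d.
  apply/seteqP; split => x /= [x0 hx]; split => //; last exact: hx.
  by move=> _ ->.
apply/seteqP; split => x /= [Xx hx]; split => //.
  by case=> _ /eqP; apply/negP.
by apply/eqP => q0; apply: hx; split => //; exact: X0.
Qed.

Lemma open_setT : open_in X X.
Proof.
have := open_basic (dhomogC 1); congr open_in.
by apply/seteqP; split => x /= => [[]//|Xx]; split => //; rewrite hevalC oner_neq0.
Qed.

Lemma open2_basic a b Q : bihomog a b Q -> open_in2 X (basic_open2 Q).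
Proof.
move=> hQ; exists [set z | [/\ z.1 != 0, z.2 != 0 & bieval Q z = 0]].
  exists [set Q]; split; first by move=> _ ->; exists a, b.
  apply/seteqP; split => x /= [x0 y0 hx]; split => //; last exact: hx.
  by move=> _ ->.
apply/seteqP; split => x /=.
  by move=> [X1 X2 hx]; split => // -[_ _ /eqP]; apply/negP.
move=> [[X1 X2] hx]; split => //.
by apply/eqP => q0; apply: hx; split => //; exact: X0.
Qed.

Lemma open_in_basic U x : open_in X U -> U x ->
  exists d q, [/\ q \is d.-homog, basic_open q x & basic_open q `<=` U].
Proof.
move=> [_ [S [hS ->]] ->] [Xx] /= nZ.
have [q Sq qx] : exists2 q, S q & heval q x != 0.
  apply: contrapT => ex; apply: nZ; split; first exact: X0.
  move=> p Sp; apply/eqP/negPn/negP => px; apply: ex; by exists p.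
have [d hd] := hS _ Sq; exists d, q; split => // u /= [Xu qu]; split => //.
by case=> _ /(_ _ Sq) /eqP; apply/negP.
Qed.

Lemma open_in2_basic O z : open_in2 X O -> O z -> exists a b Q,
  [/\ bihomog a b Q, basic_open2 Q z & basic_open2 Q `<=` O].
Proof.
move=> [_ [S [hS ->]] ->] [[X1 X2]] /= nZ.
have [q Sq qx] : exists2 q, S q & bieval q z != 0.
  apply: contrapT => ex; apply: nZ; split; [exact: X0|exact: X0|].
  move=> p Sp; apply/eqP/negPn/negP => px; apply: ex; by exists p.
have [a [b hd]] := hS _ Sq; exists a, b, q; split => // u /= [Xu Xv qu].
by split => //; case=> _ _ /(_ _ Sq) /eqP; apply/negP.
Qed.

Lemma basic_openM p q : basic_open (p * q) = basic_open p `&` basic_open q.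
Proof.
apply/seteqP; split => x /=; rewrite /basic_open /= hevalM mulf_eq0 negb_or.
  by move=> [Xx /andP [? ?]].
by move=> [[Xx ->] [_ ->]].
Qed.

Lemma basic_open2M P Q : basic_open2 (P * Q) = basic_open2 P `&` basic_open2 Q.
Proof.
apply/seteqP; split => x /=; rewrite /basic_open2 /= bievalM mulf_eq0 negb_or.
  by move=> [X1 X2 /andP [? ?]].
by move=> [[X1 X2 ->] [_ _ ->]].
Qed.

(** The local condition of [regular] with the neighbourhood taken to be the principal open set of
    the denominator, so that intersecting neighbourhoods is multiplying denominators. *)
Definition regular_at (d : int) x (f : pt -> C) := exists d1 d2 p q,
  [/\ p \is d1.-homog, q \is d2.-homog, d1%:Z = d2%:Z + d & basic_open q x] /\
  forall u, basic_open q u -> f u = heval p u / heval q u.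

Lemma regular_atP d U f x : regular X d U f -> U x -> regular_at d x f.
Proof.
move=> hf Ux; have [U' [d1 [d2 [p [q]]]]] := hf _ Ux.
move=> [[oU' U'x sub] [[hp hq dE] hpq]].
have [e [g [hg gx gU]]] := open_in_basic oU' U'x.
(* Multiplying numerator and denominator by g shrinks the principal open set of the denominator into
   the given neighbourhood; the same device serves on X x X. *)
exists (d1 + e)%N, (d2 + e)%N, (p * g), (q * g); split.
  split; [exact: dhomogM|exact: dhomogM| |].
    by rewrite !PoszD dE addrAC.
  rewrite basic_openM; split => //; split; first by case: gx.
  by have [] := hpq _ U'x.
move=> u; rewrite basic_openM => -[_ gu]; have [qu ->] := hpq _ (gU _ gu).
by case: gu => _ gu; rewrite !hevalM -mulf_div divff // mulr1.
Qed.

Lemma regularP d U f : open_in X U ->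
  (forall x, U x -> regular_at d x f) -> regular X d U f.
Proof.
move=> oU hf x Ux; have [d1 [d2 [p [q [[hp hq dE qx] hpq]]]]] := hf _ Ux.
have [e [g [hg gx gU]]] := open_in_basic oU Ux.
exists (basic_open (q * g)), d1, d2, p, q; split.
  split; first exact: open_basic (dhomogM hq hg).
  - by rewrite basic_openM.
  - by rewrite basic_openM => u [_ /gU].
split => // u; rewrite basic_openM => -[qu _]; split; first by case: qu.
exact: hpq.
Qed.

Lemma regular_sub d U U' f : open_in X U' -> U' `<=` U ->
  regular X d U f -> regular X d U' f.
Proof. by move=> oU' sub hf; apply: regularP => // x /sub; exact: regular_atP. Qed.

Lemma regular_atD d x f g : regular_at d x f -> regular_at d x g ->
  regular_at d x (fun u => f u + g u).
Proof.
move=> [d1 [d2 [p [q [[hp hq dE qx] hpq]]]]].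
move=> [d1' [d2' [p' [q' [[hp' hq' dE' qx'] hpq']]]]].
exists (d1 + d2')%N, (d2 + d2')%N, (p * q' + p' * q), (q * q'); split.
  split; rewrite ?basic_openM //.
  - apply: rpredD; first exact: dhomogM.
    have -> : (d1 + d2' = d1' + d2)%N by lia.
    exact: dhomogM.
  - exact: dhomogM.
  - lia.
move=> u; rewrite basic_openM => -[qu qu'].
rewrite (hpq _ qu) (hpq' _ qu') hevalD !hevalM addf_div //.
  by case: qu.
by case: qu'.
Qed.

Lemma regular_atM d d' x f g : regular_at d x f -> regular_at d' x g ->
  regular_at (d + d') x (fun u => f u * g u).
Proof.
move=> [d1 [d2 [p [q [[hp hq dE qx] hpq]]]]].
move=> [d1' [d2' [p' [q' [[hp' hq' dE' qx'] hpq']]]]].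
exists (d1 + d1')%N, (d2 + d2')%N, (p * p'), (q * q'); split.
  split; rewrite ?basic_openM //; [exact: dhomogM|exact: dhomogM|lia].
move=> u; rewrite basic_openM => -[qu qu'].
by rewrite (hpq _ qu) (hpq' _ qu') !hevalM mulf_div.
Qed.

Lemma regular_at_frac d1 d2 (d : int) p q x : p \is d1.-homog -> q \is d2.-homog ->
  d1%:Z = d2%:Z + d -> basic_open q x ->
  regular_at d x (fun u => heval p u / heval q u).
Proof. by move=> hp hq dE qx; exists d1, d2, p, q. Qed.

Lemma regular_at_ext d x f g e q : q \is e.-homog -> basic_open q x ->
  (forall u, basic_open q u -> f u = g u) ->
  regular_at d x f -> regular_at d x g.
Proof.
move=> hq qx fg [d1 [d2 [p [q' [[hp hq' dE qx'] hpq]]]]].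
exists (d1 + e)%N, (d2 + e)%N, (p * q), (q' * q); split.
  split; rewrite ?basic_openM //; [exact: dhomogM|exact: dhomogM|lia].
move=> u; rewrite basic_openM => -[qu qu'].
rewrite -fg // hpq //; case: qu' => _ qu'.
by rewrite !hevalM -mulf_div divff // mulr1.
Qed.

Lemma regular_at_ext_open d x f g U : open_in X U -> U x ->
  (forall u, U u -> f u = g u) -> regular_at d x f -> regular_at d x g.
Proof.
move=> oU Ux fg; have [e [q [hq qx qU]]] := open_in_basic oU Ux.
by apply: (regular_at_ext hq qx) => u /qU; exact: fg.
Qed.

Lemma regular_atC c x : X x -> regular_at 0 x (fun=> c).
Proof.
move=> Xx; have := @regular_at_frac 0 0 0 c%:MP 1%:MP x.
under eq_fun do rewrite !hevalC divr1.
apply; [exact: dhomogC|exact: dhomogC|by []|].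
by split => //; rewrite hevalC oner_neq0.
Qed.

Lemma regular_atX i x : X x -> regular_at 1 x (fun u => u 0 i).
Proof.
move=> Xx; have := @regular_at_frac 1 0 1 'X_i 1%:MP x.
under eq_fun do rewrite hevalXU hevalC divr1.
apply; [exact: dhomogXi|exact: dhomogC|by []|].
by split => //; rewrite hevalC oner_neq0.
Qed.

Lemma regular_atXV i x : X x -> x 0 i != 0 ->
  regular_at (-1) x (fun u => (u 0 i)^-1).
Proof.
move=> Xx xi; have := @regular_at_frac 0 1 (-1) 1%:MP 'X_i x.
under eq_fun do rewrite hevalXU hevalC mul1r.
apply; [exact: dhomogC|exact: dhomogXi|by []|].
by split => //; rewrite hevalXU.
Qed.

Lemma regular_at_sum (I : Type) (s : seq I) d x (F : I -> pt -> C) : X x ->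
  (forall i, regular_at d x (F i)) ->
  regular_at d x (fun u => \sum_(i <- s) F i u).
Proof.
move=> Xx hF; elim: s => [|i s IH].
  under eq_fun do rewrite big_nil.
  (* The empty sum must be a fraction of degree d: 0/1 suits d >= 0, but d = -(n+1) needs a
     denominator of degree n+1, a power of a coordinate nonzero at x. *)
  have [i xi] := exists_coord_neq0 Xx.
  case: d {hF} => n.
    exists n, 0%N, 0, 1%:MP; split.
      split; [exact: dhomog0|exact: dhomogC|by rewrite add0r|].
      by split => //; rewrite hevalC oner_neq0.
    by move=> u _; rewrite /heval meval0 mul0r.
  exists 0%N, n.+1, 0, ('X_i ^+ n.+1); split.
    split; [exact: dhomog0| |by rewrite NegzE subrr|].
      by rewrite -[X in X.-homog]mul1n; exact/dhomogMn/dhomogXi.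
    by split => //; rewrite /heval rmorphXn /= mevalXU expf_neq0.
  by move=> u _; rewrite /heval meval0 mul0r.
under eq_fun do rewrite big_cons.
exact: regular_atD.
Qed.

(* Local sections of pr_2^* O_X(e): e = 0 gives O_{X x X}, e = 1 gives pr_2^* L. *)
Definition regular2_at (e : nat) z (h : pt * pt -> C) := exists a b P Q,
  [/\ bihomog a (b + e) P, bihomog a b Q & basic_open2 Q z] /\
  forall w, basic_open2 Q w -> h w = bieval P w / bieval Q w.

Lemma regular2_atP O h z : regular2 X O h -> O z -> regular2_at 0 z h.
Proof.
move=> hh Oz; have [O' [a [b [p [q]]]]] := hh _ Oz.
move=> [[oO' O'z sub] [[hp hq] hpq]].
have [a' [b' [g [hg gz gO]]]] := open_in2_basic oO' O'z.
exists (a + a')%N, (b + b')%N, (p * g), (q * g); split.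
  split; rewrite ?addn0 ?basic_open2M; [exact: bihomogM|exact: bihomogM|].
  by split => //; case: (gz) => X1 X2 _; split => //; have [] := hpq _ O'z.
move=> u; rewrite basic_open2M => -[_ gu]; have [qu ->] := hpq _ (gO _ gu).
by case: gu => _ _ gu; rewrite !bievalM -mulf_div divff // mulr1.
Qed.

Lemma regular2P O h : open_in2 X O ->
  (forall z, O z -> regular2_at 0 z h) -> regular2 X O h.
Proof.
move=> oO hh z Oz; have [a [b [p [q [[hp hq qz] hpq]]]]] := hh _ Oz.
have [a' [b' [g [hg gz gO]]]] := open_in2_basic oO Oz.
exists (basic_open2 (q * g)), a, b, p, q; split.
  split; first exact: open2_basic (bihomogM hq hg).
  - by rewrite basic_open2M.
  - by rewrite basic_open2M => u [_ /gO].
split; first by rewrite addn0 in hp.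
move=> u; rewrite basic_open2M => -[qu _]; split; first by case: qu.
exact: hpq.
Qed.

Lemma regular2_at_open e z h : regular2_at e z h -> exists a b Q,
  [/\ bihomog a b Q, basic_open2 Q z &
      forall w, basic_open2 Q w -> regular2_at e w h].
Proof.
move=> [a [b [p [q [[hp hq qz] hpq]]]]]; exists a, b, q; split => // w qw.
by exists a, b, p, q.
Qed.

Lemma regular2_atD e z f g : regular2_at e z f -> regular2_at e z g ->
  regular2_at e z (fun u => f u + g u).
Proof.
move=> [a [b [p [q [[hp hq qz] hpq]]]]].
move=> [a' [b' [p' [q' [[hp' hq' qz'] hpq']]]]].
exists (a + a')%N, (b + b')%N, (p * q' + p' * q), (q * q'); split.
  split; rewrite ?basic_open2M //; last exact: bihomogM.
  apply: bihomogD.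
    by rewrite addnAC; exact: bihomogM.
  by rewrite addnC [(b + b')%N]addnC addnAC; exact: bihomogM.
move=> u; rewrite basic_open2M => -[qu qu'].
rewrite (hpq _ qu) (hpq' _ qu') bievalD !bievalM addf_div //.
  by case: qu.
by case: qu'.
Qed.

Lemma regular2_atM e e' z f g : regular2_at e z f -> regular2_at e' z g ->
  regular2_at (e + e') z (fun u => f u * g u).
Proof.
move=> [a [b [p [q [[hp hq qz] hpq]]]]].
move=> [a' [b' [p' [q' [[hp' hq' qz'] hpq']]]]].
exists (a + a')%N, (b + b')%N, (p * p'), (q * q'); split.
  split; rewrite ?basic_open2M //; last exact: bihomogM.
  by rewrite addnACA; exact: bihomogM.
move=> u; rewrite basic_open2M => -[qu qu'].
by rewrite (hpq _ qu) (hpq' _ qu') !bievalM mulf_div.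
Qed.

Lemma regular2_at_ext e z f g a b Q : bihomog a b Q -> basic_open2 Q z ->
  (forall u, basic_open2 Q u -> f u = g u) ->
  regular2_at e z f -> regular2_at e z g.
Proof.
move=> hQ Qz fg [a' [b' [p [q [[hp hq qz] hpq]]]]].
exists (a' + a)%N, (b' + b)%N, (p * Q), (q * Q); split.
  split; rewrite ?basic_open2M //; last exact: bihomogM.
  by rewrite addnAC; exact: bihomogM.
move=> u; rewrite basic_open2M => -[qu Qu].
by rewrite -fg // hpq //; case: Qu => _ _ Qu;
  rewrite !bievalM -mulf_div divff // mulr1.
Qed.

Lemma regular2_at0 e z : X z.1 -> X z.2 -> regular2_at e z (fun=> 0).
Proof.
move=> X1 X2; exists 0%N, 0%N, 0, 1%:MP; split.
  split; [exact: bihomog0|exact: bihomogC|].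
  by split => //; rewrite bievalC oner_neq0.
by move=> u _; rewrite /bieval meval0 mul0r.
Qed.

Lemma regular2_at_sum (I : Type) (s : seq I) e z (F : I -> pt * pt -> C) :
  X z.1 -> X z.2 -> (forall i, regular2_at e z (F i)) ->
  regular2_at e z (fun u => \sum_(i <- s) F i u).
Proof.
move=> X1 X2 hF; elim: s => [|i s IH].
  by under eq_fun do rewrite big_nil; exact: regular2_at0.
by under eq_fun do rewrite big_cons; exact: regular2_atD.
Qed.

Lemma regular2_at_pr1 z f : X z.2 -> regular_at 0 z.1 f ->
  regular2_at 0 z (fun w => f w.1).
Proof.
move=> X2 [d1 [d2 [p [q [[hp hq dE [X1 qx]] hpq]]]]].
have dE' : d1 = d2 by lia.
exists d1, 0%N, (lpoly p), (lpoly q); split.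
  split; [exact: bihomog_lpoly|by rewrite dE'; exact: bihomog_lpoly|].
  by split => //; rewrite bieval_lpoly.
move=> w [w1 w2]; rewrite !bieval_lpoly => qw; exact: hpq.
Qed.

Lemma regular2_at_pr2 (e : nat) z f : X z.1 -> regular_at e z.2 f ->
  regular2_at e z (fun w => f w.2).
Proof.
move=> X1 [d1 [d2 [p [q [[hp hq dE [X2 qx]] hpq]]]]].
have dE' : d1 = (d2 + e)%N by lia.
exists 0%N, d2, (rpoly p), (rpoly q); split.
  split; [by rewrite -dE'; exact: bihomog_rpoly|exact: bihomog_rpoly|].
  by split => //; rewrite bieval_rpoly.
move=> w [w1 w2]; rewrite !bieval_rpoly => qw; exact: hpq.
Qed.

Lemma pr2L_atP O s z : pr2L X O s -> O z -> regular2_at 1 z s.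
Proof.
move=> hs Oz; have [O' [U [c [h [l [[oO' O'z sub] [[oU hU] [hl hE]]]]]]]] := hs _ Oz.
have [a' [b' [g [hg gz gO]]]] := open_in2_basic oO' O'z.
have [X1 X2 _] := gz.
have := @regular2_at_sum _ (index_enum 'I_c) 1 z (fun j w => h j w * l j w.2) X1 X2.
move=> reg; apply: (regular2_at_ext hg gz _ (reg _)).
  by move=> u /gO O'u; rewrite -hE.
move=> j; have [h1 h2] := hl j; apply: (@regular2_atM 0 1).
  exact: regular2_atP h1 O'z.
by apply: regular2_at_pr2 => //; apply: regular_atP h2 _; exact: hU.
Qed.

(** A fraction P/Q of bidegree (0, 1) is a single tensor near z: P/Q = (P/(Q y_i)) y_i, for a
    coordinate y_i nonzero at the second point. *)
Lemma pr2LP O s : open_in2 X O ->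
  (forall z, O z -> regular2_at 1 z s) -> pr2L X O s.
Proof.
move=> oO hs z Oz; have [a [b [p [q [[hp hq qz] hpq]]]]] := hs _ Oz.
have [a' [b' [g [hg gz gO]]]] := open_in2_basic oO Oz.
have [X1 X2 _] := gz.
have [i yi] := exists_coord_neq0 X2.
pose Y : A2 := 'X_(rshift r.+1 i).
have hY : bihomog 0 1 Y by exact: bihomogXr.
have hO := bihomogM (bihomogM hq hg) hY.
have hqY := bihomogM hq hY; rewrite addn0 in hqY.
exists (basic_open2 (q * g * Y)), X, 1%N,
  (fun _ w => bieval p w / bieval (q * Y) w), (fun _ x => x 0 i); split.
  split; first exact: open2_basic hO.
  - by rewrite !basic_open2M; split => //; split => //; rewrite bievalXr.
  - by rewrite !basic_open2M => u [[_ /gO]].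
have oX := open_setT.
split; first by split => // w [].
split.
  move=> _; split; last by apply: regularP => // x Xx; exact: regular_atX.
  apply: regular2P; first exact: open2_basic hO.
  move=> w; rewrite !basic_open2M => -[[qw gw] Yw].
  exists a, (b + 1)%N, p, (q * Y); split => //.
  by rewrite addn0; split => //; rewrite basic_open2M.
move=> w; rewrite !basic_open2M => -[[qw gw] [_ _ Yw]].
rewrite big_ord1 hpq // bievalM -mulrA; congr (_ * _).
by rewrite -bievalXr invfM divfK.
Qed.

End Regular.

(** * The Taylor map *)

Section TaylorKernel.
Context {R : realType} {r : nat}.
Local Notation C := (R[i]).
Local Notation pt := (coords R r).
Local Notation A := {mpoly C[r.+1]}.
Local Notation A2 := {mpoly C[r.+1 + r.+1]}.
Implicit Types (p q : A) (P Q : A2) (x y : pt) (z w : pt * pt) (O : set (pt * pt)).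

Variables (X : set pt) (X0 : X `<=` [set x | x != 0]).

Lemma regular2_sub O O' h : open_in2 X O' -> O' `<=` O ->
  regular2 X O h -> regular2 X O' h.
Proof. by move=> oO sub hh; apply: regular2P => // z /sub; exact: regular2_atP. Qed.

Lemma diag_ideal_sub O O' h : open_in2 X O' -> O' `<=` O ->
  diag_ideal X O h -> diag_ideal X O' h.
Proof.
by move=> oO sub [h1 h2]; split; [exact: regular2_sub h1|move=> x /sub /h2].
Qed.

Lemma pr2L_sub O O' h : open_in2 X O' -> O' `<=` O ->
  pr2L X O h -> pr2L X O' h.
Proof. by move=> oO sub hh; apply: pr2LP => // z /sub; exact: pr2L_atP. Qed.

Lemma pr2LM O a s : open_in2 X O -> regular2 X O a -> pr2L X O s ->
  pr2L X O (fun w => a w * s w).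
Proof.
move=> oO ha hs; apply: pr2LP => // z Oz; apply: (@regular2_atM _ _ X 0 1).
  exact: regular2_atP ha Oz.
exact: pr2L_atP hs Oz.
Qed.

(** The local condition of [diag_powerL] on one fixed open set, where the closure properties are
    plain manipulations of finite sums. *)
Definition diag_power_on O e (s : pt * pt -> C) :=
  exists (c : nat) (h : 'I_c -> 'I_e -> pt * pt -> C) (t : 'I_c -> pt * pt -> C),
  (forall j, (forall l, diag_ideal X O (h j l)) /\ pr2L X O (t j)) /\
  forall w, O w -> s w = \sum_(j < c) (\prod_(l < e) h j l w) * t j w.

Lemma diag_power_on_sub O O' e s : open_in2 X O' -> O' `<=` O ->
  diag_power_on O e s -> diag_power_on O' e s.
Proof.
move=> oO sub [c [h [t [hht hE]]]]; exists c, h, t; split.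
  move=> j; have [hh ht] := hht j; split; last exact: pr2L_sub ht.
  by move=> l; exact: diag_ideal_sub (hh l).
by move=> w /sub /hE.
Qed.

Lemma diag_power_on_ext O e s s' : (forall w, O w -> s w = s' w) ->
  diag_power_on O e s -> diag_power_on O e s'.
Proof.
move=> ss [c [h [t [hht hE]]]]; exists c, h, t; split => // w Ow.
by rewrite -ss // hE.
Qed.

Lemma diag_power_onD O e s s' : diag_power_on O e s -> diag_power_on O e s' ->
  diag_power_on O e (fun w => s w + s' w).
Proof.
move=> [c [h [t [hht hE]]]] [c' [h' [t' [hht' hE']]]].
exists (c + c')%N,
  (fun i => match split i with inl j => h j | inr j => h' j end),
  (fun i => match split i with inl j => t j | inr j => t' j end); split.
  by move=> i; case: split.
move=> w Ow; rewrite hE // hE' // big_split_ord /=.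
congr (_ + _); apply: eq_bigr => i _.
  by rewrite -/(unsplit (inl i)) unsplitK.
by rewrite -/(unsplit (inr i)) unsplitK.
Qed.

Lemma diag_power_onM O e a s : open_in2 X O -> regular2 X O a ->
  diag_power_on O e s -> diag_power_on O e (fun w => a w * s w).
Proof.
move=> oO ha [c [h [t [hht hE]]]]; exists c, h, (fun j w => a w * t j w); split.
  by move=> j; have [hh ht] := hht j; split => //; exact: pr2LM.
move=> w Ow; rewrite hE // mulr_sumr; apply: eq_bigr => j _.
by rewrite mulrCA.
Qed.

Lemma diag_power_on_diag O e d s : diag_ideal X O d ->
  diag_power_on O e s -> diag_power_on O e.+1 (fun w => d w * s w).
Proof.
move=> hd [c [h [t [hht hE]]]].
exists c, (fun j l => oapp (h j) d (unlift ord0 l)), t; split.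
  move=> j; have [hh ht] := hht j; split => // l.
  by case: unliftP => /= [l' _|_].
move=> w Ow; rewrite hE // mulr_sumr; apply: eq_bigr => j _.
rewrite big_ord_recl unlift_none /= mulrA; congr (_ * _ * _).
by apply: eq_bigr => l _; rewrite liftK.
Qed.

Lemma diag_power_on0 O s : pr2L X O s -> diag_power_on O 0 s.
Proof.
move=> hs; exists 1%N, (fun _ _ _ => 0), (fun=> s); split.
  by move=> j; split => // -[].
by move=> w _; rewrite big_ord1 big_ord0 mul1r.
Qed.

Lemma diag_power_on_zero O e : diag_power_on O e (fun=> 0).
Proof.
exists 0%N, (fun _ _ _ => 0), (fun _ _ => 0); split; first by case.
by move=> w _; rewrite big_ord0.
Qed.

Definition diag_power_at e z s := exists a b Q,
  [/\ bihomog a b Q, basic_open2 X Q z & diag_power_on (basic_open2 X Q) e s].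

Lemma diag_power_atP e O s z : diag_powerL X e O s -> O z -> diag_power_at e z s.
Proof.
move=> hs Oz; have [O' [c [h [t [[oO' O'z sub] [hht hE]]]]]] := hs _ Oz.
have [a [b [Q [hQ Qz QO]]]] := open_in2_basic X0 oO' O'z.
exists a, b, Q; split => //.
have oQ := open2_basic X0 hQ.
by apply: (@diag_power_on_sub O') => //; exists c, h, t.
Qed.

Lemma diag_powerLP e O s : open_in2 X O ->
  (forall z, O z -> diag_power_at e z s) -> diag_powerL X e O s.
Proof.
move=> oO hs z Oz; have [a [b [Q [hQ Qz]]]] := hs _ Oz.
have [a' [b' [g [hg gz gO]]]] := open_in2_basic X0 oO Oz.
have oQ := open2_basic X0 (bihomogM hQ hg).
move=> /(diag_power_on_sub oQ) []; first by rewrite basic_open2M => w [].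
move=> c [h [t [hht hE]]]; exists (basic_open2 X (Q * g)), c, h, t; split => //.
split => //; first by rewrite basic_open2M.
by rewrite basic_open2M => w [_ /gO].
Qed.

Lemma diag_power_at_open e z s : diag_power_at e z s -> exists a b Q,
  [/\ bihomog a b Q, basic_open2 X Q z &
      forall w, basic_open2 X Q w -> diag_power_at e w s].
Proof.
by move=> [a [b [Q [hQ Qz h]]]]; exists a, b, Q; split => // w Qw; exists a, b, Q.
Qed.

Lemma diag_power_at_common e e' z s s' :
  diag_power_at e z s -> diag_power_at e' z s' -> exists a b Q,
  [/\ bihomog a b Q, basic_open2 X Q z, diag_power_on (basic_open2 X Q) e s &
      diag_power_on (basic_open2 X Q) e' s'].
Proof.
move=> [a [b [Q [hQ Qz h]]]] [a' [b' [Q' [hQ' Qz' h']]]].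
have oQ := open2_basic X0 (bihomogM hQ hQ').
exists (a + a')%N, (b + b')%N, (Q * Q'); split.
- exact: bihomogM.
- by rewrite basic_open2M.
- by apply: diag_power_on_sub h => //; rewrite basic_open2M => w [].
- by apply: diag_power_on_sub h' => //; rewrite basic_open2M => w [].
Qed.

Lemma diag_power_atD e z s s' : diag_power_at e z s -> diag_power_at e z s' ->
  diag_power_at e z (fun w => s w + s' w).
Proof.
move=> h h'; have [a [b [Q [hQ Qz k k']]]] := diag_power_at_common h h'.
by exists a, b, Q; split => //; exact: diag_power_onD.
Qed.

Lemma diag_power_at_ext e z s s' a b Q : bihomog a b Q -> basic_open2 X Q z ->
  (forall w, basic_open2 X Q w -> s w = s' w) ->
  diag_power_at e z s -> diag_power_at e z s'.
Proof.
move=> hQ Qz ss [a' [b' [Q' [hQ' Qz' h']]]].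
have oQ := open2_basic X0 (bihomogM hQ hQ').
exists (a + a')%N, (b + b')%N, (Q * Q'); split.
- exact: bihomogM.
- by rewrite basic_open2M.
- apply: (@diag_power_on_ext _ _ s).
    by move=> w; rewrite basic_open2M => -[/ss].
  by apply: diag_power_on_sub h' => //; rewrite basic_open2M => w [].
Qed.

Lemma diag_power_at_eq e z s s' : s =1 s' ->
  diag_power_at e z s -> diag_power_at e z s'.
Proof. by move=> /funext ->. Qed.

Lemma regular2_at_on z a : regular2_at X 0 z a -> exists b c Q,
  [/\ bihomog b c Q, basic_open2 X Q z & regular2 X (basic_open2 X Q) a].
Proof.
move=> /regular2_at_open [b [c [Q [hQ Qz h]]]]; exists b, c, Q; split => //.
by apply: regular2P => //; exact: open2_basic hQ.
Qed.

Lemma diag_power_atM e z a s : regular2_at X 0 z a -> diag_power_at e z s ->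
  diag_power_at e z (fun w => a w * s w).
Proof.
move=> /regular2_at_on [b [c [Q [hQ Qz h]]]] [b' [c' [Q' [hQ' Qz' h']]]].
have oQ := open2_basic X0 (bihomogM hQ hQ').
exists (b + b')%N, (c + c')%N, (Q * Q'); split.
- exact: bihomogM.
- by rewrite basic_open2M.
- apply: diag_power_onM => //.
    by apply: regular2_sub h => //; rewrite basic_open2M => w [].
  by apply: diag_power_on_sub h' => //; rewrite basic_open2M => w [].
Qed.

Lemma diag_power_at_diag e z d s : regular2_at X 0 z d ->
  (forall x, X x -> d (x, x) = 0) -> diag_power_at e z s ->
  diag_power_at e.+1 z (fun w => d w * s w).
Proof.
move=> /regular2_at_on [b [c [Q [hQ Qz h]]]] d0 [b' [c' [Q' [hQ' Qz' h']]]].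
have oQ := open2_basic X0 (bihomogM hQ hQ').
exists (b + b')%N, (c + c')%N, (Q * Q'); split.
- exact: bihomogM.
- by rewrite basic_open2M.
- apply: diag_power_on_diag.
    split; last by move=> x [Xx _ _]; exact: d0.
    by apply: regular2_sub h => //; rewrite basic_open2M => w [].
  by apply: diag_power_on_sub h' => //; rewrite basic_open2M => w [].
Qed.

Lemma diag_power_at0 z s : regular2_at X 1 z s -> diag_power_at 0 z s.
Proof.
move=> /regular2_at_open [b [c [Q [hQ Qz h]]]]; exists b, c, Q; split => //.
by apply/diag_power_on0/pr2LP => //; exact: open2_basic hQ.
Qed.

Lemma diag_power_at_zero e z : X z.1 -> X z.2 -> diag_power_at e z (fun=> 0).
Proof.
move=> X1 X2; exists 0%N, 0%N, 1%:MP; split; first exact: bihomogC.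
  by split => //; rewrite bievalC oner_neq0.
exact: diag_power_on_zero.
Qed.

Lemma diag_power_atN e z s : diag_power_at e z s ->
  diag_power_at e z (fun w => - s w).
Proof.
move=> h; have [a [b [Q [_ [X1 X2 _] _]]]] := h.
have := @diag_power_atM e z (fun=> -1) s _ h.
under [X in diag_power_at _ _ X]eq_fun do rewrite mulN1r.
apply; exists 0%N, 0%N, (-1)%:MP, 1%:MP; split.
  split; [exact: bihomogC|exact: bihomogC|split => //].
  by rewrite bievalC oner_neq0.
by move=> w _; rewrite !bievalC divr1.
Qed.

(* Off the diagonal some 2 x 2 minor of (x, y) is a unit, so I_Delta = O.     *)
Lemma diag_power_at_offdiag e z s i j : X z.1 -> X z.2 ->
  z.1 0 i * z.2 0 j != z.1 0 j * z.2 0 i ->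
  regular2_at X 1 z s -> diag_power_at e z s.
Proof.
move=> X1 X2 nz hs.
have [a xa] := exists_coord_neq0 X0 X1; have [b yb] := exists_coord_neq0 X0 X2.
pose x i : A2 := 'X_(lshift r.+1 i); pose y i : A2 := 'X_(rshift r.+1 i).
(* [N] only corrects the bidegree: M/N is a section of I_Delta invertible near z, and s is recovered
   by multiplying e times by M/N and by its inverse. *)
pose M := x i * y j - x j * y i; pose N := x a * y b.
have hM : bihomog 1 1 M.
  apply: bihomogD; first exact: (bihomogM (@bihomogXl _ _ _) (@bihomogXr _ _ _)).
  apply: bihomogN; exact: (bihomogM (@bihomogXl _ _ _) (@bihomogXr _ _ _)).
have hN : bihomog 1 1 N.
  exact: (bihomogM (@bihomogXl _ _ _) (@bihomogXr _ _ _)).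
have Mz : basic_open2 X M z.
  by split => //; rewrite bievalB !bievalM !bievalXl !bievalXr subr_eq0.
have Nz : basic_open2 X N z.
  by split => //; rewrite !bievalM !bievalXl !bievalXr mulf_neq0.
pose m w := bieval M w / bieval N w; pose m' w := bieval N w / bieval M w.
have rm : regular2_at X 0 z m by exists 1%N, 1%N, M, N.
have rm' : regular2_at X 0 z m' by exists 1%N, 1%N, N, M.
have m0 u : X u -> m (u, u) = 0.
  rewrite /m bievalB !bievalM !bievalXl !bievalXr /=.
  by rewrite [X in _ - X]mulrC subrr mul0r.
elim: e => [|e IH]; first exact: diag_power_at0.
have := diag_power_at_diag rm m0 (diag_power_atM rm' IH).
apply: (diag_power_at_ext (bihomogM hM hN)); first by rewrite basic_open2M.
move=> w; rewrite basic_open2M => -[[_ _ Mw] [_ _ Nw]].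
by rewrite /m /m' mulrA mulf_div [X in _ / X]mulrC divff ?mul1r // mulf_neq0.
Qed.

(** Replaces cosets with an unspecified neighbourhood by two conditions at z, each of which holds
    near z as soon as it holds at z. *)
Lemma pp_germP k s z t : X z.1 -> X z.2 ->
  pp_germ X k s z t <->
  regular2_at X 1 z t /\ diag_power_at k.+1 z (fun w => t w - s w).
Proof.
move=> X1 X2; split.
  move=> [O [oO Oz ht hts]]; split; first exact: pr2L_atP ht Oz.
  exact: diag_power_atP hts Oz.
move=> [/regular2_at_open [a [b [Q [hQ Qz h]]]]].
move=> /diag_power_at_open [a' [b' [Q' [hQ' Qz' h']]]].
have oQ := open2_basic X0 (bihomogM hQ hQ').
exists (basic_open2 X (Q * Q')); split => //.
- by rewrite basic_open2M.
- by apply: pr2LP => // w; rewrite basic_open2M => -[/h].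
- by apply: diag_powerLP => // w; rewrite basic_open2M => -[_ /h'].
Qed.

Lemma regular2_atB z s t : regular2_at X 1 z s -> regular2_at X 1 z t ->
  regular2_at X 1 z (fun w => s w - t w).
Proof.
move=> hs ht; apply: regular2_atD => //.
have [a [b [P [Q [[hP hQ Qz] h]]]]] := ht.
exists a, b, (- P), Q; split; first by split => //; exact: bihomogN.
by move=> w Qw; rewrite h // /bieval mevalN mulNr.
Qed.

Lemma pp_add_germ k (phi psi : pp_family) s t z : X z.1 -> X z.2 ->
  regular2_at X 1 z s -> regular2_at X 1 z t ->
  phi z = pp_germ X k s z -> psi z = pp_germ X k t z ->
  pp_add phi psi z = pp_germ X k (fun w => s w + t w) z.
Proof.
move=> X1 X2 hs ht phiE psiE; rewrite /pp_add phiE psiE.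
apply/seteqP; split => u.
  move=> [u1 [u2 [/pp_germP [] // r1 d1 /pp_germP [] // r2 d2 ->]]].
  apply/pp_germP => //; split; first exact: regular2_atD.
  apply: diag_power_at_eq (diag_power_atD d1 d2) => w /=.
  by rewrite opprD addrACA.
move=> /pp_germP [] // ru du.
exists (fun w => u w - t w), t; split.
- apply/pp_germP => //; split; first exact: regular2_atB.
  by apply: diag_power_at_eq du => w /=; rewrite opprD addrA addrAC.
- apply/pp_germP => //; split => //.
  apply: diag_power_at_eq (diag_power_at_zero k.+1 X1 X2) => w.
  by rewrite subrr.
- by apply/funext => w; rewrite subrK.
Qed.

Lemma pp_scale_germ k (phi : pp_family) a s z : X z.1 -> X z.2 ->
  regular_at X 0 z.1 a -> regular2_at X 1 z s -> phi z = pp_germ X k s z ->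
  pp_scale X k a phi z = pp_germ X k (fun w => a w.1 * s w) z.
Proof.
move=> X1 X2 ha hs phiE; rewrite /pp_scale phiE.
apply/seteqP; split => u.
  move=> [u1 /pp_germP [] // r1 d1 /pp_germP [] // ru du].
  apply/pp_germP => //; split => //.
  have := diag_power_atD du (diag_power_atM (regular2_at_pr1 X2 ha) d1).
  by apply: diag_power_at_eq => w /=; rewrite mulrBr addrA subrK.
move=> hu; exists s => //; apply/pp_germP => //; split => //.
apply: diag_power_at_eq (diag_power_at_zero k.+1 X1 X2) => w.
by rewrite subrr.
Qed.

(** The section of pr_2^* L that represents alpha_k(s), for every k at once: at (x, y) it is the
    linear form s(x) evaluated at y. *)
Definition contraction (s : pt -> linforms R r) w : C :=
  \sum_i s w.1 0 i * w.2 0 i.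

Lemma regular2_at_contraction (s : pt -> linforms R r) z : X z.1 -> X z.2 ->
  (forall i, regular_at X 0 z.1 (fun x => s x 0 i)) ->
  regular2_at X 1 z (contraction s).
Proof.
move=> X1 X2 hs; apply: regular2_at_sum => // i.
apply: (@regular2_atM _ _ X 0 1).
  exact: (@regular2_at_pr1 _ _ X z (fun x => s x 0 i) X2 (hs i)).
exact: (@regular2_at_pr2 _ _ X 1%N z (fun y : pt => y 0 i) X1 (regular_atX i X2)).
Qed.

Lemma taylor_map_germ k (s : pt -> linforms R r) z : X z.1 -> X z.2 ->
  (forall i, regular_at X 0 z.1 (fun x => s x 0 i)) ->
  taylor_map X k s z = pp_germ X k (contraction s) z.
Proof.
move=> X1 X2 hs; rewrite /taylor_map /contraction.
elim: (index_enum _) => [|i l IH].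
  rewrite big_nil; under [X in pp_germ _ _ X]eq_fun do rewrite big_nil.
  by [].
rewrite big_cons; under [X in pp_germ _ _ X]eq_fun do rewrite big_cons.
have ri j : regular2_at X 1 z (fun w => w.2 0 j).
  exact: (@regular2_at_pr2 _ _ X 1%N z (fun y : pt => y 0 j) X1 (regular_atX j X2)).
have rsi j : regular2_at X 1 z (fun w => s w.1 0 j * w.2 0 j).
  apply: (@regular2_atM _ _ X 0 1) => //.
  exact: (@regular2_at_pr1 _ _ X z (fun x => s x 0 j) X2 (hs j)).
apply: pp_add_germ => //; first exact: regular2_at_sum.
apply: pp_scale_germ => //; rewrite /universal_diff; congr (pp_germ X k _ z).
apply/funext => w; rewrite /lin_eval (bigD1 i) //= mxE !eqxx mul1r.
by rewrite big1 ?addr0 // => j /negbTE ji; rewrite mxE ji andbF mul0r.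
Qed.

(** The form in which ker(alpha_k) is used from here on. The coset of a section is the zero coset
    exactly when the section lies in I_Delta^(k+1) pr_2^* L, because that submodule is closed under
    sums and opposites. *)
Lemma taylor_kernelP k U s : open_in X U ->
  taylor_kernel X k U s <-> Vtensor X 0 U s /\
    forall z, (U `*` X) z -> diag_power_at k.+1 z (contraction s).
Proof.
move=> oU; have UX : U `<=` X by case: oU => Z _ -> x [].
have key (hs : Vtensor X 0 U s) z : (U `*` X) z ->
    taylor_map X k s z = pp_zero X k z <-> diag_power_at k.+1 z (contraction s).
  move=> [U1 X2]; have X1 := UX _ U1.
  have rs i : regular_at X 0 z.1 (fun x => s x 0 i).
    exact: (regular_atP X0 (hs i)).
  have rc := regular2_at_contraction X1 X2 rs.
  rewrite taylor_map_germ // /pp_zero; split.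
    move=> E; have : pp_germ X k (contraction s) z (contraction s).
      apply/pp_germP => //; split => //.
      apply: diag_power_at_eq (diag_power_at_zero k.+1 X1 X2) => w.
      by rewrite subrr.
    rewrite E => /pp_germP [] // _; apply: diag_power_at_eq => w.
    by rewrite subr0.
  move=> h; apply/seteqP; split => t /pp_germP [] // rt dt.
    apply/pp_germP => //; split => //.
    by apply: diag_power_at_eq (diag_power_atD dt h) => w; rewrite subrK subr0.
  apply/pp_germP => //; split => //.
  apply: diag_power_at_eq (diag_power_atD dt (diag_power_atN h)) => w.
  by rewrite subr0.
by split => -[hs h]; split => // z hz; apply/key => //; exact: h.
Qed.

Lemma taylor_kernel_sub k U U' s : open_in X U' -> U' `<=` U ->
  taylor_kernel X k U s -> taylor_kernel X k U' s.
Proof.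
move=> oU' sub [h1 h2]; split; first by move=> i; exact: regular_sub (h1 i).
by move=> z [/sub ? ?]; apply: h2.
Qed.

End TaylorKernel.

(** * The function field *)

Definition prime_ideal (A : comNzRingType) (J : set A) :=
  [/\ forall a b, J a -> J b -> J (a - b), forall a b, J b -> J (a * b),
      ~ J 1, J 0 & forall a b, J (a * b) -> J a \/ J b].

(** * The quotient by a prime ideal *)

Section ResidueDomain.
Variables (A : comNzRingType) (J : set A) (hJ : prime_ideal J).

(** The proof of primality is an argument so that the ideal structures, which depend on it, can be
    attached to this predicate. *)
Definition prime_ideal_pred of prime_ideal J : pred A := fun a => `[< J a >].
Local Notation I := (prime_ideal_pred hJ).

Lemma prime_ideal_pred_closed : idealr_closed I.
Proof.
case: hJ => hB hM h1 h0 hp; split.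
- exact/asboolP.
- exact/asboolP.
- move=> a u v /asboolP Ju /asboolP Jv; apply/asboolP.
  rewrite -[v]opprK; apply: hB; first exact: hM.
  by rewrite -mulN1r; exact: hM.
Qed.

Lemma prime_ideal_pred_prime : prime_idealr_closed I.
Proof.
case: hJ => hB hM h1 h0 hp a b /asboolP /hp [h|h]; apply/orP; [left|right];
  exact/asboolP.
Qed.

HB.instance Definition _ := isIdealr.Build A I prime_ideal_pred_closed.
HB.instance Definition _ := isPrimeIdealrClosed.Build A I prime_ideal_pred_prime.

Definition prime_idealr_of : prime_idealr A := I.

Definition residue := {ideal_quot prime_idealr_of}.
HB.instance Definition _ := GRing.ComNzRing.on residue.

(** The fraction field is built over an integral domain equipped with a unit predicate and an
    inverse; both are supplied classically. *)
Definition residue_unit : {pred residue} := fun x => `[< exists y, y * x = 1 >].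
Definition residue_inv (x : residue) : residue :=
  if pselect (exists y, y * x = 1) is left h then sval (cid h) else x.

Lemma residue_mulVx : {in residue_unit, left_inverse 1 residue_inv *%R}.
Proof.
move=> x /asboolP h; rewrite /residue_inv; case: pselect => // h'.
by case: cid.
Qed.

Lemma residue_unitPl (x y : residue) : y * x = 1 -> residue_unit x.
Proof. by move=> h; apply/asboolP; exists y. Qed.

Lemma residue_invr_out : {in [predC residue_unit], residue_inv =1 id}.
Proof.
move=> x /negP nx; rewrite /residue_inv; case: pselect => // h.
by case: nx; apply/asboolP.
Qed.

HB.instance Definition _ := GRing.ComNzRing_hasMulInverse.Build residue
  residue_mulVx residue_unitPl residue_invr_out.

Lemma residue_integral (x y : residue) : x * y = 0 -> (x == 0) || (y == 0).
Proof. exact: Quotient.rquot_IdomainAxiom. Qed.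

HB.instance Definition _ := GRing.ComUnitRing_isIntegral.Build residue
  residue_integral.

End ResidueDomain.

Section FractionField.
Local Open Scope quotient_scope.

Lemma fraction_numden (D : idomainType) (x : {fraction D}) :
  exists n d : D, d != 0 /\ x = tofrac n / tofrac d.
Proof.
elim/quotW: x => f; exists \n_f, \d_f; split; first exact: denom_ratioP.
have nd : tofrac \d_f != 0 by rewrite tofrac_eq0 denom_ratioP.
apply: (mulIf nd); rewrite divfK //.
unlock FracField.tofrac; rewrite -[LHS]FracField.pi_mul.
apply/eqmodP; rewrite /= FracField.equivfE.
by rewrite !numden_Ratio ?(mulf_neq0, oner_neq0, denom_ratioP) // !mulr1 mulrC.
Qed.

(** The interface through which the function field is used: a ring morphism with kernel J whose
    fractions exhaust K. *)
Lemma prime_ideal_fraction_field (A : comNzRingType) (J : set A) :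
  prime_ideal J -> exists (K : fieldType) (phi : {rmorphism A -> K}),
    (forall a, phi a = 0 <-> J a) /\
    forall x, exists a b, ~ J b /\ x = phi a / phi b.
Proof.
move=> hJ; pose D := residue hJ.
pose phi : {rmorphism A -> {fraction D}} := (@tofrac D \o \pi_D)%FUN.
have phi0 a : phi a = 0 <-> J a.
  split=> [/eqP|h].
    rewrite /= tofrac_eq0 -(rmorph0 \pi_D) -Quotient.idealrBE subr0.
    by move/asboolP.
  apply/eqP; rewrite /= tofrac_eq0 -(rmorph0 \pi_D) -Quotient.idealrBE subr0.
  exact/asboolP.
exists {fraction D}, phi; split => // x.
have [n [d [nd ->]]] := fraction_numden x.
exists (repr n), (repr d); split; last by rewrite /= !reprK.
by move=> /phi0 /eqP; rewrite /= reprK tofrac_eq0 (negbTE nd).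
Qed.

End FractionField.

(** * The affine chart where the coordinate [i0] is nonzero *)

Section Chart.
Context {R : realType} {r : nat}.
Local Notation C := (R[i]).
Local Notation pt := (coords R r).
Local Notation A := {mpoly C[r.+1]}.
Local Notation A2 := {mpoly C[r.+1 + r.+1]}.
Implicit Types (p q : A) (P Q : A2) (x y : pt) (z w : pt * pt).

Variables (X : set pt) (i0 : 'I_r.+1).

Definition normalize x : pt := (x 0 i0)^-1 *: x.
Definition normalize2 w := (normalize w.1, normalize w.2).
Definition chart : set pt := [set x | X x /\ x 0 i0 != 0].
(** The ideal of the chart embedded in the hyperplane x_i0 = 1; it contains X_i0 - 1, which takes
    the place of removing a variable. *)
Definition chart_ideal : set A :=
  [set p | forall x, chart x -> heval p (normalize x) = 0].

Local Notation nz := normalize.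
Local Notation J := chart_ideal.

Lemma normalizeK x : x 0 i0 != 0 -> x 0 i0 *: nz x = x.
Proof. by move=> h; rewrite scalerA divff // scale1r. Qed.

Lemma heval_normalize d p x : p \is d.-homog -> x 0 i0 != 0 ->
  heval p x = x 0 i0 ^+ d * heval p (nz x).
Proof. by move=> hp h; rewrite -(heval_homog _ _ hp) normalizeK. Qed.

Lemma bieval_normalize a b P w : bihomog a b P ->
  w.1 0 i0 != 0 -> w.2 0 i0 != 0 ->
  bieval P w = w.1 0 i0 ^+ a * w.2 0 i0 ^+ b * bieval P (normalize2 w).
Proof.
by move=> hP h1 h2; rewrite -(bieval_bihomog _ _ _ _ hP) !normalizeK //; case: w h1 h2.
Qed.

Lemma homogenization p : exists d hp, hp \is d.-homog /\
  forall x, x 0 i0 != 0 -> heval hp x = x 0 i0 ^+ d * heval p (nz x).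
Proof.
(* Every monomial is completed by a power of X_i0 to the degree [msize p], which strictly exceeds
   the degrees of all monomials of [p]. *)
exists (msize p),
  (\sum_(m <- msupp p) p@_m *: ('X_[m] * 'X_i0 ^+ (msize p - mdeg m))); split.
  rewrite big_seq_cond; apply: rpred_sum => m /andP [/msize_mdeg_lt hm _].
  apply: dhomogZ; have := @dhomogM _ _ mdeg (mdeg m) 'X_[m] (msize p - mdeg m)
    ('X_i0 ^+ (msize p - mdeg m)).
  rewrite subnKC 1?ltnW //; apply; first by rewrite dhomogX.
  by rewrite -[X in X.-homog]mul1n; exact/dhomogMn/dhomogXi.
move=> x x0.
have -> : heval p (nz x) = \sum_(m <- msupp p) p@_m * heval 'X_[m] (nz x).
  rewrite {1}[p]mpolyE /heval raddf_sum.
  by apply: eq_bigr => m _; exact: mevalZ.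
rewrite /heval raddf_sum mulr_sumr /=.
apply: eq_big_seq => m /msize_mdeg_lt hm.
rewrite mevalZ mulrCA; congr (_ * _); rewrite mevalM rmorphXn /= mevalXU.
rewrite -!/(heval _ _) (@heval_normalize (mdeg m) 'X_[m]) // ?dhomogX //.
by rewrite mulrAC -exprD subnKC // ltnW.
Qed.

Hypotheses (X0 : X `<=` [set x | x != 0]).
Hypothesis hirr : irreducible_set X.
Hypothesis hchart : chart !=set0.

Lemma irreducible_homog d e p q : p \is d.-homog -> q \is e.-homog ->
  (forall x, X x -> heval p x * heval q x = 0) ->
  (forall x, X x -> heval p x = 0) \/ (forall x, X x -> heval q x = 0).
Proof.
move=> hp hq hpq.
pose Z p := [set x : pt | x != 0 /\ heval p x = 0].
have hZ f n : f \is n.-homog -> zclosed (Z f).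
  move=> hf; exists [set f]; split; first by move=> _ ->; exists n.
  apply/seteqP; split => x /= [x0 hx]; split => //; last exact: hx.
  by move=> _ ->.
have [_ /(_ _ _ (hZ _ _ hp) (hZ _ _ hq)) []] := hirr.
- move=> x Xx; have /eqP := hpq _ Xx; rewrite mulf_eq0.
  by case/orP => /eqP h; [left|right]; split => //; exact: X0.
- by move=> h; left => x /h [].
- by move=> h; right => x /h [].
Qed.

(** p X_i0 vanishes on X, on the chart by hypothesis and elsewhere through X_i0. As X_i0 is not zero
    on all of X, irreducibility leaves p. *)
Lemma chart_ideal_homog d p : p \is d.-homog -> J p ->
  forall x, X x -> heval p x = 0.
Proof.
move=> hp Jp; have [x Xx|//|h] := irreducible_homog hp (dhomogXi i0).
  rewrite hevalXU; have [->|x0] := eqVneq (x 0 i0) 0; first by rewrite mulr0.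
  by rewrite (heval_normalize hp x0) Jp // mulr0 mul0r.
have [x [Xx]] := hchart; have := h _ Xx; rewrite hevalXU => ->.
by rewrite eqxx.
Qed.

Lemma chart_ideal_prime : prime_ideal J.
Proof.
split.
- by move=> a b ha hb x cx; rewrite hevalB ha // hb // subrr.
- by move=> a b hb x cx; rewrite hevalM hb // mulr0.
- have [x cx] := hchart; move=> /(_ _ cx) /eqP.
  by rewrite /heval meval1 oner_eq0.
- by move=> x cx; rewrite /heval meval0.
- move=> a b hab; have [d [ha [hha haE]]] := homogenization a.
  have [e [hb [hhb hbE]]] := homogenization b.
  (* The extra factor X_i0 makes the product of the homogenizations vanish outside the chart as
     well. *)
  have hhaX := dhomogM hha (dhomogXi i0).
  have [x Xx|h|h] := irreducible_homog hhaX hhb.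
  + rewrite hevalM hevalXU; have [->|x0] := eqVneq (x 0 i0) 0.
      by rewrite mulr0 mul0r.
    rewrite haE // hbE // mulrAC mulrACA -hevalM hab // mulr0 mul0r //.
  + left => x [Xx x0]; have /eqP := h _ Xx.
    rewrite hevalM hevalXU haE // !mulf_eq0 (negbTE x0) orbF.
    by rewrite expf_eq0 (negbTE x0) andbF => /eqP.
  + right => x [Xx x0]; have /eqP := h _ Xx.
    rewrite hbE // !mulf_eq0.
    by rewrite expf_eq0 (negbTE x0) andbF => /eqP.
Qed.

Lemma open_meets_chart U : open_in X U -> U !=set0 -> exists2 x, U x & chart x.
Proof.
move=> oU [x Ux]; have [d [q [hq [Xx qx] qU]]] := open_in_basic X0 oU Ux.
apply: contrapT => ex.
have [u Xu|h|h] := irreducible_homog hq (dhomogXi i0).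
- apply/eqP; rewrite mulf_eq0 hevalXU -[_ || _]negbK negb_or; apply/negP.
  by move=> /andP [qu u0]; apply: ex; exists u => //; apply: qU.
- by move: qx; rewrite h // eqxx.
- by have [u [Xu]] := hchart; rewrite -hevalXU h // eqxx.
Qed.

(** [q] need not be homogeneous; its nonvanishing locus on the chart is the principal open set of
    its homogenization times X_i0. *)
Lemma chart_open_basic q : ~ J q -> exists U, [/\ open_in X U, U !=set0,
  U `<=` chart & forall x, U x <-> chart x /\ heval q (nz x) != 0].
Proof.
move=> nJ; have [d [h [hh hE]]] := homogenization q.
have UE x : basic_open X (h * 'X_i0) x <-> chart x /\ heval q (nz x) != 0.
  split.
    move=> [Xx]; rewrite hevalM hevalXU mulf_eq0 negb_or => /andP [hx x0].
    split => //; move: hx; rewrite hE // mulf_eq0 negb_or.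
    by case/andP.
  move=> [[Xx x0] qx]; split => //.
  by rewrite hevalM hevalXU hE // !mulf_neq0 // expf_neq0.
exists (basic_open X (h * 'X_i0)); split => //.
- exact: open_basic (dhomogM hh (dhomogXi i0)).
- apply: contrapT => ex; apply: nJ => x cx.
  by apply/eqP/negPn/negP => qx; apply: ex; exists x; apply/UE.
- by move=> x /UE [].
Qed.

Lemma regular_at_normalize p x : chart x ->
  regular_at X 0 x (fun u => heval p (nz u)).
Proof.
move=> [Xx x0]; rewrite [p]mpolyE.
have rC c : regular_at X 0 x (fun=> c) by exact: regular_atC.
have rM f g : regular_at X 0 x f -> regular_at X 0 x g ->
    regular_at X 0 x (fun u => f u * g u) by exact: (@regular_atM _ _ X 0 0).
have -> : (fun u => heval (\sum_(m <- msupp p) p@_m *: 'X_[m]) (nz u)) =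
    (fun u => \sum_(m <- msupp p) p@_m * \prod_i (nz u) 0 i ^+ m i).
  apply/funext => u; rewrite /heval raddf_sum; apply: eq_bigr => m _.
  by rewrite /= mevalZ mevalX.
apply: regular_at_sum => // m; apply: (rM) => //.
have rX i : regular_at X 0 x (fun u => nz u 0 i).
  under eq_fun do rewrite mxE.
  exact: (@regular_atM _ _ X (-1) 1 x _ _ (regular_atXV Xx x0) (regular_atX i Xx)).
elim: (index_enum _) => [|i s IH].
  under eq_fun do rewrite big_nil.
  exact: rC.
under eq_fun do rewrite big_cons.
apply: (rM) => //.
elim: (m i) => [|n IHn].
  under eq_fun do rewrite expr0.
  exact: rC.
under eq_fun do rewrite exprS.
exact: (rM).
Qed.

Lemma regular_atV x f : regular_at X 0 x f -> f x != 0 ->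
  regular_at X 0 x (fun u => (f u)^-1).
Proof.
move=> [d1 [d2 [p [q [[hp hq dE qx] hpq]]]]] fx.
have px : heval p x != 0.
  by apply: contraNneq fx => px; rewrite hpq // px mul0r.
exists (d2 + d2)%N, (d1 + d2)%N, (q * q), (p * q); split.
  split; [exact: dhomogM|exact: dhomogM|lia|].
  by rewrite basic_openM; split => //; case: qx.
move=> u; rewrite basic_openM => -[pu qu]; rewrite hpq //.
have [_ qu0] := qu.
by rewrite !hevalM -mulf_div divff // mulr1 invf_div.
Qed.

Lemma regular_at_normalize_frac a b x : chart x -> heval b (nz x) != 0 ->
  regular_at X 0 x (fun u => heval a (nz u) / heval b (nz u)).
Proof.
move=> cx bx; apply: (@regular_atM _ _ X 0 0).
  exact: regular_at_normalize.
apply: (@regular_atV x (fun u => heval b (nz u))) => //.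
exact: regular_at_normalize.
Qed.

Lemma regular2_at_normalize P z : chart z.1 -> chart z.2 ->
  regular2_at X 0 z (fun w => bieval P (normalize2 w)).
Proof.
move=> c1 c2; have [X1 _] := c1; have [X2 _] := c2; rewrite [P]mpolyE.
have rC c : regular2_at X 0 z (fun=> c).
  exact: (@regular2_at_pr1 _ _ X z (fun=> c) X2 (regular_atC c X1)).
have rM f g : regular2_at X 0 z f -> regular2_at X 0 z g ->
    regular2_at X 0 z (fun u => f u * g u) by exact: (@regular2_atM _ _ X 0 0).
have -> : (fun w => bieval (\sum_(m <- msupp P) P@_m *: 'X_[m]) (normalize2 w)) =
    (fun w => \sum_(m <- msupp P) P@_m *
       \prod_i bieval 'X_i (normalize2 w) ^+ m i).
  apply/funext => u; rewrite /bieval raddf_sum; apply: eq_bigr => m _.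
  rewrite /= mevalZ mevalX; congr (_ * _); apply: eq_bigr => i _.
  by rewrite mevalXU.
apply: regular2_at_sum => // m; apply: (rM) => //.
have rX i : regular2_at X 0 z (fun w => bieval 'X_i (normalize2 w)).
  case: (splitP i) => j ij.
    have -> : i = lshift r.+1 j by exact: val_inj.
    under eq_fun do rewrite bievalXl -hevalXU.
    exact: (@regular2_at_pr1 _ _ X z (fun x => heval 'X_j (nz x)) X2
             (regular_at_normalize _ c1)).
  have -> : i = rshift r.+1 j by exact: val_inj.
  under eq_fun do rewrite bievalXr -hevalXU.
  exact: (@regular2_at_pr2 _ _ X 0 z (fun x => heval 'X_j (nz x)) X1
           (regular_at_normalize _ c2)).
elim: (index_enum _) => [|i s IH].
  under eq_fun do rewrite big_nil.
  exact: rC.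
under eq_fun do rewrite big_cons.
apply: (rM) => //.
elim: (m i) => [|n IHn].
  under eq_fun do rewrite expr0.
  exact: rC.
under eq_fun do rewrite exprS.
exact: (rM).
Qed.

End Chart.

(** * Subspaces of row vectors and their basis matrices *)

Lemma vspace_of_linear_set (K : fieldType) (n : nat) (P : set 'rV[K]_n) :
  P 0 -> (forall u v, P u -> P v -> P (u + v)) ->
  (forall a v, P v -> P (a *: v)) ->
  exists W : {vspace 'rV[K]_n}, forall v, v \in W <-> P v.
Proof.
move=> P0 PD PZ; have [M hM] := submx_of_linear_set P0 PD PZ.
exists <<[tuple row i M | i < n]>>%VS => v; split.
  move=> /coord_span ->; elim/big_ind: _ => [//||i _]; first exact: PD.
  by apply: PZ; rewrite -tnth_nth tnth_mktuple; apply/hM; exact: row_sub.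
move=> /hM /submxP [u ->]; rewrite mulmx_sum_row.
apply: memv_suml => i _; apply: memvZ; apply: memv_span.
by apply/tnthP; exists i; rewrite tnth_mktuple.
Qed.

Definition vbasis_mx (K : fieldType) (n : nat) (W : {vspace 'rV[K]_n}) :
  'M[K]_(\dim W, n) := \matrix_i (vbasis W)`_i.

Lemma row_vbasis_mx (K : fieldType) n (W : {vspace 'rV[K]_n}) i :
  row i (vbasis_mx W) = (vbasis W)`_i.
Proof. exact: rowK. Qed.

Lemma sub_vbasis_mx (K : fieldType) n (W : {vspace 'rV[K]_n}) v :
  (v <= vbasis_mx W)%MS = (v \in W).
Proof.
apply/idP/idP => [/submxP [u ->]|vW].
  rewrite mulmx_sum_row; apply: memv_suml => i _; rewrite row_vbasis_mx.
  by apply: memvZ; apply: vbasis_mem; rewrite mem_nth // size_tuple.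
rewrite (coord_vbasis vW); apply: summx_sub => i _; apply: scalemx_sub.
by rewrite -row_vbasis_mx row_sub.
Qed.

Lemma rank_vbasis_mx (K : fieldType) n (W : {vspace 'rV[K]_n}) :
  \rank (vbasis_mx W) = \dim W.
Proof.
apply/eqP; rewrite -/(row_free _); apply: inj_row_free => u.
rewrite mulmx_sum_row => h; apply/rowP => i; rewrite mxE.
have /freeP := basis_free (vbasisP W); apply.
by rewrite -[RHS]h; apply: eq_bigr => j _; rewrite row_vbasis_mx.
Qed.

(** * Twists and constant subsheaves *)

Section Sheaves.
Context {R : realType} {r : nat}.
Local Notation C := (R[i]).
Local Notation pt := (coords R r).
Local Notation V := (linforms R r).
Local Notation A := {mpoly C[r.+1]}.
Implicit Types (x y : pt) (U : set pt).

Variables (X : set pt) (X0 : X `<=` [set x | x != 0]).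

Lemma open_sub U : open_in X U -> U `<=` X.
Proof. by move=> [Z _ ->] x []. Qed.

Lemma open_common U U' : irreducible_set X -> open_in X U -> open_in X U' ->
  U !=set0 -> U' !=set0 ->
  exists V', [/\ open_in X V', V' !=set0, V' `<=` U & V' `<=` U'].
Proof.
move=> hirr oU oU' [x Ux] [x' Ux'].
have [d [q [hq [Xx qx] qU]]] := open_in_basic X0 oU Ux.
have [d' [q' [hq' [Xx' qx'] qU']]] := open_in_basic X0 oU' Ux'.
exists (basic_open X (q * q')); split.
- exact: open_basic (dhomogM hq hq').
- apply: contrapT => ex.
  have [u Xu|h|h] := irreducible_homog X0 hirr hq hq'.
  + apply/eqP/negPn/negP => qu; apply: ex; exists u.
    by split => //; rewrite hevalM.
  + by move: qx; rewrite h // eqxx.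
  + by move: qx'; rewrite h // eqxx.
- by rewrite basic_openM => u [/qU].
- by rewrite basic_openM => u [_ /qU'].
Qed.

Lemma open_common_fin n (U : set pt) (F : 'I_n -> set pt) : irreducible_set X ->
  open_in X U -> U !=set0 -> (forall i, open_in X (F i) /\ F i !=set0) ->
  exists V', [/\ open_in X V', V' !=set0, V' `<=` U & forall i, V' `<=` F i].
Proof.
move=> hirr oU U0; elim: n F => [|n IH] F hF.
  by exists U; split => // -[].
have [V1 [o1 n1 s1 s1']] := IH (fun i => F (lift ord0 i)) (fun i => hF _).
have [oF nF] := hF ord0.
have [V2 [o2 n2 s2 s2']] := open_common hirr o1 oF n1 nF.
exists V2; split => //; first exact: subset_trans s1.
by move=> i; case: (unliftP ord0 i) => [j ->|->] //; exact: subset_trans (s1' j).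
Qed.

Lemma open_inI U U' x : open_in X U -> open_in X U' -> U x -> U' x ->
  exists V', [/\ open_in X V', V' x, V' `<=` U & V' `<=` U'].
Proof.
move=> oU oU' Ux Ux'.
have [d [q [hq qx qU]]] := open_in_basic X0 oU Ux.
have [d' [q' [hq' qx' qU']]] := open_in_basic X0 oU' Ux'.
exists (basic_open X (q * q')); split.
- exact: open_basic (dhomogM hq hq').
- by rewrite basic_openM.
- by rewrite basic_openM => u [/qU].
- by rewrite basic_openM => u [_ /qU'].
Qed.

Lemma twist_regular_at d d' (F : sheaf) :
  (forall U t x i, open_in X U -> F U t -> U x ->
     regular_at X d x (fun u => t u 0 i)) ->
  forall U s x i, twist X d' F U s -> U x ->
     regular_at X (d' + d) x (fun u => s u 0 i).
Proof.
move=> hF U s x i hs Ux.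
have [U' [c [g [t [[oU' U'x sub] [hgt hE]]]]]] := hs _ Ux.
have Xx := open_sub oU' U'x.
apply: (regular_at_ext_open X0 oU' U'x
  (f := fun u => \sum_(j < c) g j u * t j u 0 i)).
  by move=> u /hE ->; rewrite summxE; apply: eq_bigr => j _; rewrite mxE.
apply: regular_at_sum => // j; have [hg ht] := hgt j.
by apply: regular_atM; [exact: regular_atP hg U'x|exact: hF ht U'x].
Qed.

Lemma twist_mem d (F : sheaf) (W : {vspace V}) :
  (forall U t x, open_in X U -> F U t -> U x -> t x \in W) ->
  forall U s x, twist X d F U s -> U x -> s x \in W.
Proof.
move=> hF U s x hs Ux.
have [U' [c [g [t [[oU' U'x sub] [hgt hE]]]]]] := hs _ Ux.
rewrite hE //; apply: memv_suml => j _; apply: memvZ.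
by have [_ ht] := hgt j; exact: hF ht U'x.
Qed.

Lemma twist_one d (F : sheaf) U g t : open_in X U -> regular X d U g -> F U t ->
  twist X d F U (fun u => g u *: t u).
Proof.
move=> oU hg ht x Ux; exists U, 1%N, (fun=> g), (fun=> t).
by split => //; split => // u Uu; rewrite big_ord1.
Qed.

Lemma taylor_kernel_regular_at k U t x i : taylor_kernel X k U t -> U x ->
  regular_at X 0 x (fun u => t u 0 i).
Proof. by move=> [ht _]; exact: (regular_atP X0 (ht i)). Qed.

Lemma Rsheaf_regular_at k U t x i : Rsheaf X k U t -> U x ->
  regular_at X (-1) x (fun u => t u 0 i).
Proof.
move=> ht Ux; rewrite -[-1]addr0.
apply: (@twist_regular_at 0 (-1) (taylor_kernel X k)) ht Ux.
by move=> U' t' x' i' _; exact: taylor_kernel_regular_at.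
Qed.

Lemma untwisted_regular_at k U t x i : twist X 1 (Rsheaf X k) U t -> U x ->
  regular_at X 0 x (fun u => t u 0 i).
Proof.
move=> ht Ux; rewrite -[0](subrr 1).
apply: (@twist_regular_at (-1) 1 (Rsheaf X k)) ht Ux.
by move=> U' t' x' i' _; exact: Rsheaf_regular_at.
Qed.

(** Where x_i is invertible, its inverse generates L^*, and tensoring with it carries ker(alpha_k)
    into R_k. *)
Lemma Rsheaf_scale k U s i : open_in X U -> (forall u, U u -> u 0 i != 0) ->
  taylor_kernel X k U s -> Rsheaf X k U (fun u => (u 0 i)^-1 *: s u).
Proof.
move=> oU hU hs; apply: twist_one => //; apply: (regularP X0) => // x Ux.
by apply: regular_atXV; [exact: open_sub Ux|exact: hU].
Qed.

(** * Subspaces of linear forms vanishing on X *)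

Section Vanishing.
Variables (W : {vspace V}) (hW : forall T x, T \in W -> X x -> lin_eval T x = 0).

Lemma Wtensor_mem U s x : Wtensor X W U s -> U x -> s x \in W.
Proof.
move=> [f [_ hE]] Ux; rewrite hE //; apply: memv_suml => i _; apply: memvZ.
by apply: vbasis_mem; rewrite mem_nth // size_tuple.
Qed.

(** The contraction of such a section is identically zero on U x X, hence lies in every power of
    I_Delta. *)
Lemma Wtensor_taylor_kernel k U s : open_in X U -> Wtensor X W U s ->
  taylor_kernel X k U s.
Proof.
move=> oU hs; apply/(taylor_kernelP X0) => //; split.
  move=> i; apply: (regularP X0) => // x Ux; have Xx := open_sub oU Ux.
  have [f [hf hE]] := hs.
  apply: (regular_at_ext_open X0 oU Ux
    (f := fun u => \sum_j f j u * (vbasis W)`_j 0 i)).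
    by move=> u /hE ->; rewrite summxE; apply: eq_bigr => j _; rewrite mxE.
  apply: regular_at_sum => // j; apply: (@regular_atM _ _ X 0 0).
    exact: regular_atP (hf j) Ux.
  exact: regular_atC.
move=> z [Uz Xz]; have Xz1 := open_sub oU Uz.
have [d [q [hq [_ qz] qU]]] := open_in_basic X0 oU Uz.
apply: (diag_power_at_ext X0 (bihomog_lpoly hq)) (diag_power_at_zero _ Xz1 Xz).
  by split => //; rewrite bieval_lpoly.
move=> w [X1 X2]; rewrite bieval_lpoly => qw.
by rewrite -[RHS]/(lin_eval (s w.1) w.2) hW //; apply: (Wtensor_mem hs); apply: qU.
Qed.

Lemma Wtensor_sub k : sheaf_sub X (Wtensor X W) (twist X 1 (Rsheaf X k)).
Proof.
move=> U oU s hs x Ux; have Xx := open_sub oU Ux.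
have [i xi] := exists_coord_neq0 X0 Xx.
have oi := open_basic X0 (dhomogXi (R := R) (r := r) i).
have ix : basic_open X 'X_i x by split => //; rewrite hevalXU.
have [U' [oU' U'x sU sX]] := open_inI oU oi Ux ix.
have nz u : U' u -> u 0 i != 0 by move=> /sX [_]; rewrite hevalXU.
have hs' : Wtensor X W U' s.
  have [f [hf hE]] := hs; exists f; split; last by move=> u /sU /hE.
  by move=> j; exact: (regular_sub X0 oU' sU (hf j)).
exists U', 1%N, (fun _ u => u 0 i), (fun _ (u : pt) => (u 0 i)^-1 *: s u).
split => //.
split.
  move=> _; split.
    by apply: (regularP X0) => // u /sU /(open_sub oU); exact: regular_atX.
  by apply: Rsheaf_scale => //; exact: Wtensor_taylor_kernel.
by move=> u /nz ui; rewrite big_ord1 scalerA divff // scale1r.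
Qed.

End Vanishing.

(** The coordinates in a basis of W are linear functionals on all of V, hence constant combinations
    of the regular entries of s. *)
Lemma Wtensor_intro (W : {vspace V}) U s : open_in X U ->
  (forall x, U x -> s x \in W) ->
  (forall x i, U x -> regular_at X 0 x (fun u => s u 0 i)) -> Wtensor X W U s.
Proof.
move=> oU sW rs; exists (fun j x => coord (vbasis W) j (s x)); split.
  move=> j; apply: (regularP X0) => // x Ux; have Xx := open_sub oU Ux.
  have -> : (fun u => coord (vbasis W) j (s u)) =
      (fun u => \sum_i s u 0 i * coord (vbasis W) j (delta_mx 0 i)).
    apply/funext => u; rewrite {1}[s u]row_sum_delta linear_sum.
    by apply: eq_bigr => i _; rewrite linearZ.
  apply: regular_at_sum => // i; apply: (@regular_atM _ _ X 0 0).
    exact: rs.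
  exact: regular_atC.
by move=> x /sW /coord_vbasis.
Qed.

End Sheaves.

(** * The generic stalk of the Taylor kernel *)

Section FunctionField.
Context {R : realType} {r : nat}.
Local Notation C := (R[i]).
Local Notation pt := (coords R r).
Local Notation A := {mpoly C[r.+1]}.
Local Notation A2 := {mpoly C[r.+1 + r.+1]}.
Implicit Types (p q : A) (P Q : A2) (x y : pt) (z w : pt * pt).

Variables (X : set pt) (i0 : 'I_r.+1).
Hypotheses (X0 : X `<=` [set x | x != 0]).
Hypothesis hirr : irreducible_set X.
Hypothesis hchart : chart X i0 !=set0.

Local Notation nz := (normalize i0).
Local Notation nz2 := (normalize2 i0).
Local Notation chart := (chart X i0).
Local Notation J := (chart_ideal X i0).

Variables (K : fieldType) (phi : {rmorphism A -> K}).
Hypothesis phi0 : forall a, phi a = 0 <-> J a.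
Hypothesis phi_frac : forall c, exists a b, ~ J b /\ c = phi a / phi b.

Definition const_morph : {rmorphism C -> K} := (phi \o @mpolyC r.+1 C)%FUN.
Arguments const_morph : simpl never.

Definition generic_pt (i : 'I_r.+1) : K := phi 'X_i.

Local Notation iota := const_morph.
Local Notation xg := generic_pt.
Local Notation "p ^i" := (map_mpoly iota p) (at level 2, format "p ^i").

Lemma phi_neq0 a : ~ J a -> phi a != 0.
Proof. by move=> h; apply/eqP => /phi0. Qed.

Lemma phi_neq0_at a x : chart x -> heval a (nz x) != 0 -> phi a != 0.
Proof. by move=> cx ax; apply: phi_neq0 => /(_ _ cx) /eqP; apply/negP. Qed.

Lemma phiE p : phi p = mmap iota xg p.
Proof.
rewrite {1}[p]mpolyE rmorph_sum; apply: eq_bigr => m _.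
rewrite -mul_mpolyC rmorphM; congr (_ * _).
rewrite mpolyXE_id rmorph_prod; apply: eq_bigr => i _.
by rewrite rmorphXn.
Qed.

Lemma map_iota_eval p : p^i.@[xg] = phi p.
Proof.
rewrite phiE /map_mpoly rmorph_mmap; apply: eq_mmap => i /=.
  by rewrite mevalC.
by rewrite mevalXU.
Qed.

Lemma map_iota_eval_const p (y : pt) :
  p^i.@[fun i => iota (y 0 i)] = iota (heval p y).
Proof.
rewrite /heval /meval -/(meval _ _) rmorph_mmap /map_mpoly rmorph_mmap.
by apply: eq_mmap => i /=; rewrite ?mevalC ?mevalXU.
Qed.

Definition psi_var (i : 'I_(r.+1 + r.+1)) : {mpoly K[r.+1]} :=
  match split i with inl j => (xg j)%:MP | inr j => 'X_j end.
Definition psi_const : {rmorphism C -> {mpoly K[r.+1]}} :=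
  (@mpolyC r.+1 K \o iota)%FUN.
(* Specializes the first r+1 variables to the generic point.                  *)
Definition psi_morph : {rmorphism A2 -> {mpoly K[r.+1]}} :=
  mmap psi_const psi_var.
Definition psi : A2 -> {mpoly K[r.+1]} :=
  locked_with poly_embedding_key psi_morph.

Lemma psiE P : psi P = psi_morph P.
Proof. by rewrite /psi locked_withE. Qed.

Lemma psi0 : psi 0 = 0.
Proof. by rewrite !psiE rmorph0. Qed.
Lemma psiD P Q : psi (P + Q) = psi P + psi Q.
Proof. by rewrite !psiE rmorphD. Qed.
Lemma psiB P Q : psi (P - Q) = psi P - psi Q.
Proof. by rewrite !psiE rmorphB. Qed.
Lemma psiM P Q : psi (P * Q) = psi P * psi Q.
Proof. by rewrite !psiE rmorphM. Qed.

(** Restrictions to the diagonal and, next, to a slice with fixed second point. Evaluating [psi P]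
    at the generic point or at a complex point gives [phi] of these, so vanishing in K can be tested
    on complex points of the chart. *)
Definition diag_poly (P : A2) : A := mmap (@mpolyC r.+1 C)
  (fun i => match split i with inl j => 'X_j | inr j => 'X_j end) P.
Definition slice_poly (y : pt) (P : A2) : A := mmap (@mpolyC r.+1 C)
  (fun i => match split i with inl j => 'X_j | inr j => (y 0 j)%:MP end) P.

Lemma heval_diag_poly P x : heval (diag_poly P) x = bieval P (x, x).
Proof.
rewrite /heval /diag_poly rmorph_mmap; apply: eq_mmap => i /=.
  by rewrite mevalC.
by rewrite mxE; case: split => j; rewrite mevalXU.
Qed.

Lemma heval_slice_poly P x y : heval (slice_poly y P) x = bieval P (x, y).
Proof.
rewrite /heval /slice_poly rmorph_mmap; apply: eq_mmap => i /=.
  by rewrite mevalC.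
by rewrite mxE; case: split => j; rewrite ?mevalXU ?mevalC.
Qed.

Lemma psi_diag P : (psi P).@[xg] = phi (diag_poly P).
Proof.
rewrite psiE /psi_morph /= /diag_poly !rmorph_mmap; apply: eq_mmap => i /=.
  by rewrite mevalC.
by rewrite /psi_var; case: split => j; rewrite ?mevalXU ?mevalC.
Qed.

Lemma psi_slice P y :
  (psi P).@[fun i => iota (y 0 i)] = phi (slice_poly y P).
Proof.
rewrite psiE /psi_morph /= /slice_poly !rmorph_mmap; apply: eq_mmap => i /=.
  by rewrite mevalC.
by rewrite /psi_var; case: split => j; rewrite ?mevalXU ?mevalC.
Qed.

Lemma psiXl i : psi 'X_(lshift r.+1 i) = (xg i)%:MP.
Proof.
rewrite psiE /psi_morph /= mmapX mmap1U /psi_var.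
by rewrite -/(unsplit (inl i)) unsplitK.
Qed.

Lemma psiXr i : psi 'X_(rshift r.+1 i) = 'X_i.
Proof.
rewrite psiE /psi_morph /= mmapX mmap1U /psi_var.
by rewrite -/(unsplit (inr i)) unsplitK.
Qed.

Lemma psi_lpoly p : psi (lpoly p) = (phi p)%:MP.
Proof.
rewrite lpolyE psiE rmorph_mmap phiE [RHS]rmorph_mmap; apply: eq_mmap => i /=.
  by rewrite mmapC.
by have := psiXl i; rewrite psiE.
Qed.

Lemma psi_rpoly p : psi (rpoly p) = p^i.
Proof.
rewrite rpolyE psiE rmorph_mmap /map_mpoly; apply: eq_mmap => i /=.
  by rewrite mmapC.
by have := psiXr i; rewrite psiE.
Qed.

Definition linear_bipoly (a : 'I_r.+1 -> A) : A2 :=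
  \sum_i lpoly (a i) * 'X_(rshift r.+1 i).

Lemma bieval_linear_bipoly a w :
  bieval (linear_bipoly a) w = \sum_i heval (a i) w.1 * w.2 0 i.
Proof.
rewrite /bieval raddf_sum; apply: eq_bigr => i _.
by rewrite /= -/(bieval _ w) bievalM bieval_lpoly bievalXr.
Qed.

Lemma psi_linear_bipoly a :
  psi (linear_bipoly a) = \sum_i (phi (a i))%:MP * 'X_i.
Proof.
rewrite /linear_bipoly; elim/big_rec2: _ => [|i u v' _ <-]; first exact: psi0.
by rewrite psiD psiM psi_lpoly psiXr.
Qed.

Lemma psi_eq0 P : psi P = 0 -> forall x y, chart x -> bieval P (nz x, y) = 0.
Proof.
move=> hP x y cx; rewrite -heval_slice_poly.
have : phi (slice_poly y P) = 0 by rewrite -psi_slice hP meval0.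
by move=> /phi0 h; exact: h.
Qed.

Lemma psi_diag_neq0 P x : chart x -> bieval P (nz x, nz x) != 0 ->
  (psi P).@[xg] != 0.
Proof.
by move=> cx h; rewrite psi_diag; apply: (phi_neq0_at cx); rewrite heval_diag_poly.
Qed.

(* Split off a dependent coefficient as long as some H_l does not vanish.     *)
Lemma ext_ideal_of_relation n (e : 'I_n -> K) (H : 'I_n -> A) :
  (forall y, chart y -> \sum_l e l * iota (heval (H l) (nz y)) = 0) ->
  ext_ideal iota J (\sum_l (e l)%:MP * (H l)^i).
Proof.
elim: n e H => [|n IH] e H hH; first by rewrite big_ord0; exact: ext_ideal0.
have [all|/existsNP [l0 /existsNP [y /not_implyP [cy /eqP ny]]]] :=
    pselect (forall l, J (H l)).
  by apply: ext_ideal_sum => l; exact: ext_ideal_gen.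
pose c l := heval (H (lift l0 l)) (nz y) / heval (H l0) (nz y).
have ni : iota (heval (H l0) (nz y)) != 0 by rewrite fmorph_eq0.
have split_sum (V : zmodType) (F : 'I_n.+1 -> V) :
    \sum_l F l = F l0 + \sum_l F (lift l0 l).
  by rewrite (bigD1_ord l0).
have eE : e l0 = - \sum_l e (lift l0 l) * iota (c l).
  have /eqP := hH _ cy; rewrite split_sum addr_eq0 => /eqP h.
  apply: (mulIf ni); rewrite h mulNr; congr (- _); rewrite mulr_suml.
  apply: eq_bigr => l _; rewrite -mulrA -rmorphM /c divfK //.
clearbody c.
have rel (y' : pt) : \sum_l e l * iota (heval (H l) y') =
    \sum_l e (lift l0 l) *
      iota (heval (H (lift l0 l) - (c l)%:MP * H l0) y').
  rewrite split_sum eE mulNr mulr_suml addrC -sumrB; apply: eq_bigr => l _.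
  by rewrite hevalB hevalM hevalC rmorphB rmorphM mulrBr mulrA.
have := IH (fun l => e (lift l0 l)) (fun l => H (lift l0 l) - (c l)%:MP * H l0).
suff -> : \sum_l (e l)%:MP * (H l)^i = \sum_l (e (lift l0 l))%:MP *
    (H (lift l0 l) - (c l)%:MP * H l0)^i.
  by apply => y' cy'; rewrite -rel hH.
rewrite split_sum eE mpolyCN mulNr raddf_sum /= mulr_suml addrC -sumrB.
apply: eq_bigr => l _.
by rewrite rmorphB /= [map_mpoly _ (_ * _)]rmorphM /= map_mpolyC mpolyCM mulrBr mulrA.
Qed.

(** Extending scalars from C to K creates no new equations of the chart. Write G as the combination
    of its monomials, which have coefficients in C, with weights in K; the values at complex points
    are then linear relations among the weights. *)
Lemma ext_ideal_of_vanish (G : {mpoly K[r.+1]}) :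
  (forall y, chart y -> G.@[fun i => iota (nz y 0 i)] = 0) ->
  ext_ideal iota J G.
Proof.
move=> hG; pose s := msupp G.
have E (F : 'X_{1..r.+1} -> {mpoly K[r.+1]}) :
  \sum_(m <- s) F m = \sum_(l < size s) F (tnth (in_tuple s) l) by rewrite big_tnth.
have GE : G = \sum_(l < size s) (G@_(tnth (in_tuple s) l))%:MP *
    ('X_[tnth (in_tuple s) l])^i.
  rewrite -(E (fun m => (G@_m)%:MP * ('X_[m])^i)) {1}[G]mpolyE.
  by apply: eq_bigr => m _; rewrite map_mpolyX mul_mpolyC.
rewrite GE; apply: ext_ideal_of_relation => y cy; have := hG y cy.
rewrite [in X in X -> _]GE raddf_sum => h; rewrite -[RHS]h; apply: eq_bigr => l _.
by rewrite /= rmorphM /= mevalC map_iota_eval_const.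
Qed.

Lemma ext_ideal_psi P :
  (forall x y, chart x -> chart y -> bieval P (nz x, nz y) = 0) ->
  ext_ideal iota J (psi P).
Proof.
move=> hP; apply: ext_ideal_of_vanish => y cy; rewrite psi_slice.
by apply/phi0 => x cx; rewrite heval_slice_poly hP.
Qed.

Lemma clear_denominators (G : {mpoly K[r.+1]}) :
  exists q P, ~ J q /\ psi P = (phi q)%:MP * G.
Proof.
have [Jb Jm J1 J00 Jp] := chart_ideal_prime X0 hirr hchart.
rewrite [G]mpolyE; elim/big_ind: _ => [||m _].
- by exists 1, 0; split; [|rewrite psi0 mulr0].
- move=> G1 G2 [q1 [P1 [h1 E1]]] [q2 [P2 [h2 E2]]].
  exists (q1 * q2), (lpoly q2 * P1 + lpoly q1 * P2); split.
    by move=> /Jp [].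
  rewrite psiD !psiM !psi_lpoly E1 E2.
  rewrite (rmorphM phi) mpolyCM.
  by move: ((phi q1)%:MP) ((phi q2)%:MP) => u v; ring.
- have [a [b [hb ->]]] := phi_frac G@_m; exists b, (lpoly a * rpoly 'X_[m]).
  split; first exact: hb.
  rewrite psiM psi_lpoly psi_rpoly map_mpolyX.
  rewrite -mul_mpolyC mulrA -mpolyCM; congr (_%:MP * _).
  by rewrite mulrC divfK; [|exact: phi_neq0].
Qed.

Lemma char0_K n : n.+1%:R != 0 :> K.
Proof.
by rewrite -(rmorph_nat iota) fmorph_eq0 Num.Theory.pnatr_eq0.
Qed.

(* The germ of f at the generic point of X is kappa.                          *)
Definition generic_value (f : pt -> C) (kappa : K) := exists a b,
  [/\ ~ J b, kappa = phi a / phi b &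
  forall x, chart x -> heval b (nz x) != 0 ->
    f x = heval a (nz x) / heval b (nz x)].

Local Notation gen := generic_value.

Let JM a b : ~ J a -> ~ J b -> ~ J (a * b).
Proof.
have [_ _ _ _ Jp] := chart_ideal_prime X0 hirr hchart.
by move=> ha hb /Jp [].
Qed.

Lemma generic_valueD f g k l : gen f k -> gen g l -> gen (fun x => f x + g x) (k + l).
Proof.
move=> [a [b [hb -> E]]] [a' [b' [hb' -> E']]].
exists (a * b' + a' * b), (b * b'); split; first exact: JM.
  by rewrite addf_div ?phi_neq0 // !(rmorphD, rmorphM).
move=> x cx; rewrite hevalM mulf_eq0 negb_or => /andP [bx bx'].
by rewrite E // E' // hevalD !hevalM addf_div.
Qed.

Lemma generic_valueM f g k l : gen f k -> gen g l -> gen (fun x => f x * g x) (k * l).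
Proof.
move=> [a [b [hb -> E]]] [a' [b' [hb' -> E']]].
exists (a * a'), (b * b'); split; first exact: JM.
  by rewrite mulf_div !rmorphM.
move=> x cx; rewrite hevalM mulf_eq0 negb_or => /andP [bx bx'].
by rewrite E // E' // !hevalM mulf_div.
Qed.

Let nJ1 : ~ J 1.
Proof. by have [_ _ h _ _] := chart_ideal_prime X0 hirr hchart. Qed.

Lemma generic_valueC c : gen (fun=> c) (iota c).
Proof.
exists c%:MP, 1; split => //; first by rewrite rmorph1 divr1.
by move=> x _ _; rewrite hevalC /heval meval1 divr1.
Qed.

Lemma generic_value_sum (I : Type) (s : seq I) (F : I -> pt -> C) (k : I -> K) :
  (forall i, gen (F i) (k i)) ->
  gen (fun x => \sum_(i <- s) F i x) (\sum_(i <- s) k i).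
Proof.
move=> h; elim: s => [|i s IH].
  under eq_fun do rewrite big_nil.
  by rewrite big_nil -(rmorph0 iota); exact: generic_valueC.
under eq_fun do rewrite big_cons.
by rewrite big_cons; exact: generic_valueD.
Qed.

Lemma generic_value_ext f g k U : open_in X U -> U !=set0 ->
  (forall x, U x -> f x = g x) -> gen f k -> gen g k.
Proof.
move=> oU U0 fg [a [b [hb -> E]]].
have [x Ux [Xx x0]] := open_meets_chart X0 hirr hchart oU U0.
have [d [q [hq qx qU]]] := open_in_basic X0 oU Ux.
have nJq : ~ J q.
  move=> /(chart_ideal_homog X0 hirr hchart hq) h.
  by case: qx => _; rewrite h // eqxx.
exists (a * q), (b * q); split; first exact: JM.
  by rewrite !rmorphM -mulf_div divff ?mulr1 // phi_neq0.
move=> u cu; rewrite hevalM mulf_eq0 negb_or => /andP [bu qu].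
rewrite -fg; last first.
  apply: qU; have [Xu u0] := cu; split => //.
  by rewrite (heval_normalize hq u0) mulf_neq0 // expf_neq0.
by rewrite E // !hevalM -mulf_div divff // mulr1.
Qed.

Lemma generic_value_uniq f k l : gen f k -> gen f l -> k = l.
Proof.
move=> [a [b [hb -> E]]] [a' [b' [hb' -> E']]].
apply/eqP; rewrite eqr_div ?phi_neq0 // -!rmorphM -subr_eq0 -rmorphB.
apply/eqP/phi0.
have [_ _ _ _ Jp] := chart_ideal_prime X0 hirr hchart.
(* The factor b b' absorbs the points where a denominator vanishes and nothing is known about f;
   primality then removes it. *)
have /Jp [/(JM hb hb')//|//] : J ((b * b') * (a * b' - a' * b)).
move=> x cx; rewrite !(hevalM, hevalB).
have [->|bx] := eqVneq (heval b (nz x)) 0; first by rewrite !mul0r.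
have [->|bx'] := eqVneq (heval b' (nz x)) 0; first by rewrite mulr0 !mul0r.
have /eqP := E _ cx bx; rewrite E' // eqr_div // => /eqP ->.
by rewrite subrr mulr0.
Qed.

Lemma generic_value_exists k : exists f, gen f k.
Proof.
have [a [b [hb ->]]] := phi_frac k.
by exists (fun x => heval a (nz x) / heval b (nz x)), a, b.
Qed.

Lemma generic_value_regular f k : gen f k -> exists U,
  [/\ open_in X U, U !=set0, U `<=` chart & forall x, U x -> regular_at X 0 x f].
Proof.
move=> [a [b [hb _ E]]].
have [U [oU U0 Uc UE]] := chart_open_basic X0 hb; exists U; split => // x Ux.
have /UE [cx bx] := Ux.
apply: (regular_at_ext_open X0 oU Ux) (regular_at_normalize_frac X0 a cx bx).
by move=> u /UE [cu bu]; rewrite -E.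
Qed.

(** The point x may lie outside the chart. Numerator and denominator have the same degree, so the
    powers of x_i0 from the normalization cancel, and one fraction gives both the germ and the value
    at x. *)
Lemma regular_at_generic_frac f x : regular_at X 0 x f -> exists d p q,
  [/\ p \is d.-homog, phi q != 0, gen f (phi p / phi q), X x &
      f x = heval p x / heval q x].
Proof.
move=> [d1 [d2 [p [q [[hp hq dE [Xx qx]] hpq]]]]].
have nJq : ~ J q.
  move=> /(chart_ideal_homog X0 hirr hchart hq) h.
  by move: qx; rewrite h // eqxx.
exists d1, p, q; split => //; [exact: phi_neq0| |exact: hpq].
exists p, q; split => // u cu qu; have [Xu u0] := cu.
have dE' : d1 = d2 by lia.
rewrite hpq; last first.
  by split => //; rewrite (heval_normalize hq u0) mulf_neq0 // expf_neq0.
rewrite (heval_normalize hp u0) (heval_normalize hq u0) dE'.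
by rewrite -mulf_div divff ?mul1r // expf_neq0.
Qed.

Lemma regular_at_generic_value f x : regular_at X 0 x f -> exists k, gen f k.
Proof.
move=> /regular_at_generic_frac [d [p [q [_ _ h _ _]]]].
by exists (phi p / phi q).
Qed.

(** Passes from the generic point to every point: the numerator is homogeneous and lies in J, so it
    vanishes on all of X. *)
Lemma generic_value0_regular_at f x : regular_at X 0 x f -> gen f 0 -> f x = 0.
Proof.
move=> /regular_at_generic_frac [d [p [q [hp nq gpq Xx ->]]]] f0.
have /eqP := generic_value_uniq gpq f0; rewrite mulf_eq0 invr_eq0 (negbTE nq) orbF.
move=> /eqP /phi0 /(chart_ideal_homog X0 hirr hchart hp) h.
by rewrite h // mul0r.
Qed.

Lemma generic_value_common n (f : 'I_n -> pt -> C) (k : 'I_n -> K) :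
  (forall i, gen (f i) (k i)) -> exists (a : 'I_n -> A) b,
  [/\ ~ J b, forall i, k i = phi (a i) / phi b &
    forall i x, chart x -> heval b (nz x) != 0 ->
      f i x = heval (a i) (nz x) / heval b (nz x)].
Proof.
move=> h; have /choice [ab hab] : forall i, exists ab : A * A,
    [/\ ~ J ab.2, k i = phi ab.1 / phi ab.2 &
    forall x, chart x -> heval ab.2 (nz x) != 0 ->
      f i x = heval ab.1 (nz x) / heval ab.2 (nz x)].
  by move=> i; have [a [b ?]] := h i; exists (a, b).
pose B i := \prod_(j | j != i) (ab j).2.
have BE i : \prod_j (ab j).2 = (ab i).2 * B i by rewrite (bigD1 i).
have nB : ~ J (\prod_j (ab j).2).
  by elim/big_ind: _ => [|a b|i _]; [exact: nJ1|exact: JM|case: (hab i)].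
have [Jb Jm _ J00 Jp] := chart_ideal_prime X0 hirr hchart.
exists (fun i => (ab i).1 * B i), (\prod_j (ab j).2); split => // i.
  have nBi : ~ J (B i) by move=> JB; apply: nB; rewrite (BE i); exact: Jm.
  by have [_ -> _] := hab i; rewrite (BE i) !rmorphM -mulf_div divff ?mulr1 // phi_neq0.
move=> x cx; rewrite (BE i) hevalM mulf_eq0 negb_or => /andP [b1 b2].
by have [_ _ ->] := hab i => //; rewrite !hevalM -mulf_div divff // mulr1.
Qed.

(** * From sections of the Taylor kernel to the generic stalk *)

Section LocalMembership.
Variables (x0 : pt) (cx0 : chart x0).

Local Notation ideal := (pp_ideal iota xg J).

(* h agrees near (x0, x0) with a fraction whose numerator lies, generically in
   the first variable, in m^e + J K[Y].                                       *)
Definition local_mem e (h : pt * pt -> C) := exists P Q,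
  [/\ bieval Q (nz2 (x0, x0)) != 0, ideal e (psi P) &
  forall w, chart w.1 -> chart w.2 -> bieval Q (nz2 w) != 0 ->
    h w = bieval P (nz2 w) / bieval Q (nz2 w)].

Lemma regular2_at_chart d h : regular2_at X d (x0, x0) h -> exists P Q,
  bieval Q (nz2 (x0, x0)) != 0 /\
  forall w, chart w.1 -> chart w.2 -> bieval Q (nz2 w) != 0 ->
    h w = w.2 0 i0 ^+ d * (bieval P (nz2 w) / bieval Q (nz2 w)).
Proof.
move=> [a [b [P [Q [[hP hQ [X1 X2 Qz]] hE]]]]]; exists P, Q; split.
  have [_ n0] := cx0; move: Qz.
  by rewrite (bieval_normalize (i0 := i0) hQ) // mulf_eq0 negb_or => /andP [].
move=> w [Xw1 n1] [Xw2 n2] Qw.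
have Qw' : bieval Q w != 0.
  rewrite (bieval_normalize hQ n1 n2); apply: mulf_neq0 => //.
  by apply: mulf_neq0; rewrite expf_neq0.
rewrite hE; last by split.
rewrite (bieval_normalize hP n1 n2) (bieval_normalize hQ n1 n2) exprD.
have e1 : w.1 0 i0 ^+ a != 0 by rewrite expf_neq0.
have e2 : w.2 0 i0 ^+ b != 0 by rewrite expf_neq0.
move: (w.1 0 i0 ^+ a) (w.2 0 i0 ^+ b) (w.2 0 i0 ^+ d) e1 e2 Qw.
move: (bieval P _) (bieval Q _) => p q u v t u0 v0 q0.
by field; rewrite u0 v0 q0.
Qed.

Lemma local_mem_ext e h h' a b G : bihomog a b G ->
  basic_open2 X G (x0, x0) ->
  (forall w, chart w.1 -> chart w.2 -> basic_open2 X G w -> h w = h' w) ->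
  local_mem e h -> local_mem e h'.
Proof.
move=> hG [X1 X2 Gz] hh [P [Q [Qz hP hE]]]; have [_ n0] := cx0.
exists (P * G), (Q * G); split.
- rewrite bievalM mulf_neq0 //; move: Gz.
  by rewrite (bieval_normalize (i0 := i0) hG) // mulf_eq0 negb_or => /andP [].
- by rewrite psiM mulrC; exact: pp_idealM.
- move=> w c1 c2; rewrite bievalM mulf_eq0 negb_or => /andP [Qw Gw].
  have [Xw1 n1] := c1; have [Xw2 n2] := c2.
  rewrite -hh //; first by rewrite hE // !bievalM -mulf_div divff // mulr1.
  split => //; rewrite (bieval_normalize (i0 := i0) hG) //.
  by apply: mulf_neq0 => //; apply: mulf_neq0; rewrite expf_neq0.
Qed.

Lemma local_memD e h h' : local_mem e h -> local_mem e h' ->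
  local_mem e (fun w => h w + h' w).
Proof.
move=> [P [Q [Qz hP hE]]] [P' [Q' [Qz' hP' hE']]].
exists (P * Q' + P' * Q), (Q * Q'); split.
- by rewrite bievalM mulf_neq0.
- by rewrite psiD !psiM; apply: pp_idealD; rewrite mulrC; exact: pp_idealM.
- move=> w c1 c2; rewrite bievalM mulf_eq0 negb_or => /andP [Qw Qw'].
  by rewrite hE // hE' // bievalD !bievalM addf_div.
Qed.

Lemma local_mem0 e : local_mem e (fun=> 0).
Proof.
exists 0, 1%:MP; split.
- by rewrite bievalC oner_neq0.
- by rewrite psi0; exact: pp_ideal0.
- by move=> w _ _ _; rewrite /bieval meval0 mul0r.
Qed.

Lemma local_mem_sum (I : Type) (s : seq I) e (F : I -> pt * pt -> C) :
  (forall i, local_mem e (F i)) -> local_mem e (fun w => \sum_(i <- s) F i w).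
Proof.
move=> h; elim: s => [|i s IH].
  under eq_fun do rewrite big_nil.
  exact: local_mem0.
under eq_fun do rewrite big_cons.
exact: local_memD.
Qed.

(** The numerator of d vanishes on the diagonal, so its image under [psi] vanishes at the generic
    point and contributes one more factor of m. *)
Lemma local_mem_diag e d h a b G : bihomog a b G -> basic_open2 X G (x0, x0) ->
  diag_ideal X (basic_open2 X G) d -> local_mem e h ->
  local_mem e.+1 (fun w => d w * h w).
Proof.
move=> hG Gz0 [rd d0] [P [Q [Qz hP hE]]]; have [X1 X2 Gz] := Gz0.
have [P1 [Q1 [Qz1 E1]]] := regular2_at_chart (regular2_atP X0 rd Gz0).
have [_ n0] := cx0.
have Gn w : chart w.1 -> chart w.2 ->
    (bieval G w != 0) = (bieval G (nz2 w) != 0).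
  move=> [_ n1] [_ n2]; rewrite (bieval_normalize (i0 := i0) hG) //.
  by rewrite !mulf_eq0 !expf_eq0 (negbTE n1) (negbTE n2) !andbF.
have P10 : (psi P1).@[xg] = 0.
  (* The vanishing of d is known only where Q1 and G do not vanish on the diagonal. The product
     vanishes everywhere there, and Q1 G is nonzero at (x0, x0), hence generically, so it can be
     cancelled in K. *)
  have : (psi (P1 * (Q1 * G))).@[xg] = 0.
    rewrite psi_diag; apply/phi0 => x cx; rewrite heval_diag_poly !bievalM.
    have [->|Q1x] := eqVneq (bieval Q1 (nz x, nz x)) 0.
      by rewrite mul0r mulr0.
    have [->|Gx] := eqVneq (bieval G (nz x, nz x)) 0; first by rewrite !mulr0.
    have [Xx _] := cx.
    have /eqP := E1 (x, x) cx cx Q1x; rewrite d0; last first.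
      by split => //; rewrite Gn.
    rewrite expr0 mul1r eq_sym mulf_eq0 invr_eq0 (negbTE Q1x) orbF => /eqP.
    by rewrite /normalize2 /= => ->; rewrite mul0r.
  rewrite psiM mevalM => /eqP; rewrite mulf_eq0 => /orP [/eqP //|].
  rewrite -[_ == 0]negbK (psi_diag_neq0 cx0) // bievalM mulf_neq0 //.
  by rewrite -(Gn (x0, x0)).
exists (P1 * P), (Q1 * Q); split.
- by rewrite bievalM mulf_neq0.
- by rewrite psiM; exact: pp_ideal_mul1.
- move=> w c1 c2; rewrite bievalM mulf_eq0 negb_or => /andP [Qw1 Qw].
  by rewrite hE // E1 // expr0 mul1r !bievalM mulf_div.
Qed.

Lemma local_mem_prod e (h : 'I_e -> pt * pt -> C) t a b G : bihomog a b G ->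
  basic_open2 X G (x0, x0) -> (forall l, diag_ideal X (basic_open2 X G) (h l)) ->
  regular2_at X 1 (x0, x0) t ->
  local_mem e (fun w => (\prod_l h l w) * t w / w.2 0 i0).
Proof.
move=> hG Gz hh rt; elim: e h hh => [|e IH] h hh.
  have [P [Q [Qz hE]]] := regular2_at_chart rt.
  exists P, Q; split => // w c1 c2 Qw; have [_ n2] := c2.
  by rewrite big_ord0 mul1r hE // expr1 mulrC mulKf.
have hI := IH (fun l => h (lift ord0 l)) (fun l => hh (lift ord0 l)).
have := local_mem_diag hG Gz (hh ord0) hI.
congr (local_mem e.+1 _); apply/funext => w.
by rewrite big_ord_recl !mulrA.
Qed.

Lemma local_mem_diag_power e s :
  diag_power_at X e (x0, x0) s -> local_mem e (fun w => s w / w.2 0 i0).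
Proof.
move=> [a [b [G [hG Gz [c [h [t [hht hE]]]]]]]].
apply: (local_mem_ext (h := fun w =>
    \sum_(j < c) (\prod_l h j l w) * t j w / w.2 0 i0) hG Gz).
  by move=> w _ _ Gw; rewrite hE // mulr_suml.
apply: local_mem_sum => j; have [hh ht] := hht j.
exact: (local_mem_prod hG Gz hh (pr2L_atP X0 ht Gz)).
Qed.

End LocalMembership.

(** One diagonal point (x0, x0) of the chart over U is enough: near it the contraction over y_i0 is
    P/Q with [psi P] in m^(k+1) + J K[Y], and it is also T/b, where T is the bilinear polynomial
    with the numerators of s as coefficients. *)
Lemma taylor_kernel_stalk k U (s : pt -> linforms R r) (v : 'rV[K]_r.+1) :
  open_in X U -> U !=set0 -> taylor_kernel X k U s ->
  (forall i, gen (fun x => s x 0 i) (v 0 i)) -> taylor_stalk iota xg J k v.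
Proof.
move=> oU U0 /(taylor_kernelP X0 k s oU) [_ hs] hv.
have [x0 Ux0 cx0] := open_meets_chart X0 hirr hchart oU U0.
have [Xx0 n0] := cx0.
have [P [Q [Qz hP hE]]] := local_mem_diag_power cx0 (hs (x0, x0) (conj Ux0 Xx0)).
have [a [b [hb vE sE]]] := generic_value_common hv.
pose T := linear_bipoly a.
(* The two fractions agree only where Q and b are nonzero; the factor Q b makes the identity hold on
   the whole chart product. It is a unit at the generic point and is cancelled at the end. *)
have van : ext_ideal iota J (psi ((Q * lpoly b) * (Q * T - lpoly b * P))).
  apply: ext_ideal_psi => x y cx cy.
  have [_ nx] := cx; have [_ ny] := cy.
  rewrite bievalM bievalB !bievalM !bieval_lpoly /=.
  have [->|Qw] := eqVneq (bieval Q (nz x, nz y)) 0; first by rewrite !mul0r.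
  have [->|bx] := eqVneq (heval b (nz x)) 0; first by rewrite mulr0 !mul0r.
  have := hE (x, y) cx cy Qw; rewrite /contraction /= => E.
  have {}E : bieval T (nz x, nz y) / heval b (nz x) =
      bieval P (nz x, nz y) / bieval Q (nz x, nz y).
    rewrite -E bieval_linear_bipoly !mulr_suml; apply: eq_bigr => i _ /=.
    rewrite sE // [nz y 0 i]mxE.
    move: (heval (a i) _) (heval b _) (y 0 i0) (y 0 i) bx ny => u t m n t0 m0.
    by field; rewrite t0 m0.
  move/eqP: E; rewrite eqr_div // => /eqP E.
  by rewrite [X in _ * (X - _)]mulrC E mulrC [X in (X - _)]mulrC subrr mul0r.
have nQb : (psi (Q * lpoly b)).@[xg] != 0.
  rewrite psiM psi_lpoly mevalM mevalC mulf_neq0 ?phi_neq0 //.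
  exact: psi_diag_neq0 cx0 Qz.
have nQ : (psi Q).@[xg] != 0 by exact: psi_diag_neq0 cx0 Qz.
rewrite /taylor_stalk /mkset.
have -> : linear_mpoly v = ((phi b)^-1)%:MP * psi T.
  rewrite psi_linear_bipoly mulr_sumr; apply: eq_bigr => i _.
  by rewrite vE -mul_mpolyC mulrA -mpolyCM [(phi b)^-1 * _]mulrC.
apply: pp_idealM; apply: (pp_ideal_cancel nQ); apply: (pp_ideal_cancel nQb).
have := pp_idealD (pp_ideal_ext xg k.+1 van)
  (pp_idealM (psi (Q * lpoly b) * psi (lpoly b)) hP).
rewrite psiM psiB !psiM.
move: (psi Q) (psi (lpoly b)) (psi T) (psi P) => q l t p.
by have -> : q * l * (q * t - l * p) + q * l * l * p = q * l * (q * t) by ring.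
Qed.

(** * From the generic stalk back to sections *)

Definition chart2_poly : A2 := 'X_(lshift r.+1 i0) * 'X_(rshift r.+1 i0).

Lemma bihomog_chart2 : bihomog 1 1 chart2_poly.
Proof. exact: (bihomogM (@bihomogXl _ _ _) (@bihomogXr _ _ _)). Qed.

Lemma basic_open_chart2 w :
  basic_open2 X chart2_poly w <-> chart w.1 /\ chart w.2.
Proof.
rewrite /basic_open2 /chart2_poly /= bievalM bievalXl bievalXr.
split=> [[X1 X2]|[[X1 n1] [X2 n2]]].
  by rewrite mulf_eq0 negb_or => /andP [n1 n2].
by split => //; rewrite mulf_neq0.
Qed.

Lemma regular2_at_coord z i : X z.1 -> X z.2 ->
  regular2_at X 1 z (fun w => w.2 0 i).
Proof.
move=> X1 X2.
exact: (@regular2_at_pr2 _ _ X 1%N z (fun y : pt => y 0 i) X1 (regular_atX i X2)).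
Qed.

Lemma regular2_at_normalize1 q z : chart z.1 -> chart z.2 ->
  regular2_at X 0 z (fun w => heval q (nz w.1)).
Proof.
move=> c1 [X2 _].
exact: (@regular2_at_pr1 _ _ X z (fun x => heval q (nz x)) X2
  (regular_at_normalize X0 q c1)).
Qed.

(** Up to a denominator in the first variable only, G is the restriction to the generic point of a
    function P on X x X. The factor y_i0 turns P into a section of pr_2^* L. *)
Definition lifts e (G : {mpoly K[r.+1]}) := exists q P,
  [/\ ~ J q, psi P = (phi q)%:MP * G &
  forall z, chart z.1 -> chart z.2 -> heval q (nz z.1) != 0 ->
    diag_power_at X e z (fun w => bieval P (nz2 w) * w.2 0 i0)].

Lemma lifts_ord0 G : lifts 0 G.
Proof.
have [q [P [hq PE]]] := clear_denominators G.
exists q, P; split=> [||z c1 c2 _]; [exact: hq|exact: PE|].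
apply: diag_power_at0 => //; apply: (@regular2_atM _ _ X 0 1).
  exact: regular2_at_normalize.
by case: c1 => X1 _; case: c2 => X2 _; exact: regular2_at_coord.
Qed.

Lemma lifts_ext e b H : J H -> lifts e (b * H^i).
Proof.
move=> JH; have [q [P [hq PE]]] := clear_denominators b.
exists q, (P * rpoly H); split=> [||z c1 c2 _]; first exact: hq.
  by rewrite psiM psi_rpoly PE mulrA.
have [X1 _] := c1; have [X2 _] := c2.
apply: (diag_power_at_ext X0 bihomog_chart2) (diag_power_at_zero e X1 X2).
  by apply/basic_open_chart2.
move=> w /basic_open_chart2 [_ cw]; rewrite bievalM bieval_rpoly /= JH //.
by rewrite mulr0 mul0r.
Qed.

Lemma liftsD e G H : lifts e G -> lifts e H -> lifts e (G + H).
Proof.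
move=> [q [P [hq PE dP]]] [q' [P' [hq' PE' dP']]].
exists (q * q'), (lpoly q' * P + lpoly q * P'); split.
- exact: JM.
- rewrite psiD !psiM !psi_lpoly PE PE' (rmorphM phi) mpolyCM.
  by move: ((phi q)%:MP) ((phi q')%:MP) => u v; ring.
move=> z c1 c2; rewrite hevalM mulf_eq0 negb_or => /andP [qz qz'].
have d1 := diag_power_atM X0 (regular2_at_normalize1 q' c1 c2) (dP z c1 c2 qz).
have d2 := diag_power_atM X0 (regular2_at_normalize1 q c1 c2) (dP' z c1 c2 qz').
apply: diag_power_at_eq (diag_power_atD X0 d1 d2) => w.
by rewrite bievalD !bievalM !bieval_lpoly /= !mulrA -mulrDl.
Qed.

(** The generator of m lifts to the difference of the i-th normalized coordinates of the two points,
    which vanishes on the diagonal. *)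
Lemma lifts_diag e i G : lifts e G -> lifts e.+1 (('X_i - (xg i)%:MP) * G).
Proof.
move=> [q [P [hq PE dP]]].
pose D : A2 := 'X_(rshift r.+1 i) - 'X_(lshift r.+1 i).
exists q, (D * P); split; first exact: hq.
  by rewrite psiM psiB psiXl psiXr PE mulrCA.
move=> z c1 c2 qz.
have rD := @regular2_at_normalize _ _ X i0 X0 D z c1 c2.
have D0 x : X x -> bieval D (nz2 (x, x)) = 0.
  by rewrite bievalB bievalXl bievalXr /= subrr.
apply: diag_power_at_eq (diag_power_at_diag X0 rD D0 (dP z c1 c2 qz)) => w.
by rewrite bievalM mulrA.
Qed.

Lemma lifts_pp_ideal e G : pp_ideal iota xg J e G -> lifts e G.
Proof.
have [_ _ _ J00 _] := chart_ideal_prime X0 hirr hchart.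
have L0 e' : lifts e' 0.
  by have := @lifts_ext e' 0 0 J00; rewrite mul0r.
elim: e G => [|e IH] G; first by move=> _; exact: lifts_ord0.
move=> [g [j [hg [c [b [H [hH ->]]]] ->]]]; apply: liftsD.
  elim/big_ind: _ => [|u v|i _]; [exact: L0|exact: liftsD|].
  by apply: lifts_diag; apply: IH; exact: hg.
by elim/big_ind: _ => [|u v|i _]; [exact: L0|exact: liftsD|exact: lifts_ext].
Qed.

Lemma stalk_taylor_kernel k (v : 'rV[K]_r.+1) : taylor_stalk iota xg J k v ->
  exists U (s : pt -> linforms R r),
  [/\ open_in X U, U !=set0, U `<=` chart, taylor_kernel X k U s &
      forall i, gen (fun x => s x 0 i) (v 0 i)].
Proof.
move=> /lifts_pp_ideal [q [P [hq PE dP]]].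
have /choice [f hf] : forall i, exists f, gen f (v 0 i).
  by move=> i; exact: generic_value_exists.
have [a [b [hb vE _]]] := generic_value_common hf.
pose s x : linforms R r := \row_i (heval (a i) (nz x) / heval b (nz x)).
have [U [oU U0 Uc UE]] := chart_open_basic X0 (JM hq hb).
have UE' x : U x -> [/\ chart x, heval q (nz x) != 0 & heval b (nz x) != 0].
  by move=> /UE [cx]; rewrite hevalM mulf_eq0 negb_or => /andP [].
have rs x i : U x -> regular_at X 0 x (fun u => s u 0 i).
  move=> /UE' [cx _ bx]; under eq_fun do rewrite mxE.
  exact: regular_at_normalize_frac.
exists U, s; split => //; last first.
  move=> i; exists (a i), b; split; [exact: hb|exact: vE|].
  by move=> x _ _; rewrite mxE.
apply/(taylor_kernelP X0) => //; split.
  by move=> i; apply: (regularP X0) => // x Ux; exact: rs.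
move=> z [Uz Xz2]; have [cz1 qz bz] := UE' _ Uz; have [Xz1 nz1] := cz1.
(* The kernel condition concerns all of U x X, including second points outside the chart. Such a z
   is off the diagonal: x_i0 y_j is nonzero while x_j y_i0 = 0, so there I_Delta imposes nothing. *)
have [z20|n2] := eqVneq (z.2 0 i0) 0.
  have [j yj] := exists_coord_neq0 X0 Xz2.
  apply: (@diag_power_at_offdiag _ _ X X0 _ z _ i0 j) => //.
    by rewrite z20 mulr0 mulf_neq0.
  by apply: regular2_at_contraction => // i; exact: rs.
have cz2 : chart z.2 by [].
pose T := linear_bipoly a.
(* Both products specialize to phi(q) phi(b) times the linear form of v. Equality under [psi] gives
   equality of values for first points in the chart and arbitrary second points. *)
have eqPT : psi (lpoly b * P - lpoly q * T) = 0.
  rewrite psiB !psiM !psi_lpoly PE psi_linear_bipoly /linear_mpoly.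
  rewrite mulrCA -mulrBr mulr_sumr.
  have E i : (phi b)%:MP * (v 0 i *: 'X_i) = (phi (a i))%:MP * 'X_i.
    rewrite vE -mul_mpolyC mulrA -mpolyCM; congr (_%:MP * _).
    by rewrite mulrC divfK //; exact: phi_neq0.
  by rewrite (eq_bigr _ (fun i _ => E i)) subrr mulr0.
have rq : regular2_at X 0 z (fun w => (heval q (nz w.1))^-1).
  apply: (@regular2_at_pr1 _ _ X z (fun x => (heval q (nz x))^-1)) => //.
  apply: (@regular_atV _ _ X z.1 (fun x => heval q (nz x))) => //.
  exact: regular_at_normalize.
have [d [h [hh hz hU]]] := open_in_basic X0 oU Uz.
have hN := bihomogM (bihomog_lpoly hh) bihomog_chart2.
have Nz : basic_open2 X (lpoly h * chart2_poly) z.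
  rewrite basic_open2M; split; last by apply/basic_open_chart2.
  by split => //; rewrite bieval_lpoly; case: hz.
apply: (diag_power_at_ext X0 hN Nz) (diag_power_atM X0 rq (dP z cz1 cz2 qz)).
move=> w; rewrite basic_open2M => -[[Xw1 Xw2 hw] /basic_open_chart2 [cw1 cw2]].
have [_ qw bw] : [/\ chart w.1, heval q (nz w.1) != 0 & heval b (nz w.1) != 0].
  by apply: UE'; apply: hU; split => //; rewrite bieval_lpoly in hw.
have /eqP := psi_eq0 eqPT (nz w.2) cw1.
rewrite bievalB !bievalM !bieval_lpoly subr_eq0 => /eqP /= E.
have [_ nw2] := cw2.
have -> : contraction s w =
    bieval T (nz2 w) / heval b (nz w.1) * w.2 0 i0.
  rewrite bieval_linear_bipoly /contraction !mulr_suml; apply: eq_bigr => i _.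
  rewrite !mxE /=; move: (heval (a i) _) (heval b _) bw => u t t0.
  by field; rewrite nw2 t0.
move: E; rewrite /normalize2.
move: (bieval P _) (bieval T _) (heval b _) (heval q _) bw qw => p t u l u0 l0 E.
have -> : p = l * t / u by rewrite -E mulrC mulKf.
by field; rewrite u0 l0.
Qed.

(** * The rank of R_k is the dimension of the generic stalk *)

Local Notation stalk := (taylor_stalk iota xg J).

Lemma generic_value0_open f : gen f 0 -> exists U,
  [/\ open_in X U, U !=set0 & forall x, U x -> f x = 0].
Proof.
move=> [a [b [hb E hE]]]; have [U [oU U0 _ UE]] := chart_open_basic X0 hb.
exists U; split => // x /UE [cx bx]; rewrite hE //.
move/esym/eqP: E; rewrite mulf_eq0 invr_eq0 (negbTE (phi_neq0 hb)) orbF.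
by move=> /eqP /phi0 ->; rewrite ?mul0r.
Qed.

(** Sections of R_k have degree -1 entries, which have no value in K; multiplication by x_i0 moves
    them to degree 0 and leaves linear relations unchanged. *)
Lemma Rsheaf_stalk k (M : 'M[K]_r.+1) U s :
  (forall v, stalk k v <-> (v <= M)%MS) -> open_in X U -> U !=set0 ->
  Rsheaf X k U s -> exists v : 'rV[K]_r.+1, (v <= M)%MS /\
    forall i, gen (fun u => u 0 i0 * s u 0 i) (v 0 i).
Proof.
move=> hM oU U0 hs; have [x Ux cx] := open_meets_chart X0 hirr hchart oU U0.
have [Xx _] := cx.
have [U' [c [g [t [[oU' U'x sub] [hgt hE]]]]]] := hs _ Ux.
have nU' : U' !=set0 by exists x.
have /choice [tau htau] : forall j, exists v : 'rV[K]_r.+1, (v <= M)%MS /\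
    forall i, gen (fun u => t j u 0 i) (v 0 i).
  move=> j; have [_ ht] := hgt j.
  have /choice [v hv] : forall i, exists v, gen (fun u => t j u 0 i) v.
    by move=> i; apply: (regular_at_generic_value (x := x)); exact: taylor_kernel_regular_at ht U'x.
  have hv' i : gen (fun u => t j u 0 i) ((\row_i v i) 0 i) by rewrite mxE.
  by exists (\row_i v i); split => //; apply/hM; exact: taylor_kernel_stalk ht hv'.
have /choice [ga hga] : forall j, exists k, gen (fun u => u 0 i0 * g j u) k.
  move=> j; have [hg _] := hgt j; apply: (regular_at_generic_value (x := x)).
  rewrite -[0](subrr 1); apply: regular_atM; first exact: regular_atX.
  exact: regular_atP hg U'x.
exists (\sum_j ga j *: tau j); split.
  by apply: summx_sub => j _; apply: scalemx_sub; case: (htau j).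
move=> i.
have -> : (\sum_j ga j *: tau j) 0 i = \sum_j ga j * tau j 0 i.
  by rewrite summxE; apply: eq_bigr => j _; rewrite mxE.
apply: (generic_value_ext (f := fun u => \sum_j (u 0 i0 * g j u) * t j u 0 i) oU' nU').
  move=> u /hE ->; rewrite summxE mulr_sumr; apply: eq_bigr => j _.
  by rewrite mxE mulrA.
by apply: generic_value_sum => j; apply: generic_valueM => //; case: (htau j).
Qed.

Lemma Rsheaf_generic_free k (M : 'M[K]_r.+1) :
  (forall v, stalk k v <-> (v <= M)%MS) ->
  generic_free_family X (Rsheaf X k) (\rank M).
Proof.
move=> hM; pose B := row_base M.
have /choice [Us hUs] : forall j, exists Us : set pt * (pt -> linforms R r),
    [/\ open_in X Us.1, Us.1 !=set0, Us.1 `<=` chart,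
        taylor_kernel X k Us.1 Us.2 &
        forall i, gen (fun x => Us.2 x 0 i) (B j i)].
  move=> j; have /stalk_taylor_kernel [U [s [h1 h2 h3 h4 h5]]] : stalk k (row j B).
    by apply/hM; rewrite (submx_trans (row_sub j B)) // eq_row_base.
  by exists (U, s); split => // i; have := h5 i; rewrite mxE.
pose s j := (Us j).2.
have [h [hch]] : exists U, [/\ open_in X U, U !=set0 & U `<=` chart].
  have nX : ~ J 1 by have [_ _ ? _ _] := chart_ideal_prime X0 hirr hchart.
  by have [U [h1 h2 h3 _]] := chart_open_basic X0 nX; exists U.
move=> h0 hc.
have hF j : open_in X (Us j).1 /\ (Us j).1 !=set0 by have [? ? _ _ _] := hUs j.
have [U [oU U0 Uc sU]] := open_common_fin X0 hirr hch h0 hF.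
have cU u : U u -> u 0 i0 != 0 by move=> /Uc /hc [].
exists U, (fun j (u : pt) => (u 0 i0)^-1 *: s j u); split => //.
  move=> j; have [_ _ _ ht _] := hUs j; apply: Rsheaf_scale => //.
  exact: (taylor_kernel_sub X0 oU (sU j) ht).
move=> U' f oU' U'0 U'U hf hE.
have [x U'x] := U'0.
have /choice [ka hka] : forall j, exists l, gen (f j) l.
  by move=> j; apply: (regular_at_generic_value (x := x)); exact: regular_atP (hf j) U'x.
have kB : (\row_j ka j) *m B = 0.
  apply/rowP => i; rewrite !mxE.
  have g1 : gen (fun u => \sum_j f j u * s j u 0 i) (\sum_j ka j * B j i).
    by apply: generic_value_sum => j; apply: generic_valueM => //; have [_ _ _ _] := hUs j; apply.
  have -> : \sum_j (\row_j ka j) 0 j * B j i = \sum_j ka j * B j i.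
    by apply: eq_bigr => j _; rewrite mxE.
  apply: (generic_value_uniq g1).
  have := generic_valueC 0; rewrite rmorph0; apply: (generic_value_ext oU' U'0) => u U'u.
  have ui := cU _ (U'U _ U'u).
  have := congr1 (fun v : 'rV_r.+1 => v 0 i) (hE _ U'u).
  rewrite summxE mxE => /(congr1 (fun c => u 0 i0 * c)).
  rewrite mulr0 mulr_sumr => E; rewrite -[LHS]E; apply: eq_bigr => j _.
  by rewrite !mxE; move: (f j u) (s j u 0 i) (u 0 i0) ui => a b c c0; field.
have /rowP k0 : \row_j ka j = 0.
  by apply: (row_free_inj (row_base_free M)); rewrite kB mul0mx.
move=> j u U'u; apply: (generic_value0_regular_at (f := f j)).
  exact: regular_atP (hf j) U'u.
by have := k0 j; rewrite !mxE => <-.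
Qed.

Lemma Rsheaf_not_generic_free k (M : 'M[K]_r.+1) :
  (forall v, stalk k v <-> (v <= M)%MS) ->
  ~ generic_free_family X (Rsheaf X k) (\rank M).+1.
Proof.
move=> hM [U [s [oU U0 hs free]]].
have /choice [v hv] : forall j, exists v : 'rV[K]_r.+1, (v <= M)%MS /\
    forall i, gen (fun u => u 0 i0 * s j u 0 i) (v 0 i).
  by move=> j; exact: Rsheaf_stalk hM oU U0 (hs j).
pose B := \matrix_j v j.
have BM : (B <= M)%MS.
  by apply/row_subP => j; rewrite rowK; case: (hv j).
have [ka [kB nka]] : exists ka : 'rV[K]_(\rank M).+1, ka *m B = 0 /\ ka != 0.
  apply: contrapT => ex.
  have : row_free B.
    apply: inj_row_free => u uB; apply/eqP/negPn/negP => nu.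
    by apply: ex; exists u.
  by rewrite /row_free => /eqP rB; have := mxrankS BM; rewrite rB ltnn.
have /choice [f hf] : forall j, exists f, gen f (ka 0 j).
  by move=> j; exact: generic_value_exists.
have /choice [Uf hUf] : forall j, exists V, [/\ open_in X V, V !=set0 &
    forall x, V x -> regular_at X 0 x (f j)].
  by move=> j; have [V [? ? _ ?]] := generic_value_regular (hf j); exists V.
have /choice [Uz hUz] : forall i, exists V, [/\ open_in X V, V !=set0 &
    forall x, V x -> \sum_j f j x * (x 0 i0 * s j x 0 i) = 0].
  move=> i; apply: generic_value0_open.
  have <- : \sum_j ka 0 j * v j 0 i = 0.
    have := congr1 (fun Z : 'rV_r.+1 => Z 0 i) kB; rewrite !mxE => h.
    by rewrite -[RHS]h; apply: eq_bigr => j _; rewrite !mxE.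
  by apply: generic_value_sum => j; apply: generic_valueM => //; have [_] := hv j; apply.
have [x Ux cx] := open_meets_chart X0 hirr hchart oU U0.
have oi := open_basic X0 (dhomogXi (R := R) (r := r) i0).
have ix : basic_open X 'X_i0 x.
  by case: cx => Xx xi; split => //; rewrite hevalXU.
have [Uc [oUc Ucx UcU Uci]] := open_inI X0 oU oi Ux ix.
have Uc0 : Uc !=set0 by exists x.
(* The relation over K is spread out to a nonempty open set: first all its coefficients become
   regular, then all its coordinates vanish. Only finitely many conditions occur. *)
have [U1 [o1 n1 s1 sf]] := open_common_fin X0 hirr oUc Uc0
  (fun j => let: And3 a b _ := hUf j in conj a b).
have [U2 [o2 n2 s2 sz]] := open_common_fin X0 hirr o1 n1
  (fun i => let: And3 a b _ := hUz i in conj a b).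
have U2c u : U2 u -> u 0 i0 != 0.
  by move=> /s2 /s1 /Uci [_]; rewrite hevalXU.
have f0 : forall j u, U2 u -> f j u = 0.
  apply: (free U2 f o2 n2).
  - by move=> u /s2 /s1 /UcU.
  - move=> j; apply: (regularP X0) => // u U2u; have [_ _] := hUf j; apply.
    exact: (sf j _ (s2 _ U2u)).
  - move=> u U2u; apply/rowP => i; rewrite summxE mxE.
    have [_ _ /(_ _ (sz i _ U2u)) E] := hUz i.
    apply: (mulfI (U2c _ U2u)); rewrite mulr0 -[RHS]E mulr_sumr.
    by apply: eq_bigr => j _; rewrite mxE mulrCA.
move/eqP: nka; apply; apply/rowP => j; rewrite mxE.
apply: (generic_value_uniq (hf j)); have := generic_valueC 0; rewrite rmorph0.
by apply: (generic_value_ext o2 n2) => u /f0 ->.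
Qed.

Lemma Rsheaf_has_rank k (M : 'M[K]_r.+1) :
  (forall v, stalk k v <-> (v <= M)%MS) -> has_rank X (Rsheaf X k) (\rank M).
Proof.
by move=> hM; split; [exact: Rsheaf_generic_free|exact: Rsheaf_not_generic_free].
Qed.

Definition linear_form (T : linforms R r) : A := \sum_i T 0 i *: 'X_i.

Lemma heval_linear_form T x : heval (linear_form T) x = lin_eval T x.
Proof.
rewrite /heval /linear_form raddf_sum /lin_eval; apply: eq_bigr => i _.
by rewrite /= mevalZ mevalXU.
Qed.

Lemma dhomog_linear_form T : linear_form T \is 1.-homog.
Proof. by apply: rpred_sum => i _; apply: dhomogZ; exact: dhomogXi. Qed.

Lemma map_linear_form T : (linear_form T)^i = linear_mpoly (map_mx iota T).
Proof.
rewrite /linear_form /linear_mpoly raddf_sum; apply: eq_bigr => i _.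
by rewrite /= map_mpolyZ map_mpolyX mxE.
Qed.

Lemma stalk_const k T : (forall x, X x -> lin_eval T x = 0) ->
  stalk k (map_mx iota T).
Proof.
move=> hT; rewrite /taylor_stalk /mkset -map_linear_form -[_^i]mul1r.
apply/pp_ideal_ext/ext_ideal_gen => x [Xx x0].
by have := hT _ Xx; rewrite -heval_linear_form (heval_normalize (dhomog_linear_form T) x0)
  => /eqP; rewrite mulf_eq0 expf_eq0 (negbTE x0) => /eqP.
Qed.

(** An element of the ideal vanishes at the generic point, so [phi] kills the constant linear form;
    being homogeneous and in J, the form vanishes on X. *)
Lemma stalk_const_vanish k T : stalk k (map_mx iota T) ->
  forall x, X x -> lin_eval T x = 0.
Proof.
rewrite /taylor_stalk /mkset -map_linear_form => h x Xx.
have : (linear_form T)^i.@[xg] = 0.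
  by apply: pp_ideal_vanish h => H JH; rewrite map_iota_eval; apply/phi0.
rewrite map_iota_eval -heval_linear_form => /phi0 JT.
exact: (chart_ideal_homog X0 hirr hchart (dhomog_linear_form T) JT).
Qed.

(** * The stable stalk and the linear forms vanishing on X *)

Section Stable.
Variables (W : {vspace linforms R r}).
Hypothesis hW : forall T, T \in W <-> forall x, X x -> lin_eval T x = 0.

Local Notation WK := (map_mx iota (vbasis_mx W)).

Lemma vanishing_sub_stalk k (M : 'M[K]_r.+1) :
  (forall v, stalk k v <-> (v <= M)%MS) -> (WK <= M)%MS.
Proof.
move=> hM; apply/row_subP => i; rewrite -map_row; apply/hM; apply: stalk_const.
by apply/hW; rewrite row_vbasis_mx; apply: vbasis_mem; rewrite mem_nth // size_tuple.
Qed.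

Lemma stable_stalk k (M M' : 'M[K]_r.+1) :
  (forall v, stalk k v <-> (v <= M)%MS) ->
  (forall v, stalk k.+1 v <-> (v <= M')%MS) ->
  \rank M' = \rank M -> (M <= WK)%MS.
Proof.
move=> hM hM' rk.
have M'M : (M' <= M)%MS.
  by apply/row_subP => i; apply/hM; apply: taylor_stalk_weak; apply/hM'; exact: row_sub.
have MM' : (M <= M')%MS.
  by have [_ <-] := mxrank_leqif_sup M'M; rewrite rk.
have [||B BM] := @derivation_stable_descent _ _ iota _ M.
- by move=> g; exact: constant_of_derivations char0_K.
- move=> D v dD vM; apply/hM; apply: taylor_stalk_derivation => //.
  by apply/hM'; exact: submx_trans MM'.
rewrite -BM; apply: (submx_trans _ (_ : map_mx iota B <= _)%MS) => //.
rewrite map_submx; apply/row_subP => i; rewrite sub_vbasis_mx; apply/hW.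
by apply: (@stalk_const_vanish k); apply/hM; rewrite map_row -BM row_sub.
Qed.

(** The linear equations of W, given by its cokernel matrix over C, applied to t are regular
    functions with zero germ; they vanish at each point of U, not just generically. *)
Lemma stalk_mem k (M : 'M[K]_r.+1) U t x :
  (forall v, stalk k v <-> (v <= M)%MS) -> (M <= WK)%MS ->
  open_in X U -> taylor_kernel X k U t -> U x -> t x \in W.
Proof.
move=> hM MW oU ht Ux.
have U0 : U !=set0 by exists x.
have rt i : regular_at X 0 x (fun u => t u 0 i).
  exact: taylor_kernel_regular_at ht Ux.
have /choice [v hv] : forall i, exists v, gen (fun u => t u 0 i) v.
  by move=> i; exact: regular_at_generic_value.
have hv' i : gen (fun u => t u 0 i) ((\row_i v i) 0 i) by rewrite mxE.
have vM : (\row_i v i <= WK)%MS.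
  by apply: submx_trans MW; apply/hM; exact: taylor_kernel_stalk ht hv'.
rewrite -sub_vbasis_mx; rewrite submxE in vM; rewrite submxE.
apply/eqP/rowP => j; rewrite !mxE.
pose Q := cokermx (vbasis_mx W).
have rQ i : regular_at X 0 x (fun=> Q i j) by apply: regular_atC; exact: (open_sub oU).
apply: (generic_value0_regular_at (f := fun u => \sum_i t u 0 i * Q i j)).
  apply: regular_at_sum => //; first exact: (open_sub oU).
  by move=> i; exact: (@regular_atM _ _ X 0 0).
have := congr1 (fun Z : 'rV_r.+1 => Z 0 j) (eqP vM).
rewrite -map_cokermx !mxE => <-.
by apply: generic_value_sum => i; rewrite !mxE; apply: generic_valueM => //; exact: generic_valueC.
Qed.

End Stable.

End FunctionField.

(** [m] is the least index >= 1 with c m.+1 = c m. Without one, c j.+1 + j <= c 1 would hold for all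
    j. *)
Lemma eventually_stationary (c : nat -> nat) : (forall i, (c i.+1 <= c i)%N) ->
  exists m, [/\ (1 <= m)%N, c m.+1 = c m &
    forall i, (1 <= i < m)%N -> (c i.+1 < c i)%N].
Proof.
move=> hc.
have ex : exists m, (0 < m)%N && (c m.+1 == c m).
  apply: contrapT => nex.
  have lt i : (0 < i)%N -> (c i.+1 < c i)%N.
    move=> i0; rewrite ltn_neqAle hc andbT; apply/negP => e; apply: nex.
    by exists i; rewrite i0.
  have bd j : (c j.+1 + j <= c 1%N)%N.
    elim: j => [|j IH]; first by rewrite addn0.
    by apply: leq_trans IH; rewrite addnS -addSn leq_add2r lt.
  by have := bd (c 1%N).+1; rewrite addnS ltnNge leq_addl.
case: (ex_minnP ex) => m /andP [m0 /eqP hm] minm; exists m; split => // i.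
move=> /andP [i0 im]; rewrite ltn_neqAle hc andbT; apply/negP => e.
by have := minm i; rewrite i0 e => /(_ isT); rewrite leqNgt im.
Qed.

Theorem proposition2p6 (R : realType) (r n : nat) (X : set (coords R r))
    (hX : quasi_projective_variety X)
    (hdim : has_dimension X n) (hn : (1 <= n)%N) :
  exists c : nat -> nat,
    (forall k, has_rank X (Rsheaf X k) (c k)) /\
    exists m : nat,
      [/\ (1 <= m)%N,
          forall i, (1 <= i < m)%N -> (c i.+1 < c i)%N,
          forall i, (m <= i)%N -> c i = c m &
          [/\ c m = 0%N,
              sheaf_zero X (Rsheaf X m) &
              ~ exists W : {vspace linforms R r},
                  lin_subspace W `<` projective_space /\ X `<=` lin_subspace W]
          \/
          (0 < c m)%N /\
          exists W : {vspace linforms R r},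
            [/\ \dim W = c m,
                sheaf_eq X (twist X 1 (Rsheaf X m)) (Wtensor X W),
                forall i, sheaf_sub X (Wtensor X W)
                               (twist X 1 (Rsheaf X i)) &
                X `<=` lin_subspace W]].
Proof.
have X0 : X `<=` [set x | x != 0].
  by case: hX => [[Z1 [Z2 [[S [_ ->]] _ ->]]] _] x [[]].
have hirr : irreducible_set X by case: hX.
have [x1 Xx1] : X !=set0 by case: hirr.
have [i0 x1i0] := exists_coord_neq0 X0 Xx1.
have hchart : chart X i0 !=set0 by exists x1.
have [K [phi [phi0 phi_frac]]] :=
  prime_ideal_fraction_field (chart_ideal_prime X0 hirr hchart).
pose stalk := taylor_stalk (const_morph phi) (generic_pt phi) (chart_ideal X i0).
have /choice [M hM] : forall k, exists M : 'M[K]_r.+1,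
    forall v, stalk k v <-> (v <= M)%MS.
  by move=> k; exact: taylor_stalk_submx.
have [W hW] : exists W : {vspace linforms R r}, forall T,
    T \in W <-> forall x, X x -> lin_eval T x = 0.
  apply: vspace_of_linear_set => [x _|u v hu hv x Xx|a v hv x Xx].
  - by rewrite /lin_eval big1 // => i _; rewrite mxE mul0r.
  - rewrite -[RHS](addr0 0) -{1}(hu x Xx) -(hv x Xx) /lin_eval -big_split /=.
    by apply: eq_bigr => i _; rewrite mxE mulrDl.
  - rewrite -[RHS](mulr0 a) -(hv x Xx) /lin_eval mulr_sumr.
    by apply: eq_bigr => i _; rewrite mxE mulrA.
have hW' T x : T \in W -> X x -> lin_eval T x = 0 by move=> /hW; apply.
pose c k := \rank (M k); exists c; split.
  by move=> k; exact: (Rsheaf_has_rank X0 hirr hchart phi0 phi_frac (hM k)).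
have dec k : (c k.+1 <= c k)%N.
  apply: mxrankS; apply/row_subP => i; apply/(hM k); apply: taylor_stalk_weak.
  by apply/(hM k.+1); exact: row_sub.
(* Extending scalars preserves rank, and W (x) K lies in every stalk; this bound stops the sequence
   from dropping again after [m]. *)
have Wc k : (\dim W <= c k)%N.
  rewrite -rank_vbasis_mx -(mxrank_map (const_morph phi)); apply: mxrankS.
  exact: (vanishing_sub_stalk hW (hM k)).
have [m [m1 cm strict]] := eventually_stationary dec; exists m.
have MW := stable_stalk X0 hirr hchart phi0 hW (hM m) (hM m.+1) cm.
have dimW : \dim W = c m.
  apply/eqP; rewrite eqn_leq Wc -rank_vbasis_mx -(mxrank_map (const_morph phi)).
  exact: mxrankS.
have kerW U t x : open_in X U -> taylor_kernel X m U t -> U x -> t x \in W.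
  exact: (stalk_mem X0 hirr hchart phi0 (hM m) MW).
have RW U t x : open_in X U -> Rsheaf X m U t -> U x -> t x \in W.
  by move=> _; exact: (twist_mem kerW).
split => //.
  (* Squeezed: c m = dim W <= c i <= c m. *)
  move=> i mi; apply/eqP; rewrite eqn_leq -{2}dimW Wc andbT.
  elim: i mi => [|i IH]; first by rewrite leqn0 => /eqP ->.
  rewrite leq_eqVlt => /orP [/eqP <- //|].
  by rewrite ltnS => /IH; exact: leq_trans (dec i).
have [c0|c0] := posnP (c m).
  have W0 : W = 0%VS by apply/eqP; rewrite -dimv_eq0 dimW c0.
  left; split => //.
    by move=> U oU s hs x Ux; apply/eqP; rewrite -memv0 -W0; exact: RW hs Ux.
  (* The forms in W' vanish on X, hence lie in W = 0, so W' cuts out all of projective space. *)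
  move=> [W' [[_ nsub] XW']]; apply: nsub => x x0; split => // T TW'.
  have : T \in W by apply/hW => y /XW' [_]; apply.
  rewrite W0 memv0 => /eqP ->.
  by rewrite /lin_eval big1 // => i _; rewrite mxE mul0r.
right; split => //; exists W; split => //.
- move=> U oU; apply/seteqP; split => s; last exact: (Wtensor_sub X0 hW').
  move=> hs; apply: (Wtensor_intro X0) => // [x Ux|x i Ux].
    exact: (twist_mem RW hs).
  exact: (untwisted_regular_at X0 i hs).
- by move=> i; exact: Wtensor_sub.
- by move=> x Xx; split => [|T TW]; [exact: X0|exact: hW'].
Qed.
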